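(* Let $\ell\ge 5$ and $r\neq\ell$ be primes, let $V$ be a $2g$-dimensional $\mathbb{F}_\ell$-vector space with a non-degenerate alternating form, and let $\zeta\in\mathrm{Sp}_{2g}(\ell)$ have characteristic polynomial $(x^{r-1}+\cdots+x+1)^n$ with $n=\frac{2g}{r-1}\ge 4$. Write $C_{\mathrm{Sp}_{2g}(\ell)}(\zeta)\cong G_1\times\cdots\times G_t$ as described below. Let $H$ be a subgroup of $C_{\mathrm{Sp}_{2g}(\ell)}(\zeta)$ such that for each $j$ the projection $H_j$ of $H$ onto $G_j$ contains the commutator subgroup $S_j$ of $G_j$. Suppose there is $\tau\in H$ such that for each $j$ its projection to $G_j$ has exactly one non-trivial eigenvalue, this eigenvalue having order $r$, and such that, viewed as an element of $\mathrm{Sp}_{2g}(\ell)$, the non-trivial eigenvalues of $\tau$ are $\zeta_r,\zeta_r^2,\dots,\zeta_r^{r-1}$ (each occurring once), where $\zeta_r\in\overline{\mathbb{F}}_\ell$ is a primitive $r$-th root of unity. Then $H\supseteq S_1\times\cdots\times S_t$.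
   Context: Let $i$ be the order of $\ell$ modulo $r$ (the inertia degree of $\ell$ in $\mathbb{Q}(\zeta_r)$). Factor $x^{r-1}+\cdots+1=\phi_1\cdots\phi_s$ into irreducibles of degree $i$ over $\mathbb{F}_\ell$ and let $U_k=\ker\phi_k(\zeta)$, an $n$-dimensional $\mathbb{F}_{\ell^i}$-vector space via $\mathbb{F}_\ell[\zeta]/(\phi_k)\cong\mathbb{F}_{\ell^i}$. If $i$ is odd, the $\phi_k$ come in pairs $\{\phi,\bar\phi\}$ ($\bar\phi$ having the inverse roots), $t=s/2$, and $C_{\mathrm{Sp}_{2g}(\ell)}(\zeta)\cong\mathrm{GL}_n(\ell^i)^t$, the $j$-th factor $G_j$ acting on $U\oplus U^*$ (for the $j$-th pair) by $A$ on $U$ and $A^{-T}$ on $U^*$; if $i$ is even, $t=s$, each $U_k$ carries a non-degenerate unitary form and $C_{\mathrm{Sp}_{2g}(\ell)}(\zeta)\cong\mathrm{GU}_n(\ell^{i/2})^t$. The projection to $G_j$ is the restriction to the corresponding $n$-dimensional $\mathbb{F}_{\ell^i}$-space, and its eigenvalues are taken in this $\mathbb{F}_{\ell^i}$-linear sense. $S_j$ is $\mathrm{SL}_n(\ell^i)$ resp. $\mathrm{SU}_n(\ell^{i/2})$. *)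

(* Defs.v *)
From HB Require Import structures.
From mathcomp Require Import all_boot all_order all_fingroup all_algebra all_solvable all_field.

Set Implicit Arguments.
Unset Strict Implicit.
Unset Printing Implicit Defensive.

Import GroupScope GRing.Theory.
Local Open Scope ring_scope.

(* Vectors are rows and matrices act on the right, as usual in MathComp. *)

Section Symplectic.
Variables (F : finFieldType) (d : nat).

Definition alternating (J : 'M[F]_d) : Prop :=
  forall v : 'rV[F]_d, v *m J *m v^T = 0.

Definition Sp (J : 'M[F]_d.+1) : {set {'GL_d.+1[F]}} :=
  [set A : {'GL_d.+1[F]} | GLval A *m J *m (GLval A)^T == J].

Lemma Sp_group_set J : group_set (Sp J).
Proof.
apply/group_setP; split=> [|A B]; first by rewrite inE /= trmx1 mul1mx mulmx1.
rewrite !inE /= => /eqP hA /eqP hB; apply/eqP.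
rewrite -[RHS]hA -{2}hB trmx_mul !mulmxA //.
Qed.
Canonical Sp_group J := Group (Sp_group_set J).

End Symplectic.

Section Factors.
Variable F : fieldType.

Definition geom_poly (r : nat) : {poly F} := \sum_(k < r) 'X^k.

(* The monic polynomial whose roots are the inverses of those of p, for
   p`_0 != 0. *)
Definition recip (p : {poly F}) : {poly F} := (p`_0)^-1 *: Poly (rev p).

(* phi picks one member of every pair {p, recip p} of monic irreducible
   factors of P; self-reciprocal factors make up a pair on their own. *)
Definition factor_reps (P : {poly F}) (t : nat) (phi : 'I_t -> {poly F}) : Prop :=
  (forall j, phi j %| P)
  /\ (forall p : {poly F}, monic_irreducible_poly p -> p %| P ->
        exists! j, p = phi j \/ p = recip (phi j)).

End Factors.

Section Kernel.
Variables (F : fieldType) (d : nat) (Z : 'M[F]_d.+1) (p : {poly F}).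

Definition in_ker_horner : {pred 'rV[F]_d.+1} :=
  fun v => v *m horner_mx Z p == 0.

Record ker_horner : predArgType :=
  KerHorner { ker_val :> 'rV[F]_d.+1; _ : in_ker_horner ker_val }.

HB.instance Definition _ := [isSub for ker_val].
HB.instance Definition _ := [Choice of ker_horner by <:].

Fact in_ker_horner_zmod_closed : zmod_closed in_ker_horner.
Proof.
split=> [|u v]; rewrite !unfold_in ?mul0mx // mulmxBl => /eqP-> /eqP->.
by rewrite subr0.
Qed.
HB.instance Definition _ :=
  GRing.isZmodClosed.Build 'rV[F]_d.+1 in_ker_horner in_ker_horner_zmod_closed.
HB.instance Definition _ := [SubChoice_isSubZmodule of ker_horner by <:].

(* The same kernel, as a vector space over the field F[X]/(p): the class of a
   polynomial q acts as q(Z). *)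
Definition Uspace : monic_irreducible_poly p -> predArgType :=
  fun=> ker_horner.

Hypothesis p_mi : monic_irreducible_poly p.
Local Notation K := {poly %/ p with p_mi}.
Local Notation U := (Uspace p_mi).

HB.instance Definition _ := SubChoice.on U.
HB.instance Definition _ := GRing.SubZmodule.on U.

Fact Uscale_subproof (a : K) (u : U) :
  in_ker_horner (ker_val u *m horner_mx Z (a : {poly F})).
Proof.
case: u => u /= /eqP u0; apply/eqP.
by rewrite -mulmxA mulmxE -rmorphM mulrC rmorphM -mulmxE mulmxA u0 mul0mx.
Qed.
Definition Uscale (a : K) (u : U) : U := KerHorner (Uscale_subproof a u).

Lemma mul_ker_modp (u : U) (q : {poly F}) :
  ker_val u *m horner_mx Z (q %% p) = ker_val u *m horner_mx Z q.
Proof.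
case: u => u /= /eqP u0; rewrite {2}(divp_eq q p) mulrC rmorphD rmorphM /=.
by rewrite mulmxDr -mulmxE mulmxA u0 mul0mx add0r.
Qed.

Fact UscaleA (a b : K) (u : U) : Uscale a (Uscale b u) = Uscale (a * b) u.
Proof.
have rmodE (q : {poly F}) : Pdiv.CommonRing.rmodp q (mk_monic p) = q %% p.
  by rewrite mk_monicE // Pdiv.IdomainMonic.modpE //; case: p_mi.
apply/val_inj; rewrite /= rmodE mul_ker_modp mulrC rmorphM.
by rewrite -mulmxE mulmxA.
Qed.
Fact Uscale1 : left_id (1 : K) Uscale.
Proof. by move=> u; apply/val_inj; rewrite /= rmorph1 mulmx1. Qed.
Fact UscaleDr : right_distributive Uscale +%R.
Proof. by move=> a u v; apply/val_inj; rewrite /= mulmxDl. Qed.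
Fact UscaleDl u : {morph Uscale^~ u : a b / a + b}.
Proof. by move=> a b; apply/val_inj; rewrite /= rmorphD mulmxDr. Qed.
HB.instance Definition _ :=
  GRing.Zmodule_isLmodule.Build K U UscaleA Uscale1 UscaleDr UscaleDl.

Lemma ker_valZ (a : K) (u : U) :
  ker_val (a *: u) = ker_val u *m horner_mx Z (a : {poly F}).
Proof. by []. Qed.

(* U has dimension n over K, and in some (hence any) K-basis the K-linear
   endomorphism of U induced by T has characteristic polynomial chi. *)
Definition char_poly_on (n : nat) (T : 'M[F]_d.+1) (chi : {poly K}) : Prop :=
  exists (A : 'M[K]_n) (e : {linear 'rV[K]_n -> U}),
    [/\ bijective e,
        forall v, ker_val (e (v *m A)) = ker_val (e v) *m T
      & char_poly A = chi].

(* Eigenvalues are counted with multiplicity. *)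
Definition one_nontrivial_eigenvalue_of_order (r n : nat) (T : 'M[F]_d.+1) : Prop :=
  exists lambda : K, r.-primitive_root lambda
    /\ char_poly_on n T (('X - 1) ^+ n.-1 * ('X - lambda%:P)).

End Kernel.

Section CentralizerFactors.
Variables (F : finFieldType) (d : nat) (J : 'M[F]_d.+1) (zeta : {'GL_d.+1[F]}).
Variables (t : nat) (phi : 'I_t -> {poly F}).

(* The row space of Wmx j is U if phi j is self-reciprocal, and U (+) U^*
   otherwise, where U is the kernel of (phi j)(zeta). *)
Definition Wmx (j : 'I_t) : 'M[F]_d.+1 :=
  (kermx (horner_mx (GLval zeta) (phi j))
   + kermx (horner_mx (GLval zeta) (recip (phi j))))%MS.

(* G_j as the subgroup of the centralizer of zeta that acts trivially on the
   other summands W_k. *)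
Definition Gfactor (j : 'I_t) : {set {'GL_d.+1[F]}} :=
  [set A in 'C_(Sp J)[zeta] |
    [forall k, (k != j) ==> (Wmx k *m GLval A == Wmx k)]].

Lemma Gfactor_group_set j : group_set (Gfactor j).
Proof.
apply/group_setP; split=> [|A B].
  rewrite inE group1 /=; apply/forallP=> k; apply/implyP=> _.
  by rewrite mulmx1.
move=> /setIdP[CA /forallP fixA] /setIdP[CB /forallP fixB].
apply/setIdP; split; first exact: groupM; apply/forallP=> k; apply/implyP=> neq_kj.
have /eqP WA := implyP (fixA k) neq_kj; have /eqP WB := implyP (fixB k) neq_kj.
by rewrite mulmxA WA WB.
Qed.
Canonical Gfactor_group j := Group (Gfactor_group_set j).

Definition Sfactor (j : 'I_t) : {set {'GL_d.+1[F]}} :=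
  [~: Gfactor j, Gfactor j]%g.

(* The image of H under the projection of the centralizer onto G_j, that is,
   under restriction to W_j. *)
Definition proj_factor (H : {set {'GL_d.+1[F]}}) (j : 'I_t) : {set {'GL_d.+1[F]}} :=
  [set A in Gfactor j |
    [exists h in H, Wmx j *m GLval A == Wmx j *m GLval h]].

End CentralizerFactors.

(* Main.v *)
(** Restriction to U_j maps the centralizer of zeta onto a group Gamma_j that
    is GL_n(K_j), or the unitary group of a skew-hermitian form when phi_j is
    self-reciprocal.  The commutator subgroup of Gamma_j is perfect, and every
    subgroup of Gamma_j that it normalizes is scalar or contains it (transvections,
    resp. Siegel transvections).  By Goursat's argument it is enough to exclude,
    for j <> k, that the elements of H trivial on U_j act by scalars on U_k and
    vice versa, i.e. that H identifies Gamma_j' and Gamma_k' modulo scalars.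

    A suitable power of tau acts on each U_j as a reflection with eigenvalue
    lambda_j.  It normalizes an l-subgroup Q of Gamma_j', not centralized by tau,
    on which the minimal polynomial m of lambda_j over F_l, evaluated at
    conjugation by tau, vanishes modulo Q'.  The identification carries Q to an
    l-subgroup P of Gamma_k with the same property.  But conjugation by a
    reflection with eigenvalue lambda_k has only the eigenvalues 1, lambda_k and
    1/lambda_k on matrices, so P is trivial unless m vanishes at one of them.  The
    value 1 is excluded because lambda_j <> 1; for the others, a root mu of m would
    be an eigenvalue of tau both on U_j and on U_k or its dual, while the
    non-trivial eigenvalues of tau on the whole space are simple. *)
Require Import Defs.
From HB Require Import structures.
From mathcomp Require Import all_boot all_order all_fingroup all_algebra all_solvable all_field.
From mathcomp Require Import mxrepresentation mxabelem.
From mathcomp Require Import ring zify.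

Set Implicit Arguments.
Unset Strict Implicit.
Unset Printing Implicit Defensive.

Import GroupScope GRing.Theory.
Local Open Scope ring_scope.

(** * A Goursat lemma *)

(** An identification of [Gamma_j'] with [Gamma_k'] modulo scalars is given only as an abstract
    isomorphism. Rather than classifying such isomorphisms, the argument uses only what all of them
    preserve: group words. Words have integer exponents, which is why the minimal polynomial is
    taken over the prime field. Scalars have order prime to l, so the ambiguity modulo scalars
    disappears on l-subgroups. Working modulo [Q'] is forced by the unitary case, where the Siegel
    transvections attached to an isotropic vector form a non-abelian group of Heisenberg type.

    The power of [tau] is needed because a characteristic polynomial does not exclude a unipotent
    part; its exponent is a large power of l congruent to 1 modulo r.

    The case r = 2 stands apart: there X^2 = 1 in the field, the involution X |-> 1/X is trivial and
    the form is symplectic instead of unitary. But then there is only one factor, and nothing has to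
    be separated. *)

Section Goursat.
Local Open Scope group_scope.

Variables (I : finType) (gT : finGroupType) (rT : I -> finGroupType).
Variables (C H : {group gT}) (rho : forall j, {morphism C >-> rT j}).
Variable Z : forall j, {group rT j}.

Definition partial_kernel (s : seq I) : {set gT} :=
  [set h in H | all (fun k => rho k h == 1) s].

Definition partial_image (j k : I) : {set rT j} := rho j @* partial_kernel [:: k].

Hypothesis sHC : H \subset C.

Lemma partial_kernel_group_set s : group_set (partial_kernel s).
Proof.
apply/group_setP; split=> [|x y]; rewrite !inE.
  by rewrite group1; apply/allP=> k _; rewrite morph1.
case/andP=> Hx /allP sx /andP[Hy /allP sy]; rewrite groupM //=.
apply/allP=> k ks; rewrite morphM ?(subsetP sHC) //.
by rewrite (eqP (sx k ks)) (eqP (sy k ks)) mulg1.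
Qed.
Canonical partial_kernel_group s := Group (partial_kernel_group_set s).

Lemma partial_kernel_sub s : partial_kernel s \subset H.
Proof. by apply/subsetP=> x; rewrite inE => /andP[]. Qed.

Lemma partial_kernelR s x y : x \in partial_kernel s -> y \in H ->
  [~ x, y] \in partial_kernel s.
Proof.
rewrite !inE => /andP[Hx /allP sx] Hy; rewrite groupR //=; apply/allP=> k ks.
by rewrite morphR ?(subsetP sHC) // (eqP (sx k ks)) comm1g.
Qed.

Lemma partial_kernel_norm s : H \subset 'N(partial_kernel s).
Proof.
apply/subsetP=> y Hy; rewrite inE; apply/subsetP=> _ /imsetP[x Kx ->].
have Hx : x \in H by move: Kx; rewrite inE => /andP[].
by rewrite -[x ^ y](mulKVg x) -/(commg x y) groupM ?partial_kernelR.
Qed.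

Lemma partial_kernel_cons k s x : x \in partial_kernel [:: k] ->
  x \in partial_kernel s -> x \in partial_kernel (k :: s).
Proof. by rewrite !inE /= => /and3P[-> -> _] /andP[_ ->]. Qed.

Hypothesis Sperf : forall j,
  (rho j @* C)^`(1) \subset [~: (rho j @* C)^`(1), (rho j @* C)^`(1)].
Hypothesis SnZ : forall j, ~~ ((rho j @* C)^`(1) \subset Z j).
Hypothesis normal_dichotomy : forall j (N : {group rT j}), N \subset rho j @* C ->
  (rho j @* C)^`(1) \subset 'N(N) -> N \subset Z j \/ (rho j @* C)^`(1) \subset N.
Hypothesis sSH : forall j, (rho j @* C)^`(1) \subset rho j @* H.
Hypothesis not_both_small : forall j k, j != k ->
  ~ (partial_image j k \subset Z j /\ partial_image k j \subset Z k).

Lemma partial_image_dichotomy j k : partial_image j k \subset Z j \/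
  (rho j @* C)^`(1) \subset partial_image j k.
Proof.
apply: (@normal_dichotomy j (rho j @* _)%G).
  by rewrite morphimS // (subset_trans (partial_kernel_sub _)).
by rewrite (subset_trans (sSH j)) // morphim_norms // partial_kernel_norm.
Qed.

(** Suppose the image at [j] is small. Then the one at [k] contains the derived group, and any
    commutator of elements of [H] can be corrected at [k] by an element trivial at [j]. Hence the
    perfect derived group at [j] consists of images of elements trivial at [k], and is small
    itself. *)
Lemma partial_image_full j k : j != k -> (rho j @* C)^`(1) \subset partial_image j k.
Proof.
move=> jk; case: (partial_image_dichotomy j k) => // jkZ.
case: (partial_image_dichotomy k j) => [kjZ | sSkj].
  by case: (not_both_small jk).
case/negP: (SnZ j); apply: subset_trans (Sperf j) (subset_trans _ jkZ).
rewrite gen_subG; apply/subsetP=> _ /imset2P[_ _ /(subsetP (sSH j))/morphimP[h Ch Hh ->]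
  /(subsetP (sSH j))/morphimP[h' Ch' Hh' ->] ->].
have : rho k [~ h, h'] \in partial_image k j.
  apply: (subsetP sSkj); rewrite morphR //; apply: mem_commg; exact: mem_morphim.
case/morphimP=> m Cm Km rhom; have Hm := subsetP (partial_kernel_sub _) m Km.
rewrite -morphR //.
have Ej : rho j ([~ h, h'] * m^-1) = rho j [~ h, h'].
  move: Km; rewrite !inE /= andbT => /andP[_ /eqP rm].
  by rewrite morphM ?groupV ?groupR // morphV // rm invg1 mulg1.
rewrite -Ej; apply: mem_morphim; first by rewrite groupM ?groupV ?groupR.
rewrite inE [_ \in H]groupM ?groupV ?groupR //= andbT.
by rewrite morphM ?groupV ?groupR // morphV // rhom mulgV.
Qed.

(** Perfectness absorbs one more coordinate [k]: the commutator of an element trivial at [k] with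
    one trivial on [s] is trivial on both. *)
Theorem goursat j (s : seq I) : j \notin s ->
  (rho j @* C)^`(1) \subset rho j @* partial_kernel s.
Proof.
elim: s => [|k s IHs] => [_|]; last rewrite inE => /norP[jk /IHs{}IHs].
  rewrite (subset_trans (sSH j)) //; apply: morphimS; apply/subsetP=> h Hh.
  by rewrite inE Hh.
apply: subset_trans (Sperf j) _.
rewrite gen_subG; apply/subsetP=> _ /imset2P[_ _ /(subsetP (partial_image_full jk))/morphimP[h Ch Kh ->]
  /(subsetP IHs)/morphimP[h' Ch' Kh' ->] ->].
rewrite -morphR //; apply: mem_morphim; first exact: groupR.
apply: partial_kernel_cons.
  by rewrite partial_kernelR // (subsetP (partial_kernel_sub s)).
rewrite -[_ \in _]groupV invg_comm partial_kernelR //.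
exact: (subsetP (partial_kernel_sub _) _ Kh).
Qed.

End Goursat.

(** * Normal subgroups of general linear groups *)

(** Modulo [R] every element of [G] comes from [T], whose elements commute, so [G / R] is abelian.
    [T] need not be a group; it will consist of matrices diagonal in a common basis. *)
Lemma der1_sub_factor (gT : finGroupType) (G R : {group gT}) (T : {pred gT}) :
  (R <| G)%g -> {in T &, forall x y, commute x y} ->
  {in G, forall g, exists2 t, t \in T & exists2 x, x \in R & g = (t * x)%g} ->
  (G^`(1) \subset R)%g.
Proof.
move=> nRG cT GT; have nR := subsetP (normal_norm nRG).
apply: der1_min; first exact: normal_norm.
apply/centsP=> _ /morphimP[g _ Gg ->] _ /morphimP[h _ Gh ->].
have [t Tt [x Rx eg]] := GT g Gg; have [u Tu [y Ry eh]] := GT h Gh.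
have Nt : t \in 'N(R)%g.
  by rewrite -[t](mulgK x) -eg nR // groupM // groupV (subsetP (normal_sub nRG)).
have Nu : u \in 'N(R)%g.
  by rewrite -[u](mulgK y) -eh nR // groupM // groupV (subsetP (normal_sub nRG)).
have Eg : coset R g = coset R t.
  by rewrite eg morphM ?(subsetP (normG R) x) //= (coset_id Rx) mulg1.
have Eh : coset R h = coset R u.
  by rewrite eh morphM ?(subsetP (normG R) y) //= (coset_id Ry) mulg1.
change (commute (coset R g) (coset R h)).
by rewrite /commute Eg Eh -!morphM //= cT.
Qed.

Lemma commg_mem_norm (gT : finGroupType) (N : {group gT}) x y :
  x \in N -> y \in 'N(N)%g -> [~ x, y]%g \in N.
Proof. by move=> Nx Ny; rewrite commgEl groupM ?groupV // memJ_norm. Qed.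

Lemma commg_norm_mem (gT : finGroupType) (N : {group gT}) x y :
  x \in 'N(N)%g -> y \in N -> [~ x, y]%g \in N.
Proof. by move=> Nx Ny; rewrite -invg_comm groupV commg_mem_norm. Qed.

(** * Row vectors, dual functionals and lines *)

Section LinearAlgebra.
Variable K : fieldType.

Lemma dual_col m n (Y : 'M[K]_(m, n)) (y : 'rV_n) :
  ~~ (y <= Y)%MS -> exists2 c : 'cV_n, Y *m c = 0 & y *m c = 1%:M.
Proof.
rewrite submxE => /rV0Pn[i nz].
pose c := cokermx Y *m delta_mx i 0 : 'cV_n.
have E : y *m c = (y *m cokermx Y) 0 i *: 1%:M.
  by rewrite [LHS]mx11_scalar mulmxA -colE mxE scalemx1.
exists (((y *m cokermx Y) 0 i)^-1 *: c).
  by rewrite -scalemxAr /c (mulmxA Y) mulmx_coker mul0mx scaler0.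
by rewrite -scalemxAr E scalerA mulVf // scale1r.
Qed.

Lemma ex_perp m n k (f : 'M[K]_(n, k)) (B : 'M[K]_(m, n)) :
  (\rank B + \rank f < n)%N -> exists2 v : 'rV_n, v *m f = 0 & ~~ (v <= B)%MS.
Proof.
move=> lt; have /row_subPn[i nB] : ~~ (kermx f <= B)%MS.
  apply: contraL lt => /mxrankS; rewrite mxrank_ker -leqNgt.
  by rewrite leq_subLR addnC.
by exists (row i (kermx f)) => //; rewrite -row_mul mulmx_ker row0.
Qed.

Lemma sub_rV_scale n (x y : 'rV[K]_n) : reflect (exists a, x = a *: y) (x <= y)%MS.
Proof.
apply: (iffP submxP) => [[a ->]|[a ->]]; last by exists a%:M; rewrite mul_scalar_mx.
by exists (a 0 0); rewrite [a in LHS]mx11_scalar mul_scalar_mx.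
Qed.

Lemma sub_adds_rV m n (Y : 'M[K]_(m, n)) (x z : 'rV_n) :
  reflect (exists2 y, (y <= Y)%MS & exists a, x = y + a *: z) (x <= Y + z)%MS.
Proof.
apply: (iffP sub_addsmxP) => [[[u v] ->]|[_ /submxP[u ->] [a ->]]].
  exists (u *m Y); first exact: submxMl.
  by exists (v 0 0); rewrite /= [v in LHS]mx11_scalar mul_scalar_mx.
by exists (u, a%:M); rewrite /= mul_scalar_mx.
Qed.

Lemma exchange_rV m n (Y : 'M[K]_(m, n)) (x z : 'rV_n) :
  ~~ (x <= Y)%MS -> (x <= Y + z)%MS -> (z <= Y + x)%MS.
Proof.
move=> nxY /sub_adds_rV[y yY [a ex]].
have nz_a : a != 0.
  by apply: contraNneq nxY => a0; rewrite ex a0 scale0r addr0.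
apply/sub_adds_rV; exists (- a^-1 *: y); first exact: scalemx_sub.
exists a^-1; rewrite ex scalerDr scalerA mulVf // scale1r addrA.
by rewrite scaleNr addNr add0r.
Qed.

Lemma line_stable_scalar n (A : 'M[K]_n) :
  (forall u : 'rV_n, (u *m A <= u)%MS) -> is_scalar_mx A.
Proof.
move=> stA; case: n => [|n] in A stA *; first by apply/is_scalar_mxP; exists 0; rewrite [A]flatmx0 [RHS]flatmx0.
have rowA i : exists a, row i A = a *: delta_mx 0 i.
  by rewrite rowE; apply/sub_rV_scale.
have [a0 ea0] := rowA 0; apply/is_scalar_mxP; exists a0.
apply/row_matrixP=> i; rewrite -scalemx1 linearZ /= row1; have [a ea] := rowA i.
have [-> // | ne_i0] := eqVneq i 0; rewrite ea; congr (_ *: _).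
have /sub_rV_scale[c] := stA (delta_mx 0 i + delta_mx 0 0).
rewrite mulmxDl -!rowE ea ea0 => /rowP e.
move: (e i) (e 0); rewrite !mxE !eqxx (negPf ne_i0) eq_sym (negPf ne_i0) /=.
by rewrite !mulr0 !addr0 !add0r !mulr1 => -> ->.
Qed.

Lemma exchange1_rV n (x z : 'rV[K]_n) : x != 0 -> (x <= z)%MS -> (z <= x)%MS.
Proof.
move=> nz /sub_rV_scale[a ex]; apply/sub_rV_scale; exists a^-1.
rewrite ex scalerA mulVf ?scale1r //.
by apply: contraNneq nz => a0; rewrite ex a0 scale0r.
Qed.

End LinearAlgebra.

Definition GLfin (K : finFieldType) (n : nat) : finGroupType := {'GL_n.+1[K]}.

Section ToGL.
Variables (K : finFieldType) (n : nat).
Local Notation gT := (GLfin K n).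

(* Locked, lest unification unfold group elements into matrices. *)
Fact toGL_key : unit. Proof. by []. Qed.
Definition toGL (A : 'M[K]_n.+1) : gT := locked_with toGL_key (insubd (1%g : gT) A).

Lemma toGLK A : A \in unitmx -> GLval (toGL A) = A.
Proof. by move=> uA; rewrite /toGL unlock; apply: (@insubdK _ _ gT (1%g : gT) A). Qed.

Lemma GL_inj : injective (@GLval n.+1 K). Proof. exact: val_inj. Qed.

Lemma GLM (x y : gT) : GLval (x * y)%g = GLval x *m GLval y. Proof. by []. Qed.
Lemma GL1 : GLval (1%g : gT) = 1%:M. Proof. by []. Qed.
Lemma GL_mulVmx (x : gT) : GLval x^-1%g *m GLval x = 1%:M.
Proof. by rewrite -GLM mulVg. Qed.
Lemma GL_mulmxV (x : gT) : GLval x *m GLval x^-1%g = 1%:M.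
Proof. by rewrite -GLM mulgV. Qed.
Lemma GL_X (x : gT) k : GLval (x ^+ k)%g = GLval x ^+ k.
Proof. by elim: k => // k IHk; rewrite expgS exprS -IHk. Qed.

Definition scalar_GL : {set gT} := [set g | is_scalar_mx (GLval g)].

Lemma scalar_GLP g : reflect (exists a, GLval g = a%:M) (g \in scalar_GL).
Proof. by rewrite inE; apply: is_scalar_mxP. Qed.

Lemma scalar_GL_group_set : group_set scalar_GL.
Proof.
apply/group_setP; split=> [|x y]; first by apply/scalar_GLP; exists 1.
move=> /scalar_GLP[a ex] /scalar_GLP[b ey]; apply/scalar_GLP; exists (a * b).
by rewrite GLM ex ey scalar_mxM.
Qed.
Canonical scalar_GL_group := Group scalar_GL_group_set.

Lemma scalar_GL_cent (A : {set gT}) : scalar_GL \subset 'C(A)%g.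
Proof.
apply/centsP=> x /scalar_GLP[a ex] y _; apply: GL_inj.
by rewrite !GLM ex scalar_mxC.
Qed.

End ToGL.

(** * Transvections *)

Section GL.
Variables (K : finFieldType) (n : nat).
Hypothesis n_ge3 : (3 <= n)%N.
Local Notation gT := (GLfin K n).
Local Notation G := [set: gT]%G.
Implicit Types (a b u w : 'rV[K]_n.+1) (c f : 'cV[K]_n.+1) (g : gT).

(** For [a *m f = 0] this is the transvection v |-> v + (v f) a, with direction [a] and axis the
    kernel of [f]. *)
Definition trv a f : gT := toGL (1%:M + f *m a).

Lemma trvE a f : a *m f = 0 -> GLval (trv a f) = 1%:M + f *m a.
Proof.
move=> af; apply: toGLK; suff: (1%:M + f *m a) *m (1%:M - f *m a) = 1%:M.
  by case/mulmx1_unit.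
rewrite mulmxDl mul1mx mulmxBr mulmx1 mulmxA -(mulmxA f) af mulmx0 mul0mx subr0.
by rewrite subrK.
Qed.

Lemma trvJ a f g : a *m f = 0 ->
  (trv a f ^ g)%g = trv (a *m GLval g) (GLval g^-1%g *m f).
Proof.
move=> af; apply: GL_inj; rewrite conjgE !GLM !trvE //; last first.
  by rewrite mulmxA -(mulmxA a) GL_mulmxV mulmx1.
by rewrite mulmxDl mul1mx mulmxDr GL_mulVmx !mulmxA.
Qed.

Lemma trvM a b f : a *m f = 0 -> b *m f = 0 ->
  (trv a f * trv b f)%g = trv (a + b) f.
Proof.
move=> af bf; have abf : (a + b) *m f = 0 by rewrite mulmxDl af bf addr0.
apply: GL_inj; rewrite GLM !trvE // mulmxDl mul1mx mulmxDr mulmx1 !mulmxA.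
by rewrite -(mulmxA f a) af mulmx0 mul0mx addr0 mulmxDr -addrA [f *m b + _]addrC.
Qed.

Lemma trvMr a f c : a *m f = 0 -> a *m c = 0 ->
  (trv a f * trv a c)%g = trv a (f + c).
Proof.
move=> af ac; have afc : a *m (f + c) = 0 by rewrite mulmxDr af ac addr0.
apply: GL_inj; rewrite GLM !trvE // mulmxDl mul1mx mulmxDr mulmx1 !mulmxA.
by rewrite -(mulmxA f a) ac mulmx0 mul0mx addr0 mulmxDl -addrA [c *m a + _]addrC.
Qed.

Lemma trv0 f : trv 0 f = 1%g.
Proof. by apply: GL_inj; rewrite trvE ?mul0mx // mulmx0 addr0. Qed.
Lemma trv0r a : trv a 0 = 1%g.
Proof. by apply: GL_inj; rewrite trvE ?mulmx0 // mul0mx addr0. Qed.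

Lemma trvV a f : a *m f = 0 -> (trv a f)^-1%g = trv (- a) f.
Proof.
move=> af; apply/eqP; rewrite eq_invg_mul trvM ?mulNmx ?af ?oppr0 //.
by rewrite subrr trv0.
Qed.
Lemma trvVr a f : a *m f = 0 -> (trv a f)^-1%g = trv a (- f).
Proof.
move=> af; apply/eqP; rewrite eq_invg_mul trvMr ?mulmxN ?af ?oppr0 //.
by rewrite subrr trv0r.
Qed.

Lemma trvR a f g : a *m f = 0 -> GLval g *m f = f ->
  [~ trv a f, g]%g = trv (a *m GLval g - a) f.
Proof.
move=> af gf; have gVf : GLval g^-1%g *m f = f.
  by rewrite -{1}gf mulmxA GL_mulVmx mul1mx.
rewrite commgEl trvV // trvJ // gVf trvM ?mulNmx ?af ?oppr0 //; first by rewrite addrC.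
by rewrite -mulmxA gf.
Qed.

Lemma trvRr a f g : a *m f = 0 -> a *m GLval g = a ->
  [~ trv a f, g]%g = trv a (GLval g^-1%g *m f - f).
Proof.
move=> af ag; have agV : a *m GLval g^-1%g = a.
  by rewrite -{1}ag -mulmxA GL_mulmxV mulmx1.
rewrite commgEl trvVr // trvJ // ag trvMr ?mulmxN ?af ?oppr0 //; first by rewrite addrC.
by rewrite mulmxA agV.
Qed.

(** The relation [E_ij, E_jk] = E_ik of elementary matrices, free of coordinates; [trv_commr] is its
    counterpart for the functional. *)
Lemma trv_comm a f b c : a *m f = 0 -> b *m c = 0 -> b *m f = 0 ->
  a *m c = 1%:M -> [~ trv a f, trv b c]%g = trv b f.
Proof.
move=> af bc bf ac; rewrite trvR ?trvE //; last first.
  by rewrite mulmxDl mul1mx -mulmxA bf mulmx0 addr0.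
by rewrite mulmxDr mulmx1 mulmxA ac mul1mx addrC addKr.
Qed.

Lemma trv_commr a f b c : a *m f = 0 -> b *m c = 0 -> a *m c = 0 ->
  b *m f = 1%:M -> [~ trv a f, trv b c]%g = trv a (- c).
Proof.
move=> af bc ac bf; rewrite trvRr // ?trvV ?trvE ?mulNmx ?bc ?oppr0 //; last first.
  by rewrite mulmxDr mulmx1 mulmxA ac mul0mx addr0.
by rewrite mulmxDl mul1mx mulmxN mulNmx -mulmxA bf mulmx1 addrC addKr.
Qed.

Lemma dual_row (f c : 'cV[K]_n.+1) : ~~ (c^T <= f^T)%MS ->
  exists2 b : 'rV[K]_n.+1, b *m f = 0 & b *m c = 1%:M.
Proof.
case/dual_col=> d fd cd; exists d^T; apply: trmx_inj.
  by rewrite trmx_mul trmxK fd trmx0.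
by rewrite trmx_mul trmxK cd trmx1.
Qed.

Section Spread.
Variable N : {group gT}.
Hypothesis nN : forall a f, a *m f = 0 -> trv a f \in 'N(N)%g.

(** One commutator turns the direction [a] into any [b] outside its line; on the line itself, a
    detour through another vector of the kernel of [f] is needed. *)
Lemma spread_row a b f : a != 0 -> a *m f = 0 -> b *m f = 0 ->
  trv a f \in N -> trv b f \in N.
Proof.
move=> nz_a af bf Na; have [-> | nz_b] := eqVneq b 0; first by rewrite trv0 group1.
have gen x y : ~~ (x <= y)%MS -> x *m f = 0 -> y *m f = 0 -> trv x f \in N ->
    trv y f \in N.
  move=> /dual_col[c yc xc] xf yf Nx.
  by rewrite -(trv_comm xf yc) // commg_mem_norm // nN.
have [ab | ] := boolP (a <= b)%MS; last by move/gen; apply.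
have [|z zf nzb] := @ex_perp _ _ _ _ f b.
  rewrite (leq_ltn_trans (leq_add (rank_leq_row _) (rank_leq_col _))) //.
  by rewrite addn1 ltnS (leq_trans _ n_ge3).
apply: (gen z) => //; apply: (gen a) => //.
by apply: contra nzb => /(exchange1_rV nz_a)/submx_trans->.
Qed.

Lemma spread_col a f c : f != 0 -> a *m f = 0 -> a *m c = 0 ->
  trv a f \in N -> trv a c \in N.
Proof.
move=> nz_f af ac Nf; have [-> | nz_c] := eqVneq c 0; first by rewrite trv0r group1.
have gen x y : ~~ (x^T <= y^T)%MS -> a *m x = 0 -> a *m y = 0 -> trv a x \in N ->
    trv a y \in N.
  move=> /dual_row[b yb xb] ax ay Nx.
  by rewrite -[y]opprK -(@trv_commr a x b (- y)) ?mulmxN ?yb ?ay ?oppr0 // commg_mem_norm // nN ?mulmxN ?yb ?oppr0.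
have [ab | ] := boolP (f^T <= c^T)%MS; last by move/gen; apply.
have [|z zf nzb] := @ex_perp _ _ _ _ a^T c^T.
  rewrite (leq_ltn_trans (leq_add (rank_leq_row _) (rank_leq_col _))) //.
  by rewrite addn1 ltnS (leq_trans _ n_ge3).
have az : a *m z^T = 0 by apply: trmx_inj; rewrite trmx_mul trmxK zf trmx0.
apply: (gen z^T); rewrite ?trmxK //; apply: (gen f) => //.
apply: contra nzb; rewrite trmxK => /exchange1_rV; rewrite trmx_eq0 => /(_ nz_f).
by move/submx_trans->.
Qed.

(** A nonzero [z] killed by both functionals links the two transvections through (a, f), (z, f), (z,
    c), (b, c). *)
Lemma spread a f b c : a != 0 -> f != 0 -> a *m f = 0 -> trv a f \in N ->
  b *m c = 0 -> trv b c \in N.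
Proof.
move=> nz_a nz_f af Naf bc.
have [|z] := @ex_perp _ _ _ _ (row_mx f c) (0 : 'rV_n.+1).
  by rewrite mxrank0 (leq_ltn_trans (rank_leq_col _)) // ltnS (leq_trans _ n_ge3).
rewrite mul_mx_row => /eqP; rewrite row_mx_eq0 => /andP[/eqP zf /eqP zc].
move=> nz; have nz_z : z != 0 by apply: contraNneq nz => ->; apply: sub0mx.
by apply: (spread_row nz_z zc bc); apply: (spread_col nz_f zf zc); apply: spread_row Naf.
Qed.

End Spread.

Definition trv_group : {group gT} :=
  <<[set g | [exists a, exists f, (a *m f == 0) && (g == trv a f)]]>>%G.

Lemma mem_trv_group a f : a *m f = 0 -> trv a f \in trv_group.
Proof.
move=> af; rewrite mem_gen // inE; apply/existsP; exists a; apply/existsP; exists f.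
by rewrite af !eqxx.
Qed.

Lemma trv_group_sub (N : {group gT}) :
  (forall a f, a *m f = 0 -> trv a f \in N) -> trv_group \subset N.
Proof.
move=> sN; rewrite gen_subG; apply/subsetP=> g; rewrite inE.
by case/existsP=> a /existsP[f /andP[/eqP af /eqP->]]; apply: sN.
Qed.

Lemma trv_group_normal : (trv_group <| G)%g.
Proof.
rewrite /normal subsetT /= norms_gen //; apply/subsetP=> g _; rewrite inE.
apply/subsetP=> _ /imsetP[x + ->]; rewrite !inE.
case/existsP=> a /existsP[f /andP[/eqP af /eqP->]]; rewrite trvJ //.
apply/existsP; exists (a *m GLval g); apply/existsP; exists (GLval g^-1%g *m f).
by rewrite mulmxA -(mulmxA a) GL_mulmxV mulmx1 af !eqxx.
Qed.

(** For [w] outside [Y + u] some functional kills [Y] and [w - u] but not [u], and the transvection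
    of direction [w - u] sends [u] to [w]. Otherwise a vector outside [Y + x] serves as a relay; the
    bound on the rank of [Y] provides it. *)
Lemma trv_trans m (Y : 'M[K]_(m, n.+1)) (x x' : 'rV_n.+1) :
  (\rank Y + 2 <= n.+1)%N -> ~~ (x <= Y)%MS -> ~~ (x' <= Y)%MS ->
  exists2 g, g \in trv_group & Y *m GLval g = Y /\ x *m GLval g = x'.
Proof.
move=> rY.
have gen u w : ~~ (u <= Y)%MS -> ~~ (w <= Y + u)%MS ->
    exists2 g, g \in trv_group & Y *m GLval g = Y /\ u *m GLval g = w.
  move=> nuY nwYu.
  have /dual_col[c] : ~~ (u <= col_mx Y (w - u))%MS.
    rewrite -addsmxE; apply: contra nwYu => /(exchange_rV nuY)/sub_adds_rV[y yY [e ew]].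
    apply/sub_adds_rV; exists y => //; exists (e + 1).
    by rewrite scalerDl scale1r addrA -ew subrK.
  rewrite mul_col_mx -[0]col_mx0 => /eq_col_mx[Yc uc0] uc.
  exists (trv (w - u) c); first exact: mem_trv_group.
  rewrite trvE // !(mulmxDr _ 1%:M) !mulmx1 !mulmxA Yc uc mul0mx addr0 mul1mx.
  by rewrite addrC subrK.
move=> nx nx'; have [xx' | ] := boolP (x' <= Y + x)%MS; last exact: gen.
have [|z _ nz] := @ex_perp _ _ _ _ (0 : 'M_(n.+1, 1)) (Y + x)%MS.
  rewrite mxrank0 addn0 (leq_ltn_trans (mxrank_adds_leqif _ _)) //.
  by rewrite (leq_trans _ rY) // addnS ltnS leq_add2l rank_leq_row.
have nz' : ~~ (z <= Y)%MS by apply: contra nz => /submx_trans->; rewrite ?addsmxSl.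
have nx'z : ~~ (x' <= Y + z)%MS.
  apply: contra nz => /(exchange_rV nx')/submx_trans->//.
  by rewrite addsmx_sub addsmxSl xx'.
have [g Rg [Yg xg]] := gen _ _ nx nz; have [h Rh [Yh zh]] := gen _ _ nz' nx'z.
by exists (g * h)%g; rewrite ?groupM // GLM !mulmxA Yg Yh xg zh.
Qed.

(** Row reduction by transvections alone. It stops at n of the n + 1 basis vectors, because
    transvections cannot change the determinant. *)
Lemma trv_fix_rows k g : (k <= n)%N ->
  exists2 x, x \in trv_group & pid_mx k *m GLval (g * x)%g = pid_mx k :> 'M_n.+1.
Proof.
elim: k => [_ | k IHk lt_kn].
  by exists 1%g; rewrite ?group1 // pid_mx_0 mul0mx.
have [x Rx ex] := IHk (ltnW lt_kn); set h := (g * x)%g in ex.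
have lt_k : (k < n.+1)%N by apply: leq_trans lt_kn _.
pose e := delta_mx 0 (Ordinal lt_k) : 'rV[K]_n.+1.
have ne : ~~ (e <= (pid_mx k : 'M_n.+1))%MS.
  apply/negP=> /submxP[D /rowP/(_ (Ordinal lt_k))].
  rewrite !mxE !eqxx /= big1 => [/eqP|i _]; first by rewrite oner_eq0.
  rewrite mxE; case: eqP => [->|]; last by rewrite mulr0.
  by rewrite ltnn mulr0.
have neh : ~~ (e *m GLval h <= (pid_mx k : 'M_n.+1))%MS.
  apply: contra ne => /(submxMr (GLval h^-1%g)).
  rewrite -mulmxA GL_mulmxV mulmx1 => /submx_trans-> //.
  by rewrite -{1}ex -mulmxA GL_mulmxV mulmx1.
have [|y Ry [Yy ey]] := trv_trans _ neh ne.
  by rewrite rank_pid_mx ?addn2 ?(ltnW lt_k) // ltnS.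
exists (x * y)%g; first exact: groupM.
have -> : pid_mx k.+1 = pid_mx k + e^T *m e :> 'M[K]_n.+1.
  rewrite trmx_delta mul_delta_mx; apply/matrixP=> i j; rewrite !mxE -!val_eqE /= ltnS.
  have [-> | ne_ij] := eqVneq (val i) (val j).
    by rewrite andbb; case: ltngtP; rewrite /= ?addr0 ?add0r.
  rewrite /= add0r; case: eqP => //= ik; case: eqP => //= jk.
  by case/eqP: ne_ij; rewrite /= ik jk.
rewrite mulgA GLM mulmxA !mulmxDl ex Yy -2!mulmxA (mulmxA e) -(mulmxA e) -GLM.
by rewrite -/h GLM (mulmxA e) ey.
Qed.

(** After row reduction only the last basis vector [e] moves, and one more transvection clears the
    part of its image along the others. *)
Lemma GL_factor g : exists2 s : K,
  (1%:M + s *: delta_mx ord_max ord_max : 'M_n.+1) \in unitmx &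
  exists2 x, x \in trv_group & g = (toGL (1%:M + s *: delta_mx ord_max ord_max) * x)%g.
Proof.
have [x Rx] := trv_fix_rows g (leqnn n); move eh0: (g * x)%g => h eh.
pose e := delta_mx 0 ord_max : 'rV[K]_n.+1.
have I1 : 1%:M = pid_mx n + delta_mx ord_max ord_max :> 'M[K]_n.+1.
  apply/matrixP=> i j; rewrite !mxE -!val_eqE /=.
  have [eij | ne_ij] := eqVneq (val i) (val j).
    rewrite -eij andbb /=; case: ltngtP (leq_ord i) => //= _ _; by rewrite ?addr0 ?add0r.
  rewrite /= add0r; case: eqP => //= ik; case: eqP => //= jk.
  by case/eqP: ne_ij; rewrite /= ik jk.
have ne : ~~ (e <= (pid_mx n : 'M_n.+1))%MS.
  apply/negP=> /submxP[D /rowP/(_ ord_max)].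
  rewrite !mxE !eqxx /= big1 => [/eqP|i _]; first by rewrite oner_eq0.
  rewrite mxE; case: eqP => [->|]; last by rewrite mulr0.
  by rewrite ltnn mulr0.
have : (e *m GLval h <= (pid_mx n : 'M_n.+1) + e)%MS.
  apply: submx_trans (submx1 _) _; rewrite I1 addmx_sub_adds //.
  by rewrite -(mul_delta_mx (0 : 'I_1)) submxMl.
case/sub_adds_rV=> a /submxP[D ea] [s es].
have nz_s : s != 0.
  apply: contraNneq ne => s0; rewrite s0 scale0r addr0 in es.
  suff -> : e = D *m pid_mx n by apply: submxMl.
  rewrite -[LHS]mulmx1 -(GL_mulmxV h) mulmxA es ea -[in LHS]eh.
  by rewrite -!mulmxA GL_mulmxV mulmx1.
have pe : pid_mx n *m e^T = 0 :> 'cV[K]_n.+1.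
  apply/colP=> i; rewrite !mxE big1 // => j _; rewrite !mxE /=.
  case: (j =P ord_max) => [->|]; last by rewrite ?andbF mulr0.
  by case: eqP => [->|]; rewrite ?ltnn ?mul0r.
have aeT : a *m e^T = 0 by rewrite ea -mulmxA pe mulmx0.
have ee : e *m e^T = 1%:M.
  by rewrite trmx_delta mul_delta_mx; apply/matrixP=> i j; rewrite !ord1 !mxE.
(* The functional [e^T] takes the value [s] on the image [a + s *: e] of [e]; the factor [s^-1]
   compensates for it. *)
pose y := trv (- s^-1 *: a) e^T.
have ysa : - s^-1 *: a *m e^T = 0 by rewrite -scalemxAl aeT scaler0.
have Ry : y \in trv_group by apply: mem_trv_group.
have E : GLval (h * y)%g = 1%:M + (s - 1) *: delta_mx ord_max ord_max.
  have I1' : 1%:M = pid_mx n + e^T *m e :> 'M[K]_n.+1.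
    by rewrite trmx_delta mul_delta_mx.
  have hE : GLval h = pid_mx n + e^T *m (a + s *: e).
    by rewrite -[LHS]mul1mx [in LHS]I1' mulmxDl eh -mulmxA es.
  have pey (b : 'rV_n.+1) : pid_mx n *m (e^T *m b) = 0 :> 'M[K]_n.+1.
    by rewrite mulmxA pe mul0mx.
  have eey (b : 'rV_n.+1) : (a + s *: e) *m (e^T *m b) = s *: b.
    by rewrite mulmxA mulmxDl aeT add0r -scalemxAl ee scalemx1 mul_scalar_mx.
  rewrite GLM trvE // mulmxDr mulmx1 [in X in _ + X]hE mulmxDl pey add0r -mulmxA eey.
  rewrite hE scalerA mulrN divff // scaleN1r -addrA -mulmxDr addrAC subrr add0r.
  rewrite I1' -scalemxAr trmx_delta mul_delta_mx scalerBl scale1r.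
  by rewrite -addrA [_ + (_ - _)]addrC subrK.
have uE : (1%:M + (s - 1) *: delta_mx ord_max ord_max : 'M_n.+1) \in unitmx by rewrite -E; exact: (GL_unit (h * y)%g).
exists (s - 1) => //; exists (x * y)^-1%g; first by rewrite groupV groupM.
rewrite (_ : toGL _ = (h * y)%g); last by apply: GL_inj; rewrite toGLK.
by rewrite -eh0 -[(g * x * y)%g]mulgA mulgK.
Qed.

Lemma GL_der_sub (N : {group gT}) :
  (forall a f, a *m f = 0 -> trv a f \in N) -> (G^`(1) \subset N)%g.
Proof.
move=> /trv_group_sub; apply: subset_trans.
pose D := [pred g : gT | [exists s : K, GLval g == 1%:M + s *: delta_mx ord_max ord_max]].
apply: (der1_sub_factor trv_group_normal (T := D)).
  move=> x y /existsP[s /eqP ex] /existsP[t /eqP ey]; apply: GL_inj.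
  rewrite !GLM ex ey !mulmxDl !mulmxDr !mulmx1 !mul1mx -!scalemxAl -!scalemxAr.
  by rewrite !scalerA [t * s]mulrC -!addrA; congr (_ + _); rewrite addrCA.
move=> g _; have [s us [x Rx ->]] := GL_factor g.
by exists (toGL (1%:M + s *: delta_mx ord_max ord_max)); [apply/existsP; exists s; rewrite toGLK | exists x].
Qed.

Lemma trv_is_commutator a f : a *m f = 0 -> exists u w c d,
  [/\ u *m c = 0, w *m d = 0 & trv a f = [~ trv u c, trv w d]%g].
Proof.
move=> af; have [-> | nz_f] := eqVneq f 0.
  by exists 0, 0, 0, 0; rewrite !mulmx0 !trv0r comm1g.
have [-> | nz_a] := eqVneq a 0.
  by exists 0, 0, 0, 0; rewrite !mulmx0 !trv0 comm1g.
have [|b bf nb] := @ex_perp _ _ _ _ f a.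
  rewrite (leq_ltn_trans (leq_add (rank_leq_row _) (rank_leq_col _))) //.
  by rewrite addn1 ltnS (leq_trans _ n_ge3).
have /dual_col[c ac bc] := nb.
by exists b, a, f, c; split=> //; rewrite trv_comm.
Qed.

Lemma GL_der_perfect : (G^`(1) \subset [~: G^`(1), G^`(1)])%g.
Proof.
have trvS a f : a *m f = 0 -> trv a f \in (G^`(1))%g.
  by case/trv_is_commutator=> [u [w [c [d [_ _ ->]]]]]; rewrite mem_commg ?inE.
apply: GL_der_sub => a f /trv_is_commutator[u [w [c [d [uc wd ->]]]]].
by rewrite mem_commg ?trvS.
Qed.

Lemma trv_in_der a f : a *m f = 0 -> trv a f \in (G^`(1))%g.
Proof.
by case/trv_is_commutator=> [u [w [c [d [_ _ ->]]]]]; rewrite mem_commg ?inE.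
Qed.

(** Two commutators turn a non-scalar [x] into a transvection. If [u *m x] is outside the line of
    [u], the commutator [y] of [trv u f] with [x] is a product of two transvections; for [w] fixed
    by [y], the commutator of [trv w g] with [y] is a single one, of direction [w]. A suitable [w]
    outside the line of [u] exists because n + 1 > 3. *)
Theorem GL_normal_dichotomy (N : {group gT}) : (G^`(1) \subset 'N(N))%g ->
  N \subset scalar_GL K n \/ (G^`(1) \subset N)%g.
Proof.
move=> nNS; have nN a f : a *m f = 0 -> trv a f \in 'N(N)%g.
  by move/trv_in_der; apply: (subsetP nNS).
have [sNZ | /subsetPn[x Nx nsx]] := boolP (N \subset scalar_GL K n); [by left | right].
have [u nux] : exists u, ~~ (u *m GLval x <= u)%MS.
  apply/existsP; apply: contraNT nsx => /existsPn ux; rewrite inE.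
  by apply: line_stable_scalar => u; apply: contraTT (ux u); rewrite negbK.
have nz_u : u != 0 by apply: contraNneq nux => ->; rewrite mul0mx sub0mx.
have [f uf xf] := dual_col nux; set u' := u *m GLval x in nux xf.
pose f' := GLval x^-1%g *m f; pose y := [~ trv u f, x]%g.
have Ny : y \in N by rewrite commg_norm_mem // nN.
have uf' : u' *m f' = 0 by rewrite mulmxA -(mulmxA u) GL_mulmxV mulmx1.
have yE : y = (trv (- u) f * trv u' f')%g by rewrite /y commgEl trvV // trvJ.
have nuf : - u *m f = 0 by rewrite mulNmx uf oppr0.
have [|w] := @ex_perp _ _ _ _ (row_mx f f') u.
  rewrite (leq_ltn_trans (leq_add (rank_leq_row _) (rank_leq_col _))) //.
rewrite mul_mx_row => /eqP; rewrite row_mx_eq0 => /andP[/eqP wf /eqP wf'] nwu.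
have wy : w *m GLval y = w.
  rewrite yE GLM (mulmxA w) !trvE // (mulmxDr w) mulmx1 (mulmxA w f) wf mul0mx addr0.
  by rewrite mulmxDr mulmx1 mulmxA wf' mul0mx addr0.
(* The functional [g] sees the first factor of [y] but not the second, so [y] moves it by [f] and
   the resulting [c] is nonzero. *)
have /dual_col[g] : ~~ (u <= col_mx u' w)%MS.
  rewrite -addsmxE; apply/negP=> /sub_adds_rV[_ /sub_rV_scale[a ->] [b eu]].
  have := uf; rewrite {1}eu mulmxDl -!scalemxAl xf wf scaler0 addr0.
  move/matrixP/(_ 0 0); rewrite !mxE eqxx mulr1 => a0.
  case/negP: nwu; apply: exchange1_rV nz_u _; apply/sub_rV_scale; exists b.
  by rewrite {1}eu a0 scale0r add0r.
rewrite mul_col_mx -[0]col_mx0 => /eq_col_mx[u'g wg] ug.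
have yg : GLval y *m g = g - f.
  rewrite yE GLM !trvE // -mulmxA (mulmxDl _ (f' *m u')) mul1mx -(mulmxA f') u'g mulmx0 addr0.
  by rewrite mulmxDl mul1mx -mulmxA mulNmx ug mulmxN mulmx1.
pose c := GLval y^-1%g *m g - g.
have wc : w *m c = 0.
  by rewrite mulmxBr mulmxA -{1}wy -(mulmxA w) GL_mulmxV mulmx1 wg subrr.
have nz_c : c != 0.
  apply/eqP=> /eqP; rewrite subr_eq0 => /eqP e.
  have /eqP := yg; rewrite -{1}e mulmxA GL_mulmxV mul1mx -subr_eq0 opprB addrCA subrr addr0.
  by move/eqP=> f0; have := xf; rewrite f0 mulmx0 => /matrixP/(_ 0 0)/eqP; rewrite !mxE eq_sym oner_eq0.
have nz_w : w != 0 by apply: contraNneq nwu => ->; rewrite sub0mx.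
apply: GL_der_sub => a b ab; apply: (spread nN nz_w nz_c wc) => //.
rewrite -trvRr //; apply: commg_norm_mem => //; exact: nN.
Qed.

End GL.

(** * Normal subgroups of unitary groups *)

Section Norm.
Variables (K : finFieldType) (s : {rmorphism K -> K}).
Hypothesis sK : involutive s.
Variable e : K.
Hypotheses (e_skew : s e = - e) (nz_e : e != 0).

Let nz_unit (u : {unit K}) : val u != 0. Proof. by rewrite -unitfE (valP u). Qed.
Let inv_unit (x : K) (nz : x != 0) : {unit K} := FinRing.unit K (etrans (unitfE x) nz).

Let s_unit (u : {unit K}) : s (val u) \is a GRing.unit.
Proof. by rewrite unitfE fmorph_eq0 nz_unit. Qed.
Let norm_unit (u : {unit K}) : {unit K} := (u * FinRing.unit K (s_unit u))%g.
Let ratio_unit (u : {unit K}) : {unit K} := (u * (FinRing.unit K (s_unit u))^-1)%g.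

Let norm_unitM : {in [set: {unit K}] &, {morph norm_unit : x y / (x * y)%g}}.
Proof.
by move=> x y _ _; apply: val_inj; rewrite !FinRing.val_unitM /= rmorphM mulrACA.
Qed.
Let ratio_unitM : {in [set: {unit K}] &, {morph ratio_unit : x y / (x * y)%g}}.
Proof.
move=> x y _ _; apply: val_inj; rewrite !(FinRing.val_unitM, FinRing.val_unitV) /= rmorphM.
by rewrite invfM mulrACA.
Qed.
Let nm := Morphism norm_unitM.
Let rm := Morphism ratio_unitM.

(* Hilbert's Theorem 90 identifies the kernel of the norm with the image of
   x / s x, whose kernel is the fixed field; hence the image of the norm is as
   large as the fixed field. *)
Lemma norm_surj (c : K) : s c = c -> c != 0 -> exists a, a * s a = c.
Proof.
move=> sc nz_c.
have sub1 : nm @* [set: {unit K}] \subset 'ker rm.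
  apply/subsetP=> _ /morphimP[x _ _ ->]; rewrite !inE /=; apply/eqP/val_inj.
  rewrite /= rmorphM sK [s _ * _]mulrC divff //.
  by rewrite mulf_neq0 ?fmorph_eq0 ?nz_unit.
have sub2 : 'ker nm \subset rm @* [set: {unit K}].
  apply/subsetP=> x /kerP/=; rewrite inE => /(_ isT)/(congr1 val).
  (* An explicit witness is [1 + x], since x (1 + s x) = x + 1 for [x] of norm 1. At x = -1 it
     vanishes, and the skew element [e] replaces it. *)
  rewrite FinRing.val_unitM /= => nx1; have [x_1 | nz_x1] := eqVneq (1 + val x) 0.
    have -> : x = rm (inv_unit nz_e) by
      apply: val_inj; rewrite !(FinRing.val_unitM, FinRing.val_unitV) /= e_skew invrN mulrN divff //;
      apply/eqP; rewrite -addr_eq0 addrC x_1.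
    by rewrite mem_morphim ?inE.
  have -> : x = rm (inv_unit nz_x1).
    apply: val_inj; rewrite !(FinRing.val_unitM, FinRing.val_unitV) /= rmorphD rmorph1.
    have nz_sx1 : 1 + s (val x) != 0 by rewrite -(rmorph1 s) -rmorphD fmorph_eq0.
    apply: (canRL (mulfK nz_sx1)); rewrite mulrDr mulr1 nx1 addrC //.
  by rewrite mem_morphim ?inE.
have cn := card_morphim nm [set: {unit K}]; have cr := card_morphim rm [set: {unit K}].
have E : nm @* [set: {unit K}] = 'ker rm.
  apply/eqP; rewrite eqEcard sub1 /=.
  have := subset_leq_card sub2.
  rewrite cn cr !setTI.
  have L f : (#|[set: {unit K}] : 'ker (f : {morphism [set: {unit K}] >-> _})|
     = #|[set: {unit K}]| %/ #|'ker f|)%N by rewrite divgS ?subsetT.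
  rewrite !L leq_divRL ?cardG_gt0 // => le; rewrite leq_divRL ?cardG_gt0 //.
  by rewrite mulnC.
have : inv_unit nz_c \in 'ker rm.
  rewrite !inE /=; apply/eqP/val_inj; rewrite !(FinRing.val_unitM, FinRing.val_unitV) /= sc.
  by rewrite divff.
rewrite -E => /morphimP[a _ _ /(congr1 val)/= ->]; exists (val a).
by [].
Qed.
End Norm.

Lemma rank_adds_rV (F : fieldType) m n (A : 'M[F]_(m, n)) (y : 'rV_n) :
  (\rank (A + y)%MS <= (\rank A).+1)%N.
Proof.
rewrite (leq_trans (mxrank_adds_leqif _ _)) // -(addn1 (\rank A)).
by rewrite leq_add2l rank_leq_row.
Qed.

(** * Skew-hermitian spaces *)

Section Form.
Variables (K : finFieldType) (n : nat) (s : {rmorphism K -> K}) (M : 'M[K]_n.+1).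
Local Notation gT := (GLfin K n).
Implicit Types (a t : K) (b c u v w x y z p q : 'rV[K]_n.+1) (g : gT).

Definition hvec w : 'cV[K]_n.+1 := M *m (map_mx s w)^T.
Definition hform x y : K := (x *m hvec y) 0 0.
Local Notation h := hform.

Lemma hvecE x y : x *m hvec y = (h x y)%:M.
Proof. exact: mx11_scalar. Qed.

Lemma hDl x y z : h (x + y) z = h x z + h y z.
Proof. by rewrite /h mulmxDl mxE. Qed.
Lemma hZl a x y : h (a *: x) y = a * h x y.
Proof. by rewrite /h -scalemxAl mxE. Qed.
Lemma hvecD x y : hvec (x + y) = hvec x + hvec y.
Proof. by rewrite /hvec map_mxD linearD mulmxDr. Qed.
Lemma hvecZ a x : hvec (a *: x) = s a *: hvec x.
Proof. by rewrite /hvec map_mxZ linearZ /= scalemxAr. Qed.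
Lemma hDr x y z : h x (y + z) = h x y + h x z.
Proof. by rewrite /h hvecD mulmxDr mxE. Qed.
Lemma hZr a x y : h x (a *: y) = s a * h x y.
Proof. by rewrite /h hvecZ -scalemxAr mxE. Qed.
Lemma h0l y : h 0 y = 0. Proof. by rewrite -(scale0r 0) hZl mul0r. Qed.
Lemma h0r y : h y 0 = 0. Proof. by rewrite -(scale0r 0) hZr rmorph0 mul0r. Qed.
Lemma hNl x y : h (- x) y = - h x y. Proof. by rewrite -scaleN1r hZl mulN1r. Qed.
Lemma hNr x y : h x (- y) = - h x y.
Proof. by rewrite -scaleN1r hZr rmorphN rmorph1 mulN1r. Qed.
Definition hE := (hDl, hDr, hZl, hZr, hNl, hNr, h0l, h0r).

Definition Perp m (S : 'M_(m, n.+1)) p := forall z, (z <= S)%MS -> h p z = 0.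

Lemma PerpE p y : Perp y p -> h p y = 0. Proof. exact. Qed.
Lemma Perp_sub m1 m2 (A : 'M_(m1, n.+1)) (B : 'M_(m2, n.+1)) p :
  (B <= A)%MS -> Perp A p -> Perp B p.
Proof. by move=> sBA pA z zB; apply/pA/(submx_trans zB). Qed.
Lemma Perp_addsl m1 m2 (A : 'M_(m1, n.+1)) (B : 'M_(m2, n.+1)) p :
  Perp (A + B)%MS p -> Perp A p.
Proof. by apply: Perp_sub; apply: addsmxSl. Qed.
Lemma Perp_addsr m1 m2 (A : 'M_(m1, n.+1)) (B : 'M_(m2, n.+1)) p :
  Perp (A + B)%MS p -> Perp B p.
Proof. by apply: Perp_sub; apply: addsmxSr. Qed.
Lemma PerpD m (S : 'M_(m, n.+1)) a p q : Perp S p -> Perp S q -> Perp S (p + a *: q).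
Proof. by move=> pS qS z zS; rewrite !hE pS // qS // mulr0 addr0. Qed.

Lemma PerpP m (S : 'M_(m, n.+1)) p :
  p *m (M *m (map_mx s S)^T) = 0 -> Perp S p.
Proof.
move=> pS _ /submxP[D ->]; rewrite /h /hvec map_mxM trmx_mul !mulmxA -(mulmxA p) pS.
by rewrite mul0mx mxE.
Qed.

Definition GU : {set gT} :=
  [set g : gT | GLval g *m M *m (map_mx s (GLval g))^T == M].

Lemma GU_group_set : group_set GU.
Proof.
apply/group_setP; split=> [|A B].
  by rewrite inE /= map_mx1 trmx1 mul1mx mulmx1.
rewrite !inE /= => /eqP hA /eqP hB; apply/eqP.
by rewrite -[RHS]hA -{2}hB map_mxM trmx_mul !mulmxA.
Qed.
Canonical GU_group := Group GU_group_set.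

Lemma GU_h g x y : g \in GU -> h (x *m GLval g) (y *m GLval g) = h x y.
Proof.
rewrite inE => /eqP gM; rewrite /h /hvec map_mxM trmx_mul -{2}gM.
by rewrite !mulmxA.
Qed.

Lemma h_GU g : (forall x y, h (x *m GLval g) (y *m GLval g) = h x y) -> g \in GU.
Proof.
move=> gh; rewrite inE; apply/eqP/matrixP=> i j.
have ent (A : 'M[K]_n.+1) : A i j = (delta_mx 0 i *m A *m (delta_mx 0 j)^T : 'M_1) 0 0.
  by rewrite trmx_delta -rowE -colE !mxE.
have := gh (delta_mx 0 i) (delta_mx 0 j).
by rewrite !ent /h /hvec map_mxM map_delta_mx trmx_mul !mulmxA.
Qed.

Hypotheses (sK : involutive s) (two : 2%:R != 0 :> K).
Variable e : K.
Hypotheses (e_skew : s e = - e) (nz_e : e != 0).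
Hypotheses (M_skew : (map_mx s M)^T = - M) (M_unit : M \in unitmx).

Lemma hC x y : h y x = - s (h x y).
Proof.
rewrite /h /hvec -[RHS]mulN1r.
have -> : s ((x *m (M *m (map_mx s y)^T)) 0 0) =
    (map_mx s (x *m (M *m (map_mx s y)^T)))^T 0 0 by rewrite !mxE.
rewrite !map_mxM !trmx_mul M_skew -map_trmx trmxK -map_mx_comp.
rewrite (map_mx_id (f := s \o s)); last by move=> x0; apply: sK.
by rewrite mulmxN mulNmx [in RHS]mxE mulN1r opprK mulmxA.
Qed.

Lemma hC0 x y : h x y = 0 -> h y x = 0.
Proof. by move=> xy; rewrite hC xy rmorph0 oppr0. Qed.

Lemma dual_perp m (S : 'M_(m, n.+1)) y : ~~ (y <= S)%MS ->
  exists2 p, Perp S p & h p y = 1.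
Proof.
case/dual_col=> c Sc yc; exists ((map_mx s c)^T *m invmx M).
  apply: PerpP; rewrite mulmxA mulmxKV // -trmx_mul -map_mxM Sc map_mx0.
  by rewrite trmx0.
rewrite /h /hvec mulmxA mulmxKV // -trmx_mul -map_mxM yc map_mx1 trmx1.
by rewrite mxE.
Qed.

Lemma nondeg y : y != 0 -> exists p, h p y = 1.
Proof.
move=> nz; have [|p _ py] := @dual_perp 1 (0 : 'rV_n.+1) y; last by exists p.
by apply: contra nz => /submx0null->.
Qed.

Lemma ex_Perp m k (S : 'M_(m, n.+1)) (B : 'M_(k, n.+1)) :
  (\rank S + \rank B < n.+1)%N -> exists2 p, Perp S p & ~~ (p <= B)%MS.
Proof.
move=> lt; have [|p pS pB] := @ex_perp K k _ _ (M *m (map_mx s S)^T) B.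
  rewrite addnC (leq_ltn_trans _ lt) // leq_add2r.
  by rewrite (leq_trans (mxrankM_maxr _ _)) // mxrank_tr mxrank_map.
by exists p => //; apply: PerpP.
Qed.

(** Two orthogonal anisotropic vectors have skew values, so minus their ratio is fixed by [s], hence
    is a norm; this makes some combination of them isotropic. *)
Lemma iso_exists m (S : 'M_(m, n.+1)) : (\rank S + 2 <= n.+1)%N ->
  exists w, [/\ w != 0, h w w = 0 & Perp S w].
Proof.
move=> rS; have [|x xS nz_x] := @ex_Perp _ _ S (0 : 'rV[K]_n.+1).
  by rewrite mxrank0 addn0 (leq_trans _ rS) // addn2 ltnS.
have {}nz_x : x != 0 by apply: contraNneq nz_x => ->; apply: sub0mx.
have [|y yS nyx] := @ex_Perp _ _ S x.
  by rewrite (leq_trans _ rS) // addn2 ltnS -(addn1 (\rank S)) leq_add2l rank_leq_row.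
have [xx | nxx] := eqVneq (h x x) 0; first by exists x.
pose y' := y + - (h y x / h x x) *: x.
have y'S : Perp S y' by apply: PerpD.
have y'x : h y' x = 0 by rewrite !hE mulNr divfK // subrr.
have xy' : h x y' = 0 by apply: hC0.
have nz_y' : y' != 0.
  apply: contra nyx; rewrite addr_eq0 => /eqP->.
  by rewrite scaleNr opprK scalemx_sub.
clearbody y'; have [yy | nyy] := eqVneq (h y' y') 0; first by exists y'.
have sxx : s (h x x) = - h x x by apply/eqP; rewrite -eqr_oppLR -hC.
have syy : s (h y' y') = - h y' y' by apply/eqP; rewrite -eqr_oppLR -hC.
have [||a na] := @norm_surj K s sK e e_skew nz_e (- (h x x / h y' y')).
- by rewrite rmorphN rmorphM fmorphV sxx syy invrN mulrNN.
- by rewrite oppr_eq0 mulf_neq0 ?invr_eq0.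
exists (x + a *: y'); split; last exact: PerpD.
  apply/eqP=> e0; have := h0l x; rewrite -e0 !hE y'x mulr0 addr0 => /eqP.
  by apply/negP.
rewrite !hE y'x xy' !mulr0 addr0 add0r mulrA na mulNr divfK // subrr //.
Qed.


(** * Siegel transvections *)

Lemma mx_act_inj (A B : 'M[K]_n.+1) : (forall v, v *m A = v *m B) -> A = B.
Proof. by move=> AB; apply/row_matrixP=> i; rewrite !rowE. Qed.

Lemma s_half (a : K) : s (a / 2%:R) = s a / 2%:R.
Proof. by rewrite rmorphM fmorphV rmorph_nat. Qed.

Lemma split_half a : a / 2%:R + a / 2%:R = a.
Proof. by rewrite -mulrDl -mulr2n -[a *+ 2]mulr_natr mulfK. Qed.

(** The Siegel transvection v |-> v + h(v,w) b + (h(v,b) + t h(v,w)) w; for [b = 0] it is a unitary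
    transvection. For fixed [w] the parameters (b, t) multiply as in a Heisenberg group, with the
    transvections central. *)
Definition smx w b t : 'M[K]_n.+1 :=
  1%:M + hvec w *m b + hvec b *m w + t *: (hvec w *m w).

Lemma smxE v w b t : v *m smx w b t = v + h v w *: b + (h v b + t * h v w) *: w.
Proof.
rewrite /smx !mulmxDr mulmx1 -scalemxAr !(mulmxA v (hvec _)) !hvecE !mul_scalar_mx scalerA.
by rewrite scalerDl !addrA.
Qed.

(** Conditions under which [smx w b t] is an isometry. *)
Definition sok w b t := [/\ h w w = 0, h b w = 0 & t - s t = h b b].

Lemma sokC w b t : sok w b t -> h w b = 0. Proof. by case=> _ /hC0. Qed.

Lemma smxM w b t c t' : sok w b t -> sok w c t' ->
  smx w b t *m smx w c t' = smx w (b + c) (t + t' + h b c).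
Proof.
move=> okb okc; have [ww bw _] := okb; have wc := sokC okc.
apply: mx_act_inj => v; rewrite mulmxA !smxE !hE bw ww wc.
by apply/rowP=> i; rewrite !mxE; ring.
Qed.

Lemma sok0 w : h w w = 0 -> sok w 0 0.
Proof. by move=> ww; split; rewrite ?hE // rmorph0 subr0. Qed.

Lemma sokM w b t c t' : sok w b t -> sok w c t' -> sok w (b + c) (t + t' + h b c).
Proof.
case=> ww bw bb [_ cw cc]; split=> //; first by rewrite !hE bw cw addr0.
rewrite !rmorphD !hE -bb -cc [h c b]hC; ring.
Qed.

Lemma sokN w b t : sok w b t -> sok w (- b) (- s t).
Proof.
case=> ww bw bb; split=> //; rewrite ?hE ?bw ?oppr0 //.
by rewrite rmorphN sK -bb !opprK addrC.
Qed.

Lemma smx0 w : smx w 0 0 = 1%:M.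
Proof. by apply: mx_act_inj => v; rewrite smxE !hE scaler0 mul0r add0r scale0r !addr0 mulmx1. Qed.

Lemma smxV w b t : sok w b t -> smx w b t *m smx w (- b) (- s t) = 1%:M.
Proof.
move=> ok; rewrite smxM //; last exact: sokN.
by case: ok => _ _ bb; rewrite subrr bb hE subrr smx0.
Qed.

Definition sgl w b t : gT := toGL (smx w b t).

Lemma sglK w b t : sok w b t -> GLval (sgl w b t) = smx w b t.
Proof. by move/smxV/mulmx1_unit=> [u _]; apply: toGLK. Qed.

Lemma sglE v w b t : sok w b t ->
  v *m GLval (sgl w b t) = v + h v w *: b + (h v b + t * h v w) *: w.
Proof. by move=> ok; rewrite sglK // smxE. Qed.

(* Otherwise failed unification attempts unfold these deeply. *)
Opaque hform hvec smx sgl.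

Lemma sglM w b t c t' : sok w b t -> sok w c t' ->
  (sgl w b t * sgl w c t')%g = sgl w (b + c) (t + t' + h b c).
Proof.
move=> okb okc; apply: GL_inj; rewrite GLM !sglK ?smxM //; exact: sokM.
Qed.

Lemma sgl0 w : sgl w 0 0 = 1%g.
Proof. by apply: GL_inj; rewrite toGLK smx0 // unitmx1. Qed.

Lemma sglV w b t : sok w b t -> (sgl w b t)^-1%g = sgl w (- b) (- s t).
Proof.
move=> ok; apply/eqP; rewrite eq_invg_mul sglM //; last exact: sokN.
by case: ok => _ _ bb; rewrite subrr bb hE subrr sgl0.
Qed.

Lemma sgl_GU w b t : sok w b t -> sgl w b t \in GU.
Proof.
move=> ok; have [ww bw bb] := ok; have wb := sokC ok.
apply: h_GU => x y; rewrite !sglE // !hE !rmorphD !rmorphM ww bw wb -bb.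
rewrite [h w y]hC [h b y]hC; ring.
Qed.

Lemma sglJ w b t g : sok w b t -> g \in GU ->
  (sgl w b t ^ g)%g = sgl (w *m GLval g) (b *m GLval g) t.
Proof.
move=> ok Gg; have [ww bw bb] := ok.
have okg : sok (w *m GLval g) (b *m GLval g) t by split; rewrite GU_h.
apply: (mulgI g); rewrite -conjgC; apply: GL_inj; rewrite !GLM; apply: mx_act_inj => v.
by rewrite !mulmxA !sglE // !GU_h // !mulmxDl -!scalemxAl.
Qed.

Lemma sokJ w b t g : sok w b t -> g \in GU -> sok (w *m GLval g) (b *m GLval g) t.
Proof. by case=> ww bw bb Gg; split; rewrite GU_h. Qed.

Definition sym a := s a = a.

Lemma sok_T w a : h w w = 0 -> sym a -> sok w 0 a.
Proof. by move=> ww sc; split; rewrite ?hE // sc subrr. Qed.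

Lemma sgl_TE w b t a : sok w b t -> sym a -> sgl w b (t + a) = (sgl w b t * sgl w 0 a)%g.
Proof.
by move=> ok sc; have [ww _ _] := ok; rewrite sglM ?addr0 ?hE ?addr0 //; apply: sok_T.
Qed.

Lemma sok_sym w b t t' : sok w b t -> sok w b t' -> sym (t' - t).
Proof.
case=> _ _ bb [_ _ bb']; rewrite /sym rmorphB.
have -> : s t' = t' - h b b by rewrite -bb' opprB addrC subrK.
have -> : s t = t - h b b by rewrite -bb opprB addrC subrK.
by rewrite opprB addrA subrK.
Qed.

Lemma sok_half w b : h w w = 0 -> h b w = 0 -> sok w b (h b b / 2%:R).
Proof.
move=> ww bw; split=> //; rewrite s_half.
by rewrite -[s _]opprK -hC mulNr opprK split_half.
Qed.

Lemma sglR w b t c t' : sok w b t -> sok w c t' ->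
  [~ sgl w b t, sgl w c t']%g = sgl w 0 (h b c - h c b).
Proof.
move=> okb okc; have [ww _ _] := okb.
have ok0 : sok w 0 (h b c - h c b).
  by apply: sok_T => //; rewrite /sym rmorphB [h c b]hC rmorphN sK; ring.
apply: (mulgI (sgl w c t' * sgl w b t)%g); rewrite -commgC !sglM //; last exact: sokM.
rewrite addr0 [c + b]addrC hDl !h0r !addr0; have -> // : t + t' + h b c = t' + t + h c b + (h b c - h c b) by ring.
Qed.

Lemma sglRfix w b t g : sok w b t -> g \in GU -> w *m GLval g = w ->
  exists2 t', sok w (b *m GLval g - b) t' &
  [~ sgl w b t, g]%g = sgl w (b *m GLval g - b) t'.
Proof.
move=> ok Gg wg; rewrite commgEl sglV // sglJ // wg.
have okN := sokN ok; have okg := sokJ ok Gg; rewrite wg in okg.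
have okM := sokM okN okg; rewrite [- b + _]addrC in okM.
by eexists; [exact: okM | rewrite sglM // [- b + _]addrC].
Qed.

(** The commutator parameter is [h b c - h c b]. With [p] orthogonal to [w] and [h p b = 1], the
    multiple [c] of [p] by [- (a / 2)] makes each term contribute half of [a]. *)
Lemma T_comm w b a : w != 0 -> sym a -> sok w b (h b b / 2%:R) -> ~~ (b <= w)%MS ->
  exists c t', sok w c t' /\ forall t, sok w b t -> sgl w 0 a = [~ sgl w b t, sgl w c t']%g.
Proof.
move=> nz_w sa [ww bw _] nbw; have [p /PerpE pw pb] := dual_perp nbw.
have bp : h b p = -1 by rewrite hC pb rmorph1.
have s2 : s (- (a / 2%:R)) = - (a / 2%:R) by rewrite rmorphN s_half sa.
exists (- (a / 2%:R) *: p), (h (- (a / 2%:R) *: p) (- (a / 2%:R) *: p) / 2%:R).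
have ok : sok w (- (a / 2%:R) *: p) (h (- (a / 2%:R) *: p) (- (a / 2%:R) *: p) / 2%:R).
  by apply: sok_half; rewrite // hE pw mulr0.
split=> // t okb; rewrite (sglR okb ok); congr (sgl _ _ _).
by rewrite !(hZl, hZr) s2 bp pb mulrN1 opprK mulr1 opprK split_half.
Qed.

(** The coefficient is chosen so that each of the two cross terms equals minus half of [h b b]. *)
Lemma iso_shift b z : h z z = 0 -> h b z != 0 ->
  exists a, h (b + a *: z) (b + a *: z) = 0.
Proof.
move=> zz bz; pose x := s (- (h b b / 2%:R) / h b z); exists x.
have sbb : s (h b b) = - h b b by apply/eqP; rewrite -eqr_oppLR -hC.
have E1 : s x * h b z = - (h b b / 2%:R) by rewrite /x sK divfK.
have E2 : x * h z b = - (h b b / 2%:R).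
  rewrite [h z b]hC -{1}[x]sK mulrN -rmorphM E1 rmorphN s_half sbb mulNr.
  by rewrite opprK.
by rewrite !hE zz E2 [s x * h b _]E1 !mulr0 !addr0 -addrA -opprD split_half subrr.
Qed.

(** * From one transvection to all Siegel transvections *)

Section Spread.
Variable N : {group gT}.
Hypothesis nN : forall w b t, sok w b t -> sgl w b t \in 'N(N)%g.

Lemma T_of_sgl w b t a : w != 0 -> sok w b t -> ~~ (b <= w)%MS ->
  sgl w b t \in N -> sym a -> sgl w 0 a \in N.
Proof.
move=> nz_w ok nbw Nb sa; have [ww bw _] := ok.
have [c [t' [okc E]]] := T_comm nz_w sa (sok_half ww bw) nbw.
by rewrite (E _ ok) commg_mem_norm // nN.
Qed.

Definition allT w := forall a, sym a -> sgl w 0 a \in N.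

(** For [p] orthogonal to [z] with [h p w = 1], the transvection along [w] moves [p] by [w], so its
    commutator with a Siegel transvection for (z, p) is one for (z, w). The parameter [t] is not
    controlled. *)
Lemma sgl_of_T z w : h z z = 0 -> h w w = 0 -> h w z = 0 -> ~~ (w <= z)%MS ->
  allT w -> exists2 t, sok z w t & sgl z w t \in N.
Proof.
move=> zz ww wz nwz Tw; have [p /PerpE pz pw] := dual_perp nwz.
have okp := sok_half zz pz; have s1 : sym 1 by rewrite /sym rmorph1.
have okw := sok_T ww s1; have zw := hC0 wz.
have Ez : z *m GLval (sgl w 0 1) = z.
  by rewrite sglE // zw h0r mulr0 addr0 !scale0r !addr0.
have Ep : p *m GLval (sgl w 0 1) - p = w.
  by rewrite sglE // pw hE scaler0 addr0 mulr1 add0r scale1r addrC addKr.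
have [t okt E] := sglRfix okp (sgl_GU okw) Ez; rewrite Ep in okt E.
by exists t => //; rewrite -E commg_norm_mem ?Tw // nN.
Qed.

Lemma allT_perp z w : z != 0 -> h z z = 0 -> h w w = 0 -> h w z = 0 ->
  ~~ (w <= z)%MS -> allT w -> allT z.
Proof.
move=> nz_z zz ww wz nwz Tw a sa; have [t ok Nt] := sgl_of_T zz ww wz nwz Tw.
exact: T_of_sgl Nt sa.
Qed.

Lemma allT_scale z a : a != 0 -> h z z = 0 -> allT (a *: z) -> allT z.
Proof.
move=> nz_a zz Taz r sr; have nz_sa : s a != 0 by rewrite fmorph_eq0.
have sr' : sym (r / (a * s a)).
  by rewrite /sym rmorphM fmorphV rmorphM sK sr [s a * a]mulrC.
suff -> : sgl z 0 r = sgl (a *: z) 0 (r / (a * s a)) by apply: Taz.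
have azz : h (a *: z) (a *: z) = 0 by rewrite !hE zz !mulr0.
apply: GL_inj; apply: mx_act_inj => v; rewrite !sglE; try exact: sok_T.
rewrite !hE !scaler0 !addr0 !add0r scalerA; congr (_ + _ *: _).
by rewrite -mulrA mulrACA -!mulrA; field; rewrite nz_a nz_sa.
Qed.

Hypothesis n_ge3 : (3 <= n)%N.

(** Distinct orthogonal isotropic lines are linked by [allT_perp]; non-orthogonal ones are linked
    through an isotropic vector orthogonal to both. *)
Lemma allT_all z w : w != 0 -> z != 0 -> h w w = 0 -> h z z = 0 -> allT w -> allT z.
Proof.
move=> nz_w nz_z ww zz Tw.
have [wz | nwz] := eqVneq (h w z) 0.
  have [/sub_rV_scale[a ew] | nwz] := boolP (w <= z)%MS; last exact: (allT_perp nz_z zz ww wz nwz).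
  rewrite ew in Tw nz_w; apply: allT_scale Tw => //.
  by apply: contraNneq nz_w => ->; rewrite scale0r.
have [|y [nz_y yy ywz]] := @iso_exists _ (w + z)%MS.
  rewrite addn2 ltnS (leq_trans _ n_ge3) // ltnS (leq_trans (rank_adds_rV _ _)) //.
  by rewrite ltnS rank_leq_row.
have yw := PerpE (Perp_addsl ywz); have yz := PerpE (Perp_addsr ywz).
apply: (@allT_perp z y) => //.
  apply/negP=> /sub_rV_scale[a ey]; move: yw; rewrite ey hE => /eqP.
  rewrite mulf_eq0 => /orP[/eqP a0 | /eqP/hC0/eqP]; last by apply/negP.
  by rewrite ey a0 scale0r eqxx in nz_y.
apply: (@allT_perp y w) => //; first exact: hC0.
apply/negP=> /sub_rV_scale[a ew]; case/eqP: nwz.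
by rewrite ew hE yz mulr0.
Qed.

Lemma sgl_adjust w b t t' : sok w b t -> sok w b t' -> allT w ->
  sgl w b t \in N -> sgl w b t' \in N.
Proof.
move=> ok ok' Tw Nt; rewrite -[t'](subrK t) addrC sgl_TE //; last exact: sok_sym ok ok'.
by rewrite groupM // Tw //; apply: sok_sym ok ok'.
Qed.

(** It suffices to find an anisotropic [x] orthogonal to [w] and [b]: then [x + a *: b] is isotropic
    for some nonzero [a], by surjectivity of the norm, and it is not orthogonal to [b]. *)
Lemma isotropic_perp w b : w != 0 -> h w w = 0 -> h b w = 0 -> h b b != 0 ->
  exists2 z, h z z = 0 & h z w = 0 /\ h b z != 0.
Proof.
move=> nz_w ww bw nbb.
have nwb : ~~ (w <= b)%MS.
  apply/negP=> /sub_rV_scale[a ew]; case/eqP: (nz_w).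
  move: bw; rewrite ew hE => /eqP; rewrite mulf_eq0 (negPf nbb) orbF fmorph_eq0.
  by move/eqP->; rewrite scale0r.
have [p /PerpE pb pw] := dual_perp nwb.
(* Orthogonality to [p] keeps [y] out of the degenerate span of [w] and [b]; three conditions leave
   room because n + 1 > 3. *)
have [|y yS nz_y] := @ex_Perp _ _ (w + b + p)%MS (0 : 'rV[K]_n.+1).
  rewrite mxrank0 addn0 ltnS (leq_trans _ n_ge3) // (leq_trans (rank_adds_rV _ _)) //.
  by rewrite ltnS (leq_trans (rank_adds_rV _ _)) // ltnS rank_leq_row.
have {}nz_y : y != 0 by apply: contraNneq nz_y => ->; apply: sub0mx.
have yp := PerpE (Perp_addsr yS); have ywb := Perp_addsl yS.
have yw := PerpE (Perp_addsl ywb); have yb := PerpE (Perp_addsr ywb).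
have wp : h w p = -1 by rewrite hC pw rmorph1.
have nywb : ~~ (y <= w + b)%MS.
  apply/negP=> /sub_adds_rV[_ /sub_rV_scale[x ->] [x' ey]]; case/eqP: nz_y.
  move: yb; rewrite ey !hE (hC0 bw) mulr0 add0r => /eqP.
  rewrite mulf_eq0 (negPf nbb) orbF => /eqP x'0.
  move: yp; rewrite ey x'0 !hE wp mulrN1 mul0r addr0 => /eqP.
  by rewrite oppr_eq0 => /eqP->; rewrite !scale0r addr0.
have [q qwb qy] := dual_perp nywb.
have qw := PerpE (Perp_addsl qwb); have qb := PerpE (Perp_addsr qwb).
(* If [y] and [q] are both isotropic, the form takes the value -2e on [q + e *: y]. *)
have [x [xw xb nxx]] : exists x, [/\ h x w = 0, h x b = 0 & h x x != 0].
  have [yy | nyy] := eqVneq (h y y) 0; last by exists y.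
  have [qq | nqq] := eqVneq (h q q) 0; last by exists q.
  exists (q + e *: y); rewrite !hE qw yw qb yb !mulr0 !addr0; split=> //.
  rewrite qq yy qy [h y q]hC qy rmorph1 e_skew mulr1 mulrN1 !mulr0 add0r addr0.
  by rewrite -opprD oppr_eq0 -mulr2n -mulr_natr mulf_neq0.
have syy y0 : s (h y0 y0) = - h y0 y0 by apply/eqP; rewrite -eqr_oppLR -hC.
have [||a na] := @norm_surj K s sK e e_skew nz_e (- (h x x / h b b)).
- by rewrite rmorphN rmorphM fmorphV !syy invrN mulrNN.
- by rewrite oppr_eq0 mulf_neq0 ?invr_eq0.
exists (x + a *: b); rewrite !hE.
  by rewrite (hC0 xb) xb !mulr0 addr0 add0r mulrA na mulNr divfK // subrr.
split; first by rewrite xw bw mulr0 addr0.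
rewrite (hC0 xb) add0r mulf_neq0 // fmorph_eq0.
apply: contraNneq nxx => a0; move: na; rewrite a0 mul0r => /eqP.
by rewrite eq_sym oppr_eq0 mulf_eq0 invr_eq0 (negPf nbb) orbF.
Qed.

(** For isotropic [b], [sgl_of_T] gives the right vector parameter and a transvection along [w]
    corrects the scalar one; if [b] is on the line of [w], the element is itself a transvection. An
    anisotropic [b] is the sum of the isotropic vectors [b + x *: z] and [- (x *: z)]. *)
Lemma sgl_all w b t : (forall z, h z z = 0 -> allT z) -> sok w b t -> sgl w b t \in N.
Proof.
move=> Tall.
have iso c r : sok w c r -> h c c = 0 -> sgl w c r \in N.
  move=> ok cc; have [ww cw rr] := ok.
  have [/sub_rV_scale[a ec] | ncw] := boolP (c <= w)%MS; last first.
    have [r' ok' Nr'] := sgl_of_T ww cc cw ncw (Tall c cc).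
    by apply: sgl_adjust ok' ok (Tall w ww) Nr'.
  have sr : sym r by apply/eqP; rewrite eq_sym -subr_eq0 rr cc.
  have sa : sym (a + s a + r) by rewrite /sym !rmorphD sK sr [s a + a]addrC.
  suff -> : sgl w c r = sgl w 0 (a + s a + r) by apply: Tall.
  apply: GL_inj; apply: mx_act_inj => v; rewrite !sglE //; last exact: sok_T.
  by rewrite ec; apply/rowP=> i; rewrite !hE !mxE; ring.
have [-> | nz_w] := eqVneq w 0.
  suff E r c : sgl 0 c r = 1%g by rewrite E.
  apply: GL_inj; rewrite toGLK; last first.
    by rewrite (_ : smx 0 c r = 1%:M) ?unitmx1 //; apply: mx_act_inj => v; rewrite smxE !hE scale0r scaler0 !addr0 mulmx1.
  by apply: mx_act_inj => v; rewrite smxE !hE scale0r scaler0 !addr0 mulmx1.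
move=> ok; have [ww bw bb] := ok.
have [b0 | nbb] := eqVneq (h b b) 0; first exact: iso.
have [z zz [zw bz]] := isotropic_perp nz_w ww bw nbb.
have [x bxz0] := iso_shift zz bz.
have ok1 : sok w (b + x *: z) 0 by split=> //; rewrite ?bxz0 ?rmorph0 ?subrr // !hE bw zw mulr0 addr0.
have xz0 : h (- (x *: z)) (- (x *: z)) = 0 by rewrite !hE zz !(mulr0, oppr0).
have ok2 : sok w (- (x *: z)) 0 by split=> //; rewrite ?xz0 ?rmorph0 ?subrr // !hE zw mulr0 oppr0.
have := groupM (iso _ _ ok1 bxz0) (iso _ _ ok2 xz0).
have := sokM ok1 ok2; rewrite (sglM ok1 ok2) addrK => ok12 Nb.
exact: sgl_adjust ok12 ok (Tall w ww) Nb.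
Qed.

End Spread.

Hypothesis n_ge3 : (3 <= n)%N.

(** Two isotropic vectors share their eigenvalue because a combination involving both is isotropic
    too; an anisotropic vector is a difference of two isotropic ones. *)
Lemma isotropic_lines_scalar g :
  (forall u, h u u = 0 -> (u *m GLval g <= u)%MS) -> g \in scalar_GL K n.
Proof.
move=> stg; have [|w [nz_w ww _]] := @iso_exists _ (0 : 'rV[K]_n.+1).
  by rewrite mxrank0 ltnS (leq_trans _ n_ge3).
have [a wa] := sub_rV_scale _ _ (stg w ww).
have same u : h u u = 0 -> u *m GLval g = a *: u.
  move=> uu; have [c uc] := sub_rV_scale _ _ (stg u uu); rewrite uc.
  have [/sub_rV_scale[b eu] | nuw] := boolP (u <= w)%MS.
    by rewrite -uc eu -scalemxAl wa !scalerA mulrC.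
  have [t [nz_t wtu]] : exists t, t != 0 /\ h (w + t *: u) (w + t *: u) = 0.
    have [wu | nwu] := eqVneq (h w u) 0.
      by exists 1; rewrite oner_neq0 scale1r !hE ww uu wu (hC0 wu) !addr0.
    (* With this [t] the two cross terms are 1 and -1. *)
    exists (s (h w u)^-1); rewrite fmorph_eq0 invr_eq0 nwu; split=> //.
    rewrite !hE ww uu [h u w]hC sK mulVf // fmorphV mulrN mulVf ?fmorph_eq0 //.
    by rewrite add0r !mulr0 addr0 subrr.
  have [d] := sub_rV_scale _ _ (stg _ wtu).
  rewrite mulmxDl -scalemxAl wa uc scalerDr !scalerA => /eqP.
  rewrite -subr_eq0 opprD addrACA -!scalerBl => /eqP E.
  have cd : t * c - d * t = 0.
    apply: contraNeq nuw => nz; apply/sub_rV_scale; exists (- ((a - d) / (t * c - d * t))).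
    have := congr1 (fun x => (t * c - d * t)^-1 *: x) E.
    rewrite scalerDr !scalerA mulVf // scale1r scaler0 => /eqP.
    by rewrite addrC addr_eq0 => /eqP->; rewrite scaleNr mulrC.
  have ad : a = d.
    apply/eqP; rewrite -subr_eq0; apply: contraNT nz_w => nz.
    move/eqP: E; rewrite cd scale0r addr0 scaler_eq0 (negPf nz).
    by move/eqP->.
  move/eqP: cd; rewrite mulrC -mulrBl mulf_eq0 (negPf nz_t) orbF subr_eq0 => /eqP->.
  by rewrite ad.
apply/scalar_GLP; exists a; apply: mx_act_inj => v; rewrite mul_mx_scalar.
have [vv | nvv] := eqVneq (h v v) 0; first exact: same.
have [|w' [nz_w' ww' /PerpE w'v]] := @iso_exists _ v.
  by rewrite addn2 ltnS (leq_trans _ n_ge3) // ltnS (leq_trans (rank_leq_row _)).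
have [z zz [_ vz]] := isotropic_perp n_ge3 nz_w' ww' (hC0 w'v) nvv.
have [x vxz] := iso_shift zz vz.
rewrite -[v in LHS](addrK (x *: z)) mulmxBl same // -scalemxAl same //.
by rewrite scalerDr !scalerA [x * a]mulrC addrK.
Qed.

(** * Factorization of unitary elements along a hyperbolic frame *)

Definition sgl_group : {group gT} :=
  <<[set g : gT | [exists w, exists b, exists t,
       [&& h w w == 0, h b w == 0, t - s t == h b b & g == sgl w b t]]]>>%G.

Lemma sgl_setP g : reflect (exists w b t, sok w b t /\ g = sgl w b t)
  (g \in [set g : gT | [exists w, exists b, exists t,
       [&& h w w == 0, h b w == 0, t - s t == h b b & g == sgl w b t]]]).
Proof.
rewrite inE; apply: (iffP existsP) => [[w /existsP[b /existsP[t]]]|[w [b [t [[ww bw bb] ->]]]]].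
  by case/and4P=> /eqP ww /eqP bw /eqP bb /eqP->; exists w, b, t.
exists w; apply/existsP; exists b; apply/existsP; exists t.
by rewrite ww bw bb !eqxx.
Qed.

Lemma mem_sgl_group w b t : sok w b t -> sgl w b t \in sgl_group.
Proof. by move=> ok; apply/mem_gen/sgl_setP; exists w, b, t. Qed.

Lemma sgl_group_sub (N : {group gT}) :
  (forall w b t, sok w b t -> sgl w b t \in N) -> sgl_group \subset N.
Proof.
move=> sN; rewrite gen_subG; apply/subsetP=> g /sgl_setP[w [b [t [ok ->]]]].
exact: sN.
Qed.

Lemma sgl_group_normal : (sgl_group <| GU)%g.
Proof.
apply/andP; split; first by apply: (@sgl_group_sub GU_group) => w b t /sgl_GU.
rewrite norms_gen //; apply/subsetP=> g Gg; rewrite inE.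
apply/subsetP=> _ /imsetP[_ /sgl_setP[w [b [t [ok ->]]]] ->]; apply/sgl_setP.
by exists (w *m GLval g), (b *m GLval g), t; rewrite sglJ //; split=> //; apply: sokJ.
Qed.

(** Non-degeneracy of the form on the row space of [S]; isotropic vectors are allowed. *)
Definition anisotropic_span m (S : 'M[K]_(m, n.+1)) :=
  forall y, (y <= S)%MS -> Perp S y -> y = 0.

Definition fixes m (S : 'M[K]_(m, n.+1)) g := forall z, (z <= S)%MS -> z *m GLval g = z.

Lemma fixesM m (S : 'M[K]_(m, n.+1)) g g' : fixes S g -> fixes S g' -> fixes S (g * g')%g.
Proof. by move=> fg fg' z zS; rewrite GLM mulmxA fg // fg'. Qed.

Lemma fixes_sgl m (S : 'M[K]_(m, n.+1)) w b t : sok w b t -> Perp S w -> Perp S b ->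
  fixes S (sgl w b t).
Proof.
move=> ok Sw Sb z zS; rewrite sglE //.
by rewrite (hC0 (Sw z zS)) (hC0 (Sb z zS)) mulr0 addr0 !scale0r !addr0.
Qed.

(** After rescaling [v] to [v1] with [h u v1 = 1], the transvection along [u] followed by the one
    along [v1] sends [v1] to [- u]. *)
Lemma line_trans_nonperp m (S : 'M[K]_(m, n.+1)) u v :
  h u u = 0 -> h v v = 0 -> Perp S u -> Perp S v -> h u v != 0 ->
  exists2 g, g \in sgl_group & fixes S g /\ (v *m GLval g <= u)%MS.
Proof.
move=> uu vv Su Sv uv; have s1 : sym 1 by rewrite /sym rmorph1.
pose a := s (h u v)^-1; pose v1 := a *: v.
have nz_a : a != 0 by rewrite fmorph_eq0 invr_eq0.
have Sv1 : Perp S v1 by move=> z zS; rewrite hE Sv // mulr0.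
have v1v1 : h v1 v1 = 0 by rewrite !hE vv !mulr0.
have uv1 : h u v1 = 1 by rewrite hE sK mulVf.
have vE : v = a^-1 *: v1 by rewrite scalerA mulVf ?scale1r.
clearbody v1; have v1u : h v1 u = -1 by rewrite hC uv1 rmorph1.
have S0 : Perp S 0 by move=> z _; rewrite h0l.
have [oku okv] := (sok_T uu s1, sok_T v1v1 s1).
exists (sgl u 0 1%R * sgl v1 0 1%R)%g; first by rewrite groupM ?mem_sgl_group.
split; first by apply: fixesM; apply: fixes_sgl.
suff E : v1 *m GLval (sgl u 0 1%R * sgl v1 0 1%R)%g = - u.
  by rewrite vE -scalemxAl scalemx_sub // E -scaleN1r scalemx_sub.
rewrite GLM mulmxA !sglE // !hE v1u v1v1 uv1 !mul1r !scaler0 !addr0.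
by apply/rowP=> i; rewrite !mxE; ring.
Qed.

(** Orthogonal [u] and [v] are joined through an isotropic vector of the complement of [S] that is
    orthogonal to neither. Non-degeneracy of [S] puts [u] outside [S + v] and [v] outside [S + u],
    which yields such a vector. *)
Lemma line_trans m (S : 'M[K]_(m, n.+1)) u v : anisotropic_span S ->
  h u u = 0 -> h v v = 0 -> u != 0 -> v != 0 -> Perp S u -> Perp S v ->
  exists2 g, g \in sgl_group & fixes S g /\ (v *m GLval g <= u)%MS.
Proof.
move=> ndS uu vv nz_u nz_v Su Sv.
have [uv | ] := eqVneq (h u v) 0; last exact: line_trans_nonperp.
have [vu | nvu] := boolP (v <= u)%MS.
  by exists 1%g; rewrite ?group1 //; split=> [z _|]; rewrite mulmx1.
have nuv : ~~ (u <= v)%MS by apply: contra nvu; apply: exchange1_rV.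
have out x y : Perp S x -> Perp S y -> ~~ (x <= y)%MS -> ~~ (x <= S + y)%MS.
  move=> Sx Sy nxy; apply: contra nxy => /sub_adds_rV[z zS [a ex]].
  rewrite ex (ndS z) ?add0r ?scalemx_sub //.
  have -> : z = x + - a *: y by rewrite ex scaleNr addrK.
  exact: PerpD.
have [p pSv pu] := dual_perp (out _ _ Su Sv nuv).
have [q qSu qv] := dual_perp (out _ _ Sv Su nvu).
have pv := PerpE (Perp_addsr pSv); have qu := PerpE (Perp_addsr qSu).
have yu : h (p + q) u = 1 by rewrite hE pu qu addr0.
have [|x zz] := @iso_shift (p + q) u uu; first by rewrite yu oner_neq0.
have zu : h (p + q + x *: u) u = 1 by rewrite hDl yu hE uu mulr0 addr0.
have zv : h (p + q + x *: u) v = 1 by rewrite !hE pv qv uv mulr0 addr0 add0r.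
have Sz : Perp S (p + q + x *: u).
  apply: PerpD => //; rewrite -[q]scale1r; apply: PerpD.
    exact: Perp_addsl pSv.
  exact: Perp_addsl qSu.
have [|g Rg [fg vg]] := @line_trans_nonperp _ S _ v zz vv Sz Sv.
  by rewrite zv oner_neq0.
have [|g' Rg' [fg' zg']] := @line_trans_nonperp _ S u _ uu zz Su Sz.
  by rewrite hC zu rmorph1 oppr_eq0 oner_neq0.
exists (g * g')%g; first exact: groupM.
split; first exact: fixesM.
by rewrite GLM mulmxA (submx_trans (submxMr _ vg)).
Qed.

Fixpoint span_frame (fs : seq ('rV[K]_n.+1 * 'rV[K]_n.+1)) : 'M[K]_n.+1 :=
  if fs is p :: fs' then (span_frame fs' + (p.1 + p.2))%MS else 0.

(** A list of mutually orthogonal hyperbolic pairs. *)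
Fixpoint frame (fs : seq ('rV[K]_n.+1 * 'rV[K]_n.+1)) : Prop :=
  if fs is p :: fs' then
    [/\ h p.1 p.1 = 0, h p.2 p.2 = 0 & h p.1 p.2 = 1] /\
    [/\ Perp (span_frame fs') p.1, Perp (span_frame fs') p.2 & frame fs']
  else True.

Fixpoint stabilizes_lines (fs : seq ('rV[K]_n.+1 * 'rV[K]_n.+1)) g : bool :=
  if fs is p :: fs' then
    [&& p.1 *m GLval g <= p.1, p.2 *m GLval g <= p.2 & stabilizes_lines fs' g]%MS
  else true.

Lemma frame_anisotropic fs : frame fs -> anisotropic_span (span_frame fs).
Proof.
elim: fs => [_ y /submx0null->//|[u v] fs IHfs /= [[uu vv uv] [Su Sv Ffs]] y].
case/sub_addsmxP=> [[X Y] ->] /=; set z := X *m _ => Sy.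
have zS : (z <= span_frame fs)%MS by apply: submxMl.
have : (Y *m (u + v)%MS <= u + v)%MS by apply: submxMl.
case/sub_adds_rV=> _ /sub_rV_scale[a ->] [b ey]; rewrite ey in Sy *.
have [zu zv] := (hC0 (Su z zS), hC0 (Sv z zS)).
have vu : h v u = -1 by rewrite hC uv rmorph1.
have a0 : a = 0.
  have := PerpE (Perp_addsr (Perp_addsr Sy)).
  by rewrite !hE zv uv vv mulr0 addr0 mulr1 add0r.
have b0 : b = 0.
  have := PerpE (Perp_addsl (Perp_addsr Sy)).
  rewrite !hE zu vu uu mulr0 mulrN1 !add0r => /eqP.
  by rewrite oppr_eq0 => /eqP.
rewrite a0 b0 !scale0r !addr0 in Sy *; apply: IHfs => //.
exact: Perp_addsl Sy.
Qed.

Lemma frame_extend fs : frame fs -> (\rank (span_frame fs) < n)%N ->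
  exists uv, frame (uv :: fs) /\ (\rank (span_frame fs) < \rank (span_frame (uv :: fs)))%N.
Proof.
move=> Ffs lt; have ndS := frame_anisotropic Ffs.
have [|u [nz_u uu Su]] := @iso_exists _ (span_frame fs); first by rewrite addn2 ltnS.
have nuS : ~~ (u <= span_frame fs)%MS by apply: contra nz_u => /ndS->.
have [q Sq qu] := dual_perp nuS.
have Nqu : h (- q) u != 0 by rewrite hE qu oppr_eq0 oner_neq0.
have [x vv] := iso_shift uu Nqu; exists (u, - q + x *: u).
split; last first.
  rewrite ltnNge; apply: contra nuS => /= le; set S' := (_ + _)%MS in le.
  have sS : (span_frame fs <= S')%MS by apply: addsmxSl.
  have sS' : (S' <= span_frame fs)%MS by rewrite -(mxrank_leqif_sup sS).2 eqn_leq mxrankS.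
  by apply: submx_trans sS'; apply: submx_trans (addsmxSr _ _); apply: addsmxSl.
split; split=> //=.
  by rewrite !hE uu [h u q]hC qu rmorph1 opprK mulr0 addr0.
by apply: PerpD => // z zS; rewrite hE Sq ?oppr0.
Qed.

(** Witt decomposition: a complement of dimension at least 2 contains an isotropic vector, so
    hyperbolic pairs split off until the complement has dimension at most 1. *)
Lemma frame_exists : exists2 fs, frame fs & (n <= \rank (span_frame fs))%N.
Proof.
suff H m : exists2 fs, frame fs & (minn m n <= \rank (span_frame fs))%N.
  by have [fs Ffs] := H n; rewrite minnn; exists fs.
elim: m => [|m [fs Ffs le]]; first by exists [::]; rewrite ?min0n.
have [ge | lt] := leqP n (\rank (span_frame fs)).
  by exists fs => //; apply: leq_trans ge; apply: geq_minr.
have [p [Fp ltp]] := frame_extend Ffs lt; exists (p :: fs) => //.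
apply: leq_trans ltp; apply: leq_trans (_ : (minn m n).+1 <= _)%N; last by rewrite ltnS.
by rewrite -minnSS leq_min geq_minl /= (leq_trans (geq_minr _ _)).
Qed.

Lemma stabilizes_span fs g : stabilizes_lines fs g ->
  (span_frame fs <= span_frame fs *m GLval g)%MS.
Proof.
move=> stg; have sub : (span_frame fs *m GLval g <= span_frame fs)%MS.
  elim: fs stg => [|[u v] fs IHfs] /= => [_|/and3P[ug vg /IHfs fg]].
    by rewrite mul0mx sub0mx.
  by rewrite (addsmxMr _ _ (GLval g)) addsmxS // (addsmxMr _ _ (GLval g)) addsmxS.
rewrite -(mxrank_leqif_sup sub).2 mxrankMfree // row_free_unit.
exact: (GL_unit g).
Qed.

Lemma stabilizes_perp fs g y : g \in GU -> stabilizes_lines fs g ->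
  Perp (span_frame fs) y -> Perp (span_frame fs) (y *m GLval g).
Proof.
move=> Gg /stabilizes_span stg Sy z /submx_trans/(_ stg)/submxP[D ->].
by rewrite mulmxA GU_h // Sy // submxMl.
Qed.

Lemma stabilizesM fs g g' : stabilizes_lines fs g -> fixes (span_frame fs) g' ->
  stabilizes_lines fs (g * g')%g.
Proof.
elim: fs => [|[u v] fs IHfs] //= /and3P[ug vg sg] fg'.
have fu : u *m GLval g' = u.
  by apply: fg'; apply: submx_trans (addsmxSr _ _); apply: addsmxSl.
have fv : v *m GLval g' = v.
  by apply: fg'; apply: submx_trans (addsmxSr _ _); apply: addsmxSr.
apply/and3P; split.
- by rewrite -[X in (X <= _)%MS]/(u *m GLval (g * g')%g) GLM mulmxA -{2}fu submxMr.
- by rewrite -[X in (X <= _)%MS]/(v *m GLval (g * g')%g) GLM mulmxA -{2}fv submxMr.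
by apply: IHfs => // z zS; apply: fg'; apply: submx_trans (addsmxSl _ _).
Qed.

(** Once the tail of the frame is settled, transvections bring the image of [u] back to its line,
    then a Siegel transvection along [u] does the same for [v]; all of them fix the tail
    pointwise. *)
Lemma frame_stabilize fs g : frame fs -> g \in GU ->
  exists2 x, x \in sgl_group & stabilizes_lines fs (g * x)%g.
Proof.
have sRG := subsetP (normal_sub sgl_group_normal).
elim: fs g => [|[u v] fs IHfs] g Ff Gg; first by exists 1%g; rewrite ?group1.
have [[/= uu vv uv] [Su Sv Ffs]] := Ff; have ndS := frame_anisotropic Ffs.
have nz_u : u != 0 by apply: contraNneq (oner_neq0 K) => u0; rewrite -uv u0 h0l.
have nzg y g' : y != 0 -> y *m GLval g' != 0.
  apply: contraNneq => e0; rewrite -[y]mulmx1 -(GL_mulmxV g') mulmxA e0.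
  by rewrite mul0mx.
have [x Rx stx] := IHfs g Ffs Gg.
have Ggx : (g * x)%g \in GU by rewrite groupM ?(sRG x).
have [y Ry [fy uy]] := line_trans ndS uu (etrans (GU_h u u Ggx) uu) nz_u
  (nzg u _ nz_u) Su (stabilizes_perp Ggx stx Su).
have Gg1 : (g * x * y)%g \in GU by rewrite groupM ?(sRG y).
have st1 := stabilizesM stx fy; rewrite -mulmxA -GLM in uy.
move eg1: (g * x * y)%g => g1 in Gg1 st1 uy.
have Sv1 := stabilizes_perp Gg1 st1 Sv.
have uv1 : h u (v *m GLval g1) != 0.
  have [c ec] := sub_rV_scale _ _ uy.
  apply: contraNneq (oner_neq0 K) => e0.
  by rewrite -uv -(GU_h u v Gg1) ec hE e0 mulr0.
have v1v1 : h (v *m GLval g1) (v *m GLval g1) = 0 by rewrite GU_h.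
move ev1: (v *m GLval g1) => v1 in Sv1 uv1 v1v1.
pose a := s (h u v1)^-1; pose v2 := a *: v1.
have nz_a : a != 0 by rewrite fmorph_eq0 invr_eq0.
have v1E : v1 = a^-1 *: v2 by rewrite scalerA mulVf ?scale1r.
have v2v2 : h v2 v2 = 0 by rewrite !hE v1v1 !mulr0.
have uv2 : h u v2 = 1 by rewrite hE sK mulVf.
have Sv2 : Perp (span_frame fs) v2 by move=> z zS; rewrite hE Sv1 // mulr0.
clearbody v2; have v2u : h v2 u = -1 by rewrite hC uv2 rmorph1.
have vu : h v u = -1 by rewrite hC uv rmorph1.
have ok : sok u (v2 - v) (- h v2 v).
  split=> //; first by rewrite hDl hNl v2u vu subrr.
  by rewrite !hE v2v2 vv [h v v2]hC rmorphN !opprK; ring.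
have Sd : Perp (span_frame fs) (v2 - v) by rewrite -scaleN1r; apply: PerpD.
have Rz := mem_sgl_group ok; have fz := fixes_sgl ok Su Sd.
have uE := sglE u ok; have vE := sglE v2 ok.
move: (sgl _ _ _) Rz fz uE vE => E Rz fz uE vE.
exists (x * y * E)%g; first by rewrite !groupM.
have eE : (g1 * E = g * (x * y * E))%g by rewrite -eg1 !mulgA.
suff : stabilizes_lines ((u, v) :: fs) (g1 * E)%g by rewrite {1}eE.
rewrite {eE}; apply/and3P; split; last exact: stabilizesM st1 fz.
  have [c ec] := sub_rV_scale _ _ uy.
  rewrite -[X in (X <= _)%MS]/(u *m GLval (g1 * E)%g) GLM mulmxA ec -scalemxAl.
  rewrite scalemx_sub // uE uu !hE uv2 uv subrr.
  by rewrite mulr0 addr0 !scale0r !addr0.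
rewrite -[X in (X <= _)%MS]/(v *m GLval (g1 * E)%g) GLM mulmxA ev1 v1E -scalemxAl.
rewrite scalemx_sub // vE v2u hDr v2v2 hNr mulrN1 opprK add0r addNr scale0r addr0.
by rewrite scaleN1r opprB addrC subrK.
Qed.

(** Both elements are diagonal in one basis: the frame vectors and, if the frame does not span, a
    vector of its one-dimensional complement. *)
Lemma stabilizers_commute fs g g' : frame fs -> (n <= \rank (span_frame fs))%N ->
  g \in GU -> g' \in GU -> stabilizes_lines fs g -> stabilizes_lines fs g' ->
  commute g g'.
Proof.
move=> Ffs rk Gg Gg' sg sg'; apply: GL_inj; rewrite !GLM; apply/eqP; rewrite -subr_eq0.
set D := _ - _; have line y : (y *m GLval g <= y)%MS -> (y *m GLval g' <= y)%MS -> y *m D = 0.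
  move=> /sub_rV_scale[a ya] /sub_rV_scale[b yb].
  by rewrite mulmxBr !mulmxA ya yb -!scalemxAl ya yb !scalerA mulrC subrr.
have SD : span_frame fs *m D = 0.
  elim: {Ffs rk} fs sg sg' => [|[u v] fs IHfs] /=; first by rewrite mul0mx.
  case/and3P=> ug vg sg /and3P[ug' vg' sg']; apply/eqP.
  rewrite -submx0 (addsmxMr _ _ D) addsmx_sub IHfs // submx_refl /=.
  by rewrite (addsmxMr _ _ D) addsmx_sub !line // !sub0mx.
have [full | notfull] := boolP (row_full (span_frame fs)).
  by apply/eqP; apply: (row_full_inj full); rewrite SD mulmx0.
have rkn : \rank (span_frame fs) = n.
  apply/eqP; rewrite eqn_leq rk andbT -ltnS ltn_neqAle rank_leq_row andbT.
  exact: notfull.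
have [|y Sy nyS] := @ex_Perp _ _ (span_frame fs) (0 : 'rV[K]_n.+1).
  by rewrite rkn mxrank0 addn0.
have nz_y : y != 0 by apply: contraNneq nyS => ->; apply: sub0mx.
have ndS := frame_anisotropic Ffs.
have {}nyS : ~~ (y <= span_frame fs)%MS by apply: contra nz_y => /ndS->.
have full : row_full (span_frame fs + y)%MS.
  rewrite /row_full eqn_leq rank_leq_col -{1}rkn ltnNge; apply: contra nyS => le.
  have sS := addsmxSl (span_frame fs) y.
  have sS' : (span_frame fs + y <= span_frame fs)%MS.
    by rewrite -(mxrank_leqif_sup sS).2 eqn_leq mxrankS.
  by apply: submx_trans sS'; apply: addsmxSr.
have ystab g0 : g0 \in GU -> stabilizes_lines fs g0 -> (y *m GLval g0 <= y)%MS.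
  move=> Gg0 sg0; have : (y *m GLval g0 <= span_frame fs + y)%MS by apply: submx_full.
  case/sub_adds_rV=> z zS [a ey]; rewrite ey (ndS z) ?add0r ?scalemx_sub //.
  have -> : z = y *m GLval g0 + - a *: y by rewrite ey scaleNr addrK.
  by apply: PerpD => //; apply: stabilizes_perp.
apply/eqP; apply: (row_full_inj full); rewrite mulmx0; apply/eqP; rewrite -submx0.
by rewrite (addsmxMr _ _ D) SD (line y) ?ystab // addsmx_sub !sub0mx.
Qed.

Lemma GU_der_sub_sgl : (GU^`(1) \subset sgl_group)%g.
Proof.
have [fs Ffs rk] := frame_exists.
pose T := [pred g : gT | (g \in GU) && stabilizes_lines fs g].
have sRG := subsetP (normal_sub sgl_group_normal).
apply: (der1_sub_factor sgl_group_normal (T := T)) => [x y | g Gg].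
  by case/andP=> Gx sx /andP[Gy sy]; apply: stabilizers_commute Ffs rk Gx Gy sx sy.
have [x Rx sx] := frame_stabilize Ffs Gg; exists (g * x)%g.
  by rewrite inE sx groupM ?(sRG x).
by exists x^-1%g; rewrite ?groupV ?mulgK.
Qed.

(** * Perfectness and normal subgroups *)

Lemma T_commutator w a : w != 0 -> h w w = 0 -> sym a ->
  exists b t c t', [/\ sok w b t, sok w c t' & sgl w 0 a = [~ sgl w b t, sgl w c t']%g].
Proof.
move=> nz_w ww sa; have [|b /PerpE bw nb] := @ex_Perp _ _ w w.
  rewrite (leq_ltn_trans (leq_add (rank_leq_row _) (rank_leq_row _))) //.
  by rewrite ltnS (leq_trans _ n_ge3).
have ok := sok_half ww bw; have [c [t' [okc E]]] := T_comm nz_w sa ok nb.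
by exists b, (h b b / 2%:R), c, t'; rewrite (E _ ok).
Qed.

Lemma sgl_T0 a : sgl 0 0 a = 1%g.
Proof.
suff E : smx 0 0 a = 1%:M by apply: GL_inj; rewrite toGLK E // unitmx1.
by apply: mx_act_inj => v; rewrite smxE !scaler0 !addr0 mulmx1.
Qed.

(** The group [A] is arbitrary so that the lemma applies to the unitary group and then again to its
    derived subgroup. *)
Lemma sgl_in_der (A : {group gT}) w b t : (forall w b t, sok w b t -> sgl w b t \in A) ->
  sok w b t -> sgl w b t \in (A^`(1))%g.
Proof.
move=> sA; apply: sgl_all => // [w1 b1 t1 /sA | z zz a sa].
  by apply: (subsetP (normal_norm (der_normal 1 A))).
have [-> | nz_z] := eqVneq z 0; first by rewrite sgl_T0 group1.
have [b1 [t1 [c [t' [okb okc ->]]]]] := T_commutator nz_z zz sa.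
by rewrite mem_commg ?sA.
Qed.

Lemma sgl_in_GU_der w b t : sok w b t -> sgl w b t \in (GU^`(1))%g.
Proof. by apply: (@sgl_in_der GU_group) => w1 b1 t1 /sgl_GU. Qed.

Theorem GU_der_perfect : (GU^`(1) \subset [~: GU^`(1), GU^`(1)])%g.
Proof.
apply: subset_trans GU_der_sub_sgl _; apply: (@sgl_group_sub ((GU^`(1))^`(1))%G).
by move=> w b t; apply: (@sgl_in_der (GU^`(1))%G) => w1 b1 t1 /sgl_in_GU_der.
Qed.

(** On the complement of [u], the commutator [y] acts as the transvection along [u']. Its commutator
    with a Siegel transvection for (w, b) is one for [w] and a multiple of [u'], and one more
    commutator gives all transvections along [w]. *)
Theorem GU_normal_dichotomy (N : {group gT}) : N \subset GU -> (GU^`(1) \subset 'N(N))%g ->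
  N \subset scalar_GL K n \/ (GU^`(1) \subset N)%g.
Proof.
move=> sNG nNS; have nN w b t : sok w b t -> sgl w b t \in 'N(N)%g.
  by move/sgl_in_GU_der; apply: (subsetP nNS).
have [sNZ | /subsetPn[x Nx nsx]] := boolP (N \subset scalar_GL K n); [by left | right].
have [u uu nux] : exists2 u, h u u = 0 & ~~ (u *m GLval x <= u)%MS.
  have /existsP[u /andP[/eqP uu nux]] : [exists u : 'rV_n.+1, (h u u == 0) && ~~ (u *m GLval x <= u)%MS].
    apply: contraNT nsx => /existsPn ux; apply: isotropic_lines_scalar => u uu.
    by have := ux u; rewrite uu eqxx negbK.
  by exists u.
have nz_u : u != 0 by apply: contraNneq nux => ->; rewrite mul0mx sub0mx.
have Gx : x \in GU by apply: (subsetP sNG).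
pose u' := u *m GLval x; have u'u' : h u' u' = 0 by rewrite GU_h.
have s1 : sym 1 by rewrite /sym rmorph1.
have [ok ok'] := (sok_T uu s1, sok_T u'u' s1).
pose y := [~ sgl u 0 1%R, x]%g.
have yE : y = (sgl u 0 (- 1) * sgl u' 0 1%R)%g.
  by rewrite /y commgEl sglV // sglJ // mul0mx oppr0 rmorph1.
have okN : sok u 0 (- 1) by apply: sok_T => //; rewrite /sym rmorphN rmorph1.
have Ny : y \in N.
  by apply: commg_norm_mem => //; apply: nN.
have Gy : y \in GU by apply: (subsetP sNG).
(* If [u] and [u'] are orthogonal, take [w = u] and [b] orthogonal to [u] but not to [u']; otherwise
   [w] is orthogonal to both and [b = u]. *)
have [w [b [nz_w ww [wu wu'] [bw bu bu']]]] : exists w b,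
    [/\ w != 0, h w w = 0, h w u = 0 /\ h w u' = 0 &
      [/\ h b w = 0, h b u = 0 & h b u' != 0 /\ ~~ (u' <= w)%MS]].
  have [uu'0 | nuu'] := eqVneq (h u u') 0.
    have [b /PerpE bu bu'] := dual_perp nux.
    by exists u, b; rewrite bu' oner_neq0.
  have [|w [nz_w ww Sw]] := @iso_exists _ (u + u')%MS.
    rewrite addn2 ltnS (leq_trans _ n_ge3) // ltnS (leq_trans (rank_adds_rV _ _)) //.
    by rewrite ltnS rank_leq_row.
  have wu := PerpE (Perp_addsl Sw); have wu' := PerpE (Perp_addsr Sw).
  exists w, u; split=> //; split; rewrite ?(hC0 wu) //; split=> //.
  apply/negP=> /sub_rV_scale[a ea]; case/eqP: nuu'.
  by rewrite ea hE (hC0 wu) mulr0.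
have [{}bu' nu'w] := bu'.
have act z : h z u = 0 -> z *m GLval y = z + h z u' *: u'.
  move=> zu; have z1 : z *m GLval (sgl u 0 (- 1)) = z.
    by rewrite sglE // zu h0r mulr0 addr0 !scale0r !addr0.
  by rewrite yE GLM mulmxA z1 sglE // h0r scaler0 addr0 mul1r add0r.
have wy : w *m GLval y = w by rewrite act // wu' scale0r addr0.
have okb := sok_half ww bw.
have [t okt E] := sglRfix okb Gy wy.
rewrite act // addrC addKr in okt E.
have Nt : sgl w (h b u' *: u') t \in N.
  by rewrite -E; apply: commg_norm_mem => //; apply: nN.
have Tw : allT N w.
  move=> a sa; apply: T_of_sgl Nt sa => //.
  apply: contra nu'w => /(scalemx_sub (h b u')^-1).
  by rewrite scalerA mulVf // scale1r.
apply: subset_trans GU_der_sub_sgl _; apply: sgl_group_sub => w1 b1 t1 ok1.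
apply: sgl_all => // z zz; have [-> | nz_z] := eqVneq z 0.
  by move=> a _; rewrite sgl_T0 group1.
exact: allT_all nz_w nz_z ww zz Tw.
Qed.

End Form.

(** * Conjugation by a reflection *)

Section PolyAction.
Variables (K : fieldType) (V : lmodType K) (c : {linear V -> V}).

(** The value p(c) applied to [v]; [c] will be conjugation by [tau] on the space of matrices. *)
Definition pact (p : {poly K}) (v : V) : V := \sum_(i < size p) p`_i *: iter i c v.

Lemma pactE n (p : {poly K}) v : (size p <= n)%N ->
  pact p v = \sum_(i < n) p`_i *: iter i c v.
Proof.
move=> le; rewrite /pact (big_ord_widen n (fun i => p`_i *: iter i c v)) //.
rewrite big_mkcond; apply: eq_bigr => i _; case: ltnP => // le_i.
by rewrite nth_default ?scale0r.
Qed.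

Lemma pactD p q v : pact (p + q) v = pact p v + pact q v.
Proof.
rewrite !(@pactE (maxn (size p) (size q))) ?leq_maxl ?leq_maxr ?size_polyD //.
by rewrite -big_split; apply: eq_bigr => i _; rewrite coefD scalerDl.
Qed.

Lemma pactZl a p v : pact (a *: p) v = a *: pact p v.
Proof.
rewrite !(@pactE (size p)) ?size_scale_leq // scaler_sumr.
by apply: eq_bigr => i _; rewrite coefZ scalerA.
Qed.

Lemma pactDr p v w : pact p (v + w) = pact p v + pact p w.
Proof.
rewrite -big_split /=; apply: eq_bigr => i _; rewrite -scalerDr; congr (_ *: _).
by elim: (i : nat) => //= k ->; rewrite linearD.
Qed.

Lemma pactZr p a v : pact p (a *: v) = a *: pact p v.
Proof.
rewrite scaler_sumr; apply: eq_bigr => i _; rewrite scalerA mulrC -scalerA.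
by congr (_ *: _); elim: (i : nat) => //= k ->; rewrite linearZ.
Qed.

Lemma pact0l v : pact 0 v = 0.
Proof. by rewrite /pact size_poly0 big_ord0. Qed.

Lemma pact0r p : pact p 0 = 0.
Proof. by rewrite -[X in pact p X](scale0r (0 : V)) pactZr scale0r. Qed.

Lemma pact1 v : pact 1 v = v.
Proof. by rewrite /pact size_poly1 big_ord1 coef1 scale1r. Qed.

Lemma pactMX p v : pact (p * 'X) v = pact p (c v).
Proof.
rewrite (@pactE (size p).+1); last first.
  by rewrite (leq_trans (size_polyMleq _ _)) // size_polyX addn2.
rewrite big_ord_recl coefMX /= scale0r add0r; apply: eq_bigr => i _.
by rewrite coefMX /= -iterS -iterSr.
Qed.

Lemma pactM p q v : pact (p * q) v = pact p (pact q v).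
Proof.
elim/poly_ind: q v => [|q b IHq] v.
  by rewrite mulr0 !pact0l pact0r.
rewrite mulrDr mulrA !pactD pactMX IHq pactDr pactMX; congr (_ + _).
by rewrite [p * _]mulrC mul_polyC pactZl -[b%:P]alg_polyC pactZl pact1 pactZr.
Qed.

Lemma pact_eigen p k v : c v = k *: v -> pact p v = p.[k] *: v.
Proof.
move=> cv; rewrite horner_coef scaler_suml; apply: eq_bigr => i _.
rewrite -scalerA; congr (_ *: _); elim: (i : nat) => [|j IHj]; first by rewrite scale1r.
by rewrite iterS IHj linearZ /= cv scalerA exprSr.
Qed.

End PolyAction.

Section Word.
Variables (l : nat).

(* The value at q of the polynomial m in the conjugation action of t, written
   multiplicatively. *)
Definition cpow (gT : finGroupType) (m : {poly 'F_l}) (q t : gT) : gT :=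
  (\prod_(i < size m) (q ^ (t ^+ i)) ^+ (m`_i)%R)%g.

Lemma morph_cpow (aT rT : finGroupType) (D : {group aT}) (f : {morphism D >-> rT}) m q t :
  q \in D -> t \in D -> f (cpow m q t) = cpow m (f q) (f t).
Proof.
move=> Dq Dt; rewrite morph_prod => [|i _]; last by rewrite groupX ?groupJ ?groupX.
by apply: eq_bigr => i _; rewrite morphX ?morphJ ?morphX ?groupJ ?groupX.
Qed.

Lemma cpow_mem (gT : finGroupType) (P : {group gT}) m q t :
  q \in P -> t \in 'N(P)%g -> cpow m q t \in P.
Proof.
by move=> Pq Nt; apply: group_prod => i _; rewrite groupX // memJ_norm // groupX.
Qed.

End Word.

Section ReflectionWord.
Variables (l : nat) (K : finFieldType) (iota : {rmorphism 'F_l -> K}) (n : nat).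
Hypothesis l_char : l \in [pchar K].
Local Notation gT := (GLfin K n).
Variables (P : {group gT}) (tau : gT).

Definition conj_by (X : 'M[K]_n.+1) : 'M[K]_n.+1 := GLval tau^-1%g *m X *m GLval tau.
Fact conj_by_linear : linear conj_by.
Proof. by move=> a X Y; rewrite /conj_by mulmxDr mulmxDl -scalemxAr -scalemxAl. Qed.
HB.instance Definition _ :=
  GRing.isLinear.Build K 'M[K]_n.+1 'M[K]_n.+1 _ conj_by conj_by_linear.

Lemma iter_conj_by i X :
  iter i conj_by X = GLval (tau ^+ i)^-1%g *m X *m GLval (tau ^+ i)%g.
Proof.
elim: i => [|i IHi]; first by rewrite expg0 invg1 !GL1 mul1mx mulmx1.
by rewrite iterS IHi /conj_by expgSr invMg !GLM !mulmxA.
Qed.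

Lemma iotaE (x : 'F_l) : iota x = (x : nat)%:R.
Proof. by rewrite -{1}[x]natr_Zp rmorph_nat. Qed.

Hypotheses (pP : (l.-group P)%g) (nP : tau \in 'N(P)%g).
Variables (lam : K) (e : 'M[K]_n.+1).
Hypotheses (ee : e *m e = e) (nz_lam : lam != 0).
Hypothesis tauE : GLval tau = 1%:M + (lam - 1) *: e.

Lemma tauVE : GLval tau^-1%g = 1%:M + (lam^-1 - 1) *: e.
Proof.
have E (a b : K) : (1%:M + a *: e) *m (1%:M + b *: e) = 1%:M + (a + b + a * b) *: e.
  rewrite mulmxDl mul1mx mulmxDr mulmx1 -scalemxAl -scalemxAr ee scalerA !scalerDl.
  by apply/matrixP=> i j; rewrite !mxE; ring.
apply: (row_free_inj (A := GLval tau)).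
  by rewrite row_free_unit; apply: (GL_unit tau).
rewrite GL_mulVmx tauE E (_ : lam^-1 - 1 + (lam - 1) + _ = 0) ?scale0r ?addr0 //.
by field.
Qed.

(** The idempotent [e] splits [X] into four Peirce corners, on which conjugation by [tau] acts as 1,
    1, [lam] and [lam^-1]. *)
Lemma pact_conj_root (f : {poly K}) X : root f 1 -> root f lam -> root f lam^-1 ->
  pact conj_by f X = 0.
Proof.
move=> /eqP f1 /eqP fl /eqP fl'; pose e' := 1%:M - e.
have ee' : e *m e' = 0 by rewrite mulmxBr mulmx1 ee subrr.
have e'e : e' *m e = 0 by rewrite mulmxBl mul1mx ee subrr.
have X4 : X = e' *m X *m e' + e *m X *m e + (e' *m X *m e + e *m X *m e').
  have I1 : 1%:M = e + e' by rewrite addrC subrK.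
  rewrite -[LHS]mul1mx -[LHS]mulmx1 I1 mulmxDr !mulmxDl.
  by rewrite [X in _ = X + _]addrC [RHS]addrACA; congr (_ + _); rewrite addrC.
have et : e *m GLval tau = lam *: e.
  rewrite tauE mulmxDr mulmx1 -scalemxAr ee -[X in X + _]scale1r -scalerDl.
  by rewrite addrC subrK.
have te : GLval tau^-1%g *m e = lam^-1 *: e.
  rewrite tauVE mulmxDl mul1mx -scalemxAl ee -[X in X + _]scale1r -scalerDl.
  by rewrite addrC subrK.
have e't : e' *m GLval tau = e' by rewrite tauE mulmxDr mulmx1 -scalemxAr e'e scaler0 addr0.
have te' : GLval tau^-1%g *m e' = e' by rewrite tauVE mulmxDl mul1mx -scalemxAl ee' scaler0 addr0.
rewrite X4 !pactDr.
rewrite (@pact_eigen _ _ _ f 1 (e' *m X *m e')); last first.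
  by rewrite /= /conj_by !mulmxA te' -!mulmxA e't scale1r.
rewrite (@pact_eigen _ _ _ f 1 (e *m X *m e)); last first.
  by rewrite /= /conj_by !mulmxA te -!mulmxA et -scalemxAl -!scalemxAr scalerA mulVf.
rewrite (@pact_eigen _ _ _ f lam (e' *m X *m e)); last first.
  by rewrite /= /conj_by !mulmxA te' -!mulmxA et -!scalemxAr.
rewrite (@pact_eigen _ _ _ f lam^-1 (e *m X *m e')); last first.
  by rewrite /= /conj_by !mulmxA te -!mulmxA e't -!scalemxAl.
by rewrite f1 fl fl' !scale0r !addr0.
Qed.

Variable m : {poly 'F_l}.
Local Notation mK := (map_poly iota m).
Hypotheses (m1 : ~~ root mK 1) (mlam : ~~ root mK lam) (mlamV : ~~ root mK lam^-1).
Hypothesis word_der : forall y, y \in P -> cpow m y tau \in (P^`(1))%g.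

Lemma coprime_to_conj : exists f : {poly K},
  [/\ coprimep mK f, root f 1, root f lam & root f lam^-1].
Proof.
exists (('X - 1%:P) * ('X - lam%:P) * ('X - (lam^-1)%:P)).
by rewrite !coprimepMr !coprimep_XsubC m1 mlam mlamV !rootM !root_XsubC !eqxx !orbT.
Qed.

Lemma GL_repr : mx_repr P (fun x : gT => GLval x).
Proof. by split=> [|x y _ _]; rewrite ?GL1 ?GLM. Qed.
Let rG := MxRepresentation GL_repr.
Let Y1 := rfix_mx rG P.

Lemma fix1P k (v : 'M[K]_(k, n.+1)) :
  reflect (forall y, y \in P -> v *m GLval y = v) (v <= Y1)%MS.
Proof. exact: rfix_mxP. Qed.

(** Vectors fixed by [P] modulo [Y1]. On such [v], the map y |-> v (y - 1) is a homomorphism from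
    [P] to an additive group: it kills the derived subgroup and makes the word [cpow m y tau]
    linear. *)
Let Y2 (v : 'rV[K]_n.+1) := forall y, y \in P -> (v *m (GLval y - 1%:M) <= Y1)%MS.

Lemma Y1_norm t k (v : 'M[K]_(k, n.+1)) : t \in 'N(P)%g -> (v <= Y1)%MS ->
  (v *m GLval t <= Y1)%MS.
Proof.
move=> Nt /fix1P vP; apply/fix1P=> y Py; rewrite -mulmxA -GLM conjgCV GLM mulmxA.
by rewrite vP // memJ_norm // groupV.
Qed.

Lemma Y2_norm t v : t \in 'N(P)%g -> Y2 v -> Y2 (v *m GLval t).
Proof.
move=> Nt vP y Py; have -> : v *m GLval t *m (GLval y - 1%:M) =
    v *m (GLval (y ^ t^-1)%g - 1%:M) *m GLval t.
  have E : GLval t *m GLval y = GLval (y ^ t^-1)%g *m GLval t.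
    by rewrite -!GLM -conjgCV.
  by rewrite !mulmxBr mulmxBl !mulmx1 -(mulmxA v) E mulmxA.
by rewrite Y1_norm // vP // memJ_norm // groupV.
Qed.

Lemma Y2M v y z : Y2 v -> y \in P -> z \in P ->
  v *m (GLval (y * z)%g - 1%:M) = v *m (GLval y - 1%:M) + v *m (GLval z - 1%:M).
Proof.
move=> vP Py Pz; have /fix1P/(_ z Pz) := vP y Py.
by rewrite GLM !mulmxBr !mulmxBl !mulmx1 mulmxA => /eqP; rewrite subr_eq => /eqP ->; rewrite -addrA.
Qed.

Lemma Y2X v y k : Y2 v -> y \in P ->
  v *m (GLval (y ^+ k)%g - 1%:M) = k%:R *: (v *m (GLval y - 1%:M)).
Proof.
move=> vP Py; elim: k => [|k IHk]; first by rewrite expg0 GL1 subrr mulmx0 scale0r.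
by rewrite expgS Y2M ?groupX // IHk -natr1 scalerDl scale1r addrC.
Qed.

Lemma Y2_prod v k (F : 'I_k -> gT) : Y2 v -> (forall i, F i \in P) ->
  v *m (GLval (\prod_(i < k) F i)%g - 1%:M) = \sum_(i < k) v *m (GLval (F i) - 1%:M).
Proof.
move=> vP PF; suff [] : (\prod_(i < k) F i)%g \in P /\
  v *m (GLval (\prod_(i < k) F i)%g - 1%:M) = \sum_(i < k) v *m (GLval (F i) - 1%:M) by [].
elim/big_rec2: _ => [|i x y _ [Py E]]; first by rewrite group1 GL1 subrr mulmx0.
by rewrite groupM // Y2M // E.
Qed.

Lemma Y2_der v y : Y2 v -> y \in (P^`(1))%g -> v *m (GLval y - 1%:M) = 0.
Proof.
move=> vP; pose D := [set y in P | v *m (GLval y - 1%:M) == 0].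
have gD : group_set D.
  apply/group_setP; split; first by rewrite inE group1 GL1 subrr mulmx0 eqxx.
  move=> x z; rewrite !inE => /andP[Px /eqP vx] /andP[Pz /eqP vz].
  by rewrite groupM // Y2M // vx vz addr0 eqxx.
suff : (P^`(1) \subset Group gD)%g by move/subsetP/[apply]; rewrite inE => /andP[_ /eqP].
rewrite gen_subG; apply/subsetP=> _ /imset2P[x z Px Pz ->]; rewrite inE groupR //=.
apply/eqP; have := Y2M vP (groupM Pz Px) (groupR Px Pz).
rewrite -commgC (Y2M vP Px Pz) (Y2M vP Pz Px) addrC => /eqP.
by rewrite -subr_eq0 opprD addrA subrr add0r oppr_eq0 => /eqP.
Qed.

Lemma Y2_word v y : Y2 v -> y \in P -> v *m pact conj_by mK (GLval y - 1%:M) = 0.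
Proof.
move=> vP Py; rewrite -(Y2_der vP (word_der Py)) Y2_prod //; last first.
  by move=> i; rewrite groupX // memJ_norm // groupX.
rewrite (@pactE _ _ _ (size m)) ?size_poly // mulmx_sumr; apply: eq_bigr => i _.
have Pyi : (y ^ (tau ^+ i))%g \in P by rewrite memJ_norm // groupX.
rewrite Y2X // -scalemxAr coef_map /= iotaE iter_conj_by.
rewrite (_ : _ *m _ *m _ = GLval (y ^ (tau ^+ i))%g - 1%:M) //.
by rewrite mulmxBr mulmx1 mulmxBl GL_mulVmx conjgE !GLM mulmxA.
Qed.

(** As [f] annihilates conjugation, Bezout recovers y - 1 from [pact conj_by mK (y - 1)] by a
    polynomial in conjugation. Conjugating by a power of [tau] only multiplies [v] by the inverse of
    that power, which stays in [Y2]. *)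
Lemma Y2_sub v : Y2 v -> (v <= Y1)%MS.
Proof.
move=> vP; apply/fix1P=> y Py; apply/eqP; rewrite -subr_eq0 -{2}[v]mulmx1 -mulmxBr.
have [f [/Bezout_eq1_coprimepP[[a b] /= E] f1 fl flV]] := coprime_to_conj.
rewrite -(pact1 conj_by (GLval y - 1%:M)) -E pactD !pactM.
rewrite (@pact_conj_root f) //.
rewrite pact0r addr0 /pact.
rewrite mulmx_sumr big1 // => i _; rewrite -scalemxAr iter_conj_by !mulmxA Y2_word //.
  by rewrite mul0mx scaler0.
by apply: Y2_norm vP; rewrite groupV groupX.
Qed.

(* Vectors fixed modulo Y1 are fixed: the word condition makes m kill y - 1 on
   them, and m is invertible on conjugation by tau.  Hence the fixed space Y1 of
   the l-group P cannot be proper. *)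
Theorem word_trivial : P :=: 1%g.
Proof.
have [full | notfull] := boolP (row_full Y1).
  apply/trivgP/subsetP=> y Py; rewrite inE; apply/eqP/GL_inj; rewrite GL1.
  have /fix1P/(_ y Py) := submx_full (1%:M : 'M_n.+1) full.
  by rewrite mul1mx.
have modY : mxmodule rG Y1 := rfix_mx_module rG.
have dim_gt0 : (0 < \rank (cokermx Y1))%N.
  rewrite mxrank_coker subn_gt0 ltn_neqAle rank_leq_col andbT.
  exact: notfull.
(* An l-group in characteristic l fixes a nonzero vector of the nonzero quotient by [Y1]; a lift of
   that vector lies in [Y2]. *)
have /rowV0Pn[w /rfix_mxP wfix nz_w] :=
  rfix_pgroup_pchar l_char (factmod_repr modY) dim_gt0 pP (subxx P).
case/eqP: nz_w; rewrite -[w]val_factmodK; apply/eqP; rewrite in_factmod_eq0.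
apply: Y2_sub => y Py; rewrite -in_factmod_eq0 mulmxBr mulmx1 linearB /=.
have := @in_factmodJ _ _ _ _ rG _ modY _ (val_factmod w) y Py => /= ->.
by rewrite val_factmodK [X in X - _](wfix y Py) subrr.
Qed.

End ReflectionWord.

(** * Root subgroups *)

(* Q plays the role of a root subgroup on which tau acts through roots of m. *)
Definition root_subgroup l (gT : finGroupType) (tau : gT) (m : {poly 'F_l}) (Q : {group gT}) :=
  [/\ (l.-group Q)%g, tau \in 'N(Q)%g, exists2 q, q \in Q & [~ q, tau]%g != 1%g
    & forall q, q \in Q -> cpow m q tau \in (Q^`(1))%g].

(** * Transfer of a root subgroup from one factor to another *)

Section Pair.
Local Open Scope group_scope.
Variables (I : finType) (gT : finGroupType) (rT : I -> finGroupType).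
Variables (C H : {group gT}) (rho : forall j, {morphism C >-> rT j}).
Variable Z : forall j, {group rT j}.
Variables (l : nat) (l_prime : prime l).
Hypothesis sHC : H \subset C.
Hypothesis sZC : forall j, Z j \subset 'C(rho j @* C).
Hypothesis Zl' : forall j, l^'.-group (Z j).
Variables (j k : I) (tau : gT) (m : {poly 'F_l}).
Hypothesis Htau : tau \in H.
Hypotheses (jkZ : partial_image H rho j k \subset Z j)
  (kjZ : partial_image H rho k j \subset Z k).
Variable Q : {group rT j}.
Hypotheses (sQH : Q \subset rho j @* H) (rootQ : root_subgroup (rho j tau) m Q).

(** [B] is the preimage of [Q] in [H], [kap] the kernel of [rho j] on it, and [Bk], [kk] are their
    images at [k]. So [Q] maps onto [Bk / kk], and [kk] lies in the central subgroup [Z k]. *)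
Let B : {group gT} := (H :&: rho j @*^-1 Q)%G.
Let kap : {group gT} := partial_kernel_group rho sHC [:: j].
Let Bk : {group rT k} := (rho k @* B)%G.
Let kk : {group rT k} := (rho k @* kap)%G.

Let sBC : B \subset C. Proof. exact: subset_trans (subsetIl _ _) sHC. Qed.
Let kapE x : (x \in kap) = (x \in H) && (rho j x == 1).
Proof. by rewrite inE /= andbT. Qed.
Let sKB : kap \subset B.
Proof.
apply/subsetP=> x; rewrite kapE => /andP[Hx /eqP rx].
by rewrite inE Hx /= mem_morphpre ?(subsetP sHC) // rx group1.
Qed.
Let rB : rho j @* B = Q.
Proof.
apply/eqP; rewrite eqEsubset; apply/andP; split.
  by apply/subsetP=> _ /morphimP[x _ /setIP[_ /morphpreP[_ Qx]] ->].
apply/subsetP=> q Qq; have /morphimP[x Cx Hx eq] := subsetP sQH q Qq.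
by rewrite eq mem_morphim // inE Hx mem_morphpre // -eq.
Qed.
Let kkZ : kk \subset Z k. Proof. exact: kjZ. Qed.
Let sBkC : Bk \subset rho k @* C. Proof. exact: morphimS. Qed.
Let kk_cent : kk \subset 'C(Bk).
Proof. exact: subset_trans kkZ (subset_trans (sZC k) (centS sBkC)). Qed.
Let sKkBk : kk \subset Bk. Proof. exact: morphimS. Qed.

Let index_Bk : l.-nat #|Bk : kk|.
Proof.
have [pQ _ _ _] := rootQ; apply: pnat_dvd (pQ : l.-nat #|Q|).
apply: dvdn_trans (index_morphim (rho k) _) _; first by rewrite subIset // sBC.
rewrite -rB card_morphim (setIidPr sBC) -(indexgI B ('ker _)) (_ : B :&: 'ker _ = kap) //.
apply/setP=> x; rewrite kapE; apply/setIP/andP=> [[/setIP[Hx _] /kerP rx]|[Hx /eqP rx]].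
  by rewrite Hx rx ?(subsetP sHC).
have Cx := subsetP sHC x Hx; split; last by apply/kerP.
by apply: (subsetP sKB); rewrite kapE Hx rx /=.
Qed.

(** [Bk] is a central extension of an l-group. It is therefore the product of its l-core [P] and an
    l'-group [R], which lies in [kk] and so does not affect commutators. *)
Let nil_Bk : nilpotent Bk.
Proof.
rewrite -quotient_center_nil; apply: (@pgroup_nil _ l).
rewrite /pgroup card_quotient ?gFnorm //.
apply: pnat_dvd index_Bk; apply: indexgS.
by rewrite subsetI sKkBk kk_cent.
Qed.

Let P : {group rT k} := 'O_l(Bk)%G.
Let R : {group rT k} := 'O_l^'(Bk)%G.
Let decB : P \x R = Bk. Proof. exact: nilpotent_pcoreC nil_Bk. Qed.

Let sRk : R \subset kk.
Proof.
have nkR : R \subset 'N(kk).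
  by rewrite (subset_trans (pcore_sub _ _)) // cents_norm // centsC.
have p1 : l.-nat #|R / kk|.
  apply: pnat_dvd (cardSg (quotientS kk (pcore_sub l^' Bk))) _.
  by rewrite card_quotient // cents_norm // centsC.
have p2 : l^'.-nat #|R / kk| by apply: quotient_pgroup; apply: pcore_pgroup.
rewrite -quotient_sub1 //; apply/trivgP/card1_trivg; exact: pnat_1 p1 p2.
Qed.

Let der_Bk : Bk^`(1) = P^`(1).
Proof.
have := der_dprod 1 decB; rewrite (_ : R^`(1) = 1) ?dprodg1 //.
apply/derG1P; apply: subset_trans sRk _; apply: subset_trans kk_cent _.
by apply: centS; rewrite (subset_trans sRk).
Qed.

Let tauB : tau \in 'N(B).
Proof.
have [_ nQ _ _] := rootQ; have Ct := subsetP sHC tau Htau.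
rewrite inE; apply/subsetP=> _ /imsetP[x /setIP[Hx /morphpreP[Cx Qx]] ->].
by rewrite inE groupJ // mem_morphpre ?groupJ // morphJ // memJ_norm.
Qed.

(** The l-core of [Bk] works. Were it trivial, [Bk] would be central, commutators of [B] with [tau]
    would vanish at [k], and at [j] they would lie in both [Z j] and the l-group [Q], hence be 1.
    The word condition carries over up to [Z k], and exactly because [Z k] meets [P] trivially. *)
Lemma root_subgroup_transfer : exists P : {group rT k},
  [/\ l.-group P, rho k tau \in 'N(P), P :!=: 1
    & forall y, y \in P -> cpow m y (rho k tau) \in P^`(1)].
Proof.
have Ct := subsetP sHC tau Htau; have [pQ nQ [q Qq nq1] wQ] := rootQ.
have nBk : rho k tau \in 'N(Bk).
  by rewrite (subsetP (morphim_norm _ _)) // mem_morphim.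
have nP : rho k tau \in 'N(P) by apply: (subsetP (gFnorms _ _)).
exists P; split=> //; first exact: pcore_pgroup.
  apply: contra nq1 => /eqP P1.
  have BkZ : Bk \subset Z k.
    by apply: subset_trans kkZ; rewrite -decB P1 dprod1g.
  have /morphimP[h Ch Bh eq] : q \in rho j @* B by rewrite rB.
  have Hh : h \in H by case/setIP: Bh.
  have kj : [~ q, rho j tau] \in Z j.
    rewrite eq -morphR //; apply: (subsetP jkZ).
    apply: mem_morphim; first exact: groupR.
    rewrite inE groupR //= andbT morphR //.
    apply/commgP; apply: (centP (subsetP (subset_trans BkZ (sZC k)) _ _)).
      exact: mem_morphim.
    exact: mem_morphim.
  have kQ : [~ q, rho j tau] \in Q by rewrite commg_mem_norm.
  have : [~ q, rho j tau] \in Z j :&: Q by rewrite inE kj.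
  by rewrite coprime_TIg ?inE // coprime_sym (pnat_coprime pQ (Zl' j)).
move=> y Py; have Bky : y \in Bk by apply: (subsetP (pcore_sub _ _) y Py).
have /morphimP[h Ch Bh ey] := Bky; have Hh : h \in H by case/setIP: Bh.
have Qh : rho j h \in Q by rewrite -rB mem_morphim.
have wB : cpow m h tau \in B by rewrite cpow_mem.
have wC : cpow m h tau \in C := subsetP sBC _ wB.
have := wQ _ Qh; rewrite -morph_cpow // -rB -morphim_der //.
case/morphimP=> b Cb B'b ew; have Bb := subsetP (der_sub 1 B) b B'b.
have kw : b^-1 * cpow m h tau \in kap.
  rewrite kapE groupM ?groupV /=; last 2 first.
  - by case/setIP: Bb.
  - by case/setIP: wB.
  by rewrite morphM ?groupV // morphV // -ew mulVg.
have B'k : rho k b \in P^`(1).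
  by rewrite -der_Bk -morphim_der // mem_morphim.
have wP : cpow m y (rho k tau) \in P by rewrite cpow_mem.
have : rho k (b^-1 * cpow m h tau) \in Z k :&: P.
  rewrite inE (subsetP kkZ) /=; last by apply: mem_morphim kw; rewrite groupM ?groupV.
  rewrite morphM ?groupV // morphV // morph_cpow // -ey groupM //.
  by rewrite groupV (subsetP (der_sub 1 P)).
rewrite coprime_TIg; last by rewrite coprime_sym (pnat_coprime (pcore_pgroup l Bk) (Zl' k)).
rewrite inE morphM ?groupV // morphV // morph_cpow // -ey => /eqP/(canRL (mulKVg _)).
by rewrite mulg1 => ->.
Qed.

End Pair.

Lemma pgroup_of_exponent (gT : finGroupType) (G : {group gT}) l k :
  prime l -> {in G, forall x, x ^+ (l ^ k) = 1}%g -> (l.-group G)%g.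
Proof.
move=> l_pr Gk; rewrite -pnat_exponent; apply: (@pnat_dvd _ (l ^ k)).
  by apply/exponentP.
by rewrite pnatX pnat_id.
Qed.

Section RootSubgroups.
Variables (l : nat) (K : finFieldType) (iota : {rmorphism 'F_l -> K}) (n : nat).
Hypothesis l_char : l \in [pchar K].
Hypothesis n_ge3 : (3 <= n)%N.
Local Notation gT := (GLfin K n).
Variables (tau : gT) (lam : K) (a : 'rV[K]_n.+1) (f : 'cV[K]_n.+1).
Hypotheses (lam1 : lam != 1) (nz_lam : lam != 0).
Hypotheses (af : a *m f = (lam - 1)%:M) (tauE : GLval tau = 1%:M + f *m a).
Variable m : {poly 'F_l}.
Hypothesis mlam : root (map_poly iota m) lam.

Let l_prime : prime l := pcharf_prime l_char.

Lemma reflection_vec : a *m GLval tau = lam *: a.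
Proof.
by rewrite tauE mulmxDr mulmx1 mulmxA af mul_scalar_mx scalerBl scale1r addrC subrK.
Qed.

Lemma reflection_vecX i : a *m GLval (tau ^+ i)%g = lam ^+ i *: a.
Proof.
elim: i => [|i IHi]; first by rewrite expg0 GL1 mulmx1 scale1r.
by rewrite expgS GLM mulmxA reflection_vec -scalemxAl IHi scalerA -exprS.
Qed.

Lemma reflection_vec_neq0 : a != 0.
Proof.
apply: contra_neq lam1 => a0; apply/eqP; rewrite -subr_eq0.
by move: af; rewrite a0 mul0mx => /matrixP/(_ 0 0); rewrite !mxE eqxx mulr1n => <-.
Qed.

Lemma mlam_sum : \sum_(i < size m) (m`_i)%R%:R * lam ^+ i = 0 :> K.
Proof.
move/eqP: mlam; rewrite (@horner_coef_wide _ (size m)) ?size_poly // => E; rewrite -[RHS]E.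
by apply: eq_bigr => i _; rewrite coef_map /= (iotaE iota).
Qed.

Lemma trvX (b : 'rV[K]_n.+1) (g : 'cV_n.+1) k : b *m g = 0 -> (trv b g ^+ k)%g = trv (k%:R *: b) g.
Proof.
move=> bg; elim: k => [|k IHk]; first by rewrite scale0r trv0.
by rewrite expgS IHk trvM // -?scalemxAl ?bg ?scaler0 // -natr1 scalerDl scale1r addrC.
Qed.

(** Transvections of direction [x *: a] with a fixed functional [g] form a copy of the additive
    group of [K], on which [tau] acts as multiplication by [lam]; the word of [m] multiplies by
    m(lam) = 0. *)
Theorem GL_root_subgroup : exists Q : {group gT},
  Q \subset ([set: gT]^`(1))%g /\ root_subgroup tau m Q.
Proof.
have [|g' ag nz_g] := @ex_perp _ _ _ _ a^T (0 : 'rV[K]_n.+1).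
  by rewrite mxrank0 (leq_ltn_trans (rank_leq_col _)) // ltnS (leq_trans _ n_ge3).
pose g := g'^T; have {}ag : a *m g = 0 by rewrite -[a]trmxK -trmx_mul ag trmx0.
have {}nz_g : g != 0.
  by rewrite trmx_eq0; apply: contraNneq nz_g => ->; apply: sub0mx.
have tg : GLval tau^-1%g *m g = g.
  have E : GLval tau *m g = g by rewrite tauE mulmxDl mul1mx -mulmxA ag mulmx0 addr0.
  by rewrite -{1}E mulmxA GL_mulVmx mul1mx.
have tgX i : GLval (tau ^+ i)^-1%g *m g = g.
  by elim: i => [|i IHi]; rewrite ?expg0 ?invg1 ?GL1 ?mul1mx // expgSr invMg GLM -mulmxA IHi tg.
have xag x : (x *: a) *m g = 0 by rewrite -scalemxAl ag scaler0.
pose q x := trv (x *: a) g.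
have qM x y : (q x * q y)%g = q (x + y) by rewrite /q trvM // scalerDl.
have qX x k : (q x ^+ k)%g = q (k%:R * x) by rewrite /q trvX // scalerA.
have qJ x i : (q x ^ (tau ^+ i))%g = q (x * lam ^+ i).
  by rewrite /q trvJ // -scalemxAl reflection_vecX tgX scalerA.
have gQ : group_set [set q x | x : K].
  apply/group_setP; split; first by apply/imsetP; exists 0; rewrite // /q scale0r trv0.
  by move=> _ _ /imsetP[x _ ->] /imsetP[y _ ->]; rewrite qM; apply: imset_f.
exists (Group gQ); split.
  by apply/subsetP=> _ /imsetP[x _ ->]; apply: trv_in_der.
split.
- apply: (@pgroup_of_exponent _ _ _ 1) => // _ /imsetP[x _ ->].
  by rewrite expn1 qX (pcharf0 l_char) mul0r /q scale0r trv0.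
- rewrite inE; apply/subsetP=> _ /imsetP[_ /imsetP[x _ ->] ->].
  by rewrite -[tau]expg1 qJ; apply: imset_f.
- exists (q 1); first exact: imset_f.
  rewrite commgEl /q trvV // -scaleNr -/(q _) -[tau]expg1 qJ qM.
  apply: contraNneq lam1 => q1; have := congr1 (@GLval _ _) q1; rewrite trvE // GL1.
  move/(canRL (addKr _)); rewrite addNr => /eqP.
  rewrite -scalemxAr scaler_eq0 addrC mul1r expr1 subr_eq0 => /orP[//|/eqP ga0].
  have /rV0Pn[j nz_aj] := reflection_vec_neq0; have /cV0Pn[i nz_gi] := nz_g.
  move/matrixP: ga0 => /(_ i j); rewrite !mxE big_ord1 => /eqP.
  by rewrite mulf_eq0 (negPf nz_aj) (negPf nz_gi).
move=> _ /imsetP[x _ ->].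
suff -> : cpow m (q x) tau = 1%g by apply: group1.
have -> : cpow m (q x) tau = q (\sum_(i < size m) (m`_i)%R%:R * (x * lam ^+ i)).
  rewrite /cpow; elim/big_rec2: _ => [|i y z _ ->]; first by rewrite /q scale0r trv0.
  by rewrite qJ qX qM.
under eq_bigr => i _ do rewrite mulrCA.
by rewrite -mulr_sumr mlam_sum mulr0 /q scale0r trv0.
Qed.

(** * Root subgroups of unitary groups *)

Section Unitary.
Variables (s : {rmorphism K -> K}) (M : 'M[K]_n.+1).
Hypotheses (sK : involutive s) (two : 2%:R != 0 :> K).
Variable e : K.
Hypotheses (e_skew : s e = - e) (nz_e : e != 0).
Hypotheses (M_skew : (map_mx s M)^T = - M) (M_unit : M \in unitmx).
Hypothesis tauU : tau \in GU s M.
Local Notation h := (hform s M).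
Local Notation sok := (sok s M).
Local Notation sgl := (sgl s M).
Let hE := hE s M.

(** Applying [tau] preserves [h v a] but also multiplies it by [s lam], which is not 1. *)
Lemma fix_perp v : v *m f = 0 -> h v a = 0.
Proof.
move=> vf; have vt : v *m GLval tau = v by rewrite tauE mulmxDr mulmx1 mulmxA vf mul0mx addr0.
have := GU_h v a tauU; rewrite vt reflection_vec hZr => /eqP.
rewrite -subr_eq0 -{2}[h v a]mul1r -mulrBl mulf_eq0 subr_eq0 -(rmorph1 s).
by rewrite (inj_eq (fmorph_inj s)) (negPf lam1) => /eqP.
Qed.

Lemma fix_decomp v : exists2 v', v' *m f = 0 & exists c : K, v = v' + c *: a.
Proof.
have nz : lam - 1 != 0 by rewrite subr_eq0.
pose c := (v *m f) 0 0 / (lam - 1); exists (v - c *: a); last by exists c; rewrite subrK.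
rewrite mulmxBl -scalemxAl af scale_scalar_mx divfK // -mx11_scalar subrr //.
Qed.

Lemma center_anisotropic : h a a != 0.
Proof.
apply: contraNneq reflection_vec_neq0 => aa.
have [p pa] := nondeg s M_unit reflection_vec_neq0.
have [p' /fix_perp p'a [c ep]] := fix_decomp p.
move: pa; rewrite ep hDl hZl p'a aa mulr0 addr0 => /eqP.
by rewrite eq_sym oner_eq0.
Qed.

Lemma perp_fix v : h v a = 0 -> v *m GLval tau = v.
Proof.
have [v' v'f [c ->]] := fix_decomp v; have v'a := fix_perp v'f.
rewrite hDl hZl v'a add0r => /eqP; rewrite mulf_eq0 (negPf center_anisotropic) orbF.
by move/eqP->; rewrite scale0r addr0 tauE mulmxDr mulmx1 mulmxA v'f mul0mx addr0.
Qed.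

Lemma sglX (w b : 'rV[K]_n.+1) t k : sok w b t ->
  exists2 t', sok w (k%:R *: b) t' & (sgl w b t ^+ k)%g = sgl w (k%:R *: b) t'.
Proof.
move=> ok; have [ww _ _] := ok; elim: k => [|k [t' ok' IHk]].
  by exists 0; rewrite scale0r ?sgl0 //; apply: sok0.
exists (t + t' + h b (k%:R *: b)); rewrite -natr1 addrC scalerDl scale1r.
  exact: sokM.
by rewrite expgS IHk sglM.
Qed.

(** [Q] consists of the Siegel transvections for [w] and [x *: a], where the isotropic [w] is fixed
    by [tau]. As [tau] multiplies [x] by [lam], the word of [m] lands among the transvections along
    [w], and these are commutators in [Q]. *)
Theorem GU_root_subgroup : exists Q : {group gT},
  Q \subset ((GU s M)^`(1))%g /\ root_subgroup tau m Q.
Proof.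
have [|w [nz_w ww /PerpE wa]] := iso_exists sK e_skew nz_e M_skew (S := a).
  by rewrite addn2 ltnS (leq_trans _ n_ge3) // ltnS (leq_trans (rank_leq_row _)).
have aw := hC0 sK M_skew wa; have wt := perp_fix wa.
have wtX i : w *m GLval (tau ^+ i)%g = w.
  by elim: i => [|i IHi]; rewrite ?expg0 ?GL1 ?mulmx1 // expgS GLM mulmxA wt.
have okM x t y u : sok w (x *: a) t -> sok w (y *: a) u ->
    sok w ((x + y) *: a) (t + u + h (x *: a) (y *: a)).
  by rewrite scalerDl; apply: sokM.
pose A := [set g : gT | [exists x : K, exists t : K,
  (t - s t == h (x *: a) (x *: a)) && (g == sgl w (x *: a) t)]].
have okA x t : sok w (x *: a) t -> t - s t = h (x *: a) (x *: a) by case.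
have Aok x t : t - s t = h (x *: a) (x *: a) -> sok w (x *: a) t.
  by split=> //; rewrite hZl aw mulr0.
have AP g : reflect (exists x t, sok w (x *: a) t /\ g = sgl w (x *: a) t) (g \in A).
  rewrite inE; apply: (iffP existsP) => [[x /existsP[t /andP[/eqP ok /eqP ->]]]|[x [t [ok ->]]]].
    by exists x, t; split=> //; apply: Aok.
  by exists x; apply/existsP; exists t; rewrite (okA _ _ ok) !eqxx.
have gA : group_set A.
  apply/group_setP; split.
    by apply/AP; exists 0, 0; rewrite scale0r sgl0; split=> //; apply: sok0.
  move=> _ _ /AP[x [t [ok ->]]] /AP[y [u [oku ->]]]; apply/AP.
  exists (x + y), (t + u + h (x *: a) (y *: a)); split; first exact: okM oku.
  by rewrite (sglM sK M_skew ok oku) scalerDl.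
have qJ x t i : sok w (x *: a) t ->
    (sgl w (x *: a) t ^ (tau ^+ i))%g = sgl w ((x * lam ^+ i) *: a) t /\
    sok w ((x * lam ^+ i) *: a) t.
  move=> ok; have Gi : (tau ^+ i)%g \in GU s M by rewrite groupX.
  have := sokJ ok Gi; rewrite sglJ // wtX -scalemxAl reflection_vecX scalerA.
  by [].
exists (Group gA); split.
  by apply/subsetP=> _ /AP[x [t [ok ->]]]; apply: (sgl_in_GU_der sK two e_skew nz_e).
split.
(* One l-th power kills the vector parameter, a second one the remaining scalar parameter. *)
- apply: (@pgroup_of_exponent _ _ _ 2) => // _ /AP[x [t [ok ->]]].
  have [t' ok' E] := sglX l ok; rewrite expnS expn1 expgM E.
  rewrite (pcharf0 l_char) scale0r in ok' *.
  have st : sym s t' by case: ok' => _ _ /eqP; rewrite h0r subr_eq0 => /eqP.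
  have X k : (sgl w 0 t' ^+ k)%g = sgl w 0 (k%:R * t').
    elim: k => [|k IHk]; first by rewrite mul0r sgl0.
    rewrite expgSr IHk -sgl_TE -?natr1 ?mulrDl ?mul1r //.
    by apply: sok_T; rewrite // /sym rmorphM rmorph_nat st.
  by rewrite X (pcharf0 l_char) mul0r sgl0.
- rewrite inE; apply/subsetP=> _ /imsetP[_ /AP[x [t [ok ->]]] ->]; apply/AP.
  have [E ok'] := qJ x t 1 ok; rewrite expg1 in E.
  by exists (x * lam ^+ 1), t.
- have ok := Aok 1 (h (1 *: a) (1 *: a) / 2%:R).
  have {}ok : sok w (1 *: a) (h (1 *: a) (1 *: a) / 2%:R).
    by apply: sok_half; rewrite // hZl aw mulr0.
  exists (sgl w (1 *: a) (h (1 *: a) (1 *: a) / 2%:R)); first by apply/AP; exists 1, (h (1 *: a) (1 *: a) / 2%:R).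
  have [t' ok' ->] := sglRfix sK M_skew ok tauU wt; rewrite scale1r reflection_vec in ok' *.
  have [v vw] := nondeg s M_unit nz_w; apply/eqP=> E.
  have := congr1 (fun z => h z a) (sglE sK M_skew v ok'); rewrite /= E GL1 mulmx1 vw scale1r.
  rewrite !(hDl, hZl, hNl) wa mulr0 addr0 => /esym/(canRL (addKr _))/eqP.
  rewrite addNr -{2}[h a a]mul1r -mulrBl mulf_eq0 subr_eq0 (negPf lam1).
  by apply/negP; apply: center_anisotropic.
move=> _ /AP[x [t [ok ->]]].
have [t' ok' ->] : exists2 t', sok w (0 *: a) t' & cpow m (sgl w (x *: a) t) tau = sgl w (0 *: a) t'.
  have -> : 0 = \sum_(i < size m) (m`_i)%R%:R * (x * lam ^+ i).
    under eq_bigr => i _ do rewrite mulrCA.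
    by rewrite -mulr_sumr mlam_sum mulr0.
  rewrite /cpow; elim/big_rec2: _ => [|i g y _ [t' ok' ->]].
    by exists 0; rewrite scale0r ?sgl0 //; apply: sok0.
  have [-> oki] := qJ x t i ok; have [ti okti ->] := sglX (m`_i)%R oki.
  rewrite scalerA in okti *.
  exists (ti + t' + h (((m`_i)%R%:R * (x * lam ^+ i)) *: a) (y *: a)); first exact: okM.
  by rewrite (sglM sK M_skew okti ok') scalerDl.
rewrite scale0r in ok' *; have st : sym s t'.
  by case: ok' => _ _ /eqP; rewrite h0r subr_eq0 => /eqP.
(* The skew element [y] solves [- y * h a a - y * h a a = t']; the left side is the parameter of the
   commutator of the elements attached to [a] and [y *: a]. *)
have ca := center_anisotropic; pose y := - t' / (2%:R * h a a).
have sa : s (h a a) = - h a a by apply/eqP; rewrite -eqr_oppLR -(hC sK M_skew).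
have sy : s y = - y.
  by rewrite /y rmorphM fmorphV rmorphM rmorph_nat rmorphN st sa mulrN invrN mulrN.
have ok1 x' : sok w (x' *: a) (h (x' *: a) (x' *: a) / 2%:R).
  by apply: sok_half; rewrite // hZl aw mulr0.
pose t1 := h (1 *: a) (1 *: a) / 2%:R; pose ty := h (y *: a) (y *: a) / 2%:R.
have -> : sgl w 0 t' = [~ sgl w (1 *: a) t1, sgl w (y *: a) ty]%g.
  rewrite (sglR sK M_skew (ok1 1) (ok1 y)) scale1r hZl hZr sy.
  suff -> : t' = - y * h a a - y * h a a by [].
  by rewrite /y; field; rewrite ca two.
by apply: mem_commg; apply/AP; [exists 1, t1 | exists y, ty].
Qed.

End Unitary.
End RootSubgroups.

(** * Reflections and characteristic polynomials *)

Section CharPoly.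
Variable F : fieldType.

Lemma char_poly_conj n (P A : 'M[F]_n) : P \in unitmx ->
  char_poly (P *m A *m invmx P) = char_poly A.
Proof.
move=> uP; rewrite /char_poly /char_poly_mx !map_mxM map_invmx.
pose Q := map_mx (@polyC F) P; have uQ : Q \in unitmx by rewrite map_unitmx.
rewrite -/Q (_ : _ - _ = Q *m ('X%:M - map_mx (@polyC F) A) *m invmx Q).
  by rewrite !det_mulmx mulrAC -det_mulmx mulmxV // det1 mul1r.
by rewrite mulmxBr mulmxBl scalar_mxC -(mulmxA 'X%:M) mulmxV // mulmx1.
Qed.

(** In a basis extending the rows of [Y] the matrix is block triangular, with a scalar block [mu] of
    size [k]. *)
Lemma eigen_dvd_char_poly k n (A : 'M[F]_n) (Y : 'M_(k, n)) mu :
  row_free Y -> Y *m A = mu *: Y -> ('X - mu%:P) ^+ k %| char_poly A.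
Proof.
move=> fY YA; have /eqP rY := fY.
have le_kn : (k <= n)%N by rewrite -rY rank_leq_col.
have [m en] : exists m, n = (k + m)%N by exists (n - k)%N; rewrite subnKC.
subst n; pose R := row_ebase Y; have uR : R \in unitmx := row_ebase_unit Y.
pose B := R *m A *m invmx R; rewrite -(char_poly_conj A uR) -/B.
have pB : pid_mx k *m B = mu *: pid_mx k :> 'M_(k, k + m).
  have uC := col_ebase_unit Y.
  have E : pid_mx k = invmx (col_ebase Y) *m Y *m invmx R :> 'M_(k, k + m).
    by rewrite -{2}(mulmx_ebase Y) rY !mulmxA mulVmx // mul1mx mulmxK.
  rewrite {1}E /B !mulmxA mulmxKV // -(mulmxA _ Y) YA -scalemxAr -!scalemxAl.
  by rewrite -E.
rewrite -[B]submxK pid_mx_row mul_row_block !mul1mx !mul0mx !addr0 in pB.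
rewrite scale_row_mx scaler0 in pB; have [B11 B12] := eq_row_mx pB.
rewrite -[B]submxK B11 B12 /char_poly /char_poly_mx map_block_mx map_mx0.
rewrite (scalar_mx_block _ _ 'X) opp_block_mx add_block_mx oppr0 addr0 det_lblock.
rewrite scalemx1 map_scalar_mx /= -raddfB det_scalar.
exact: dvdp_mulIl.
Qed.

Lemma eigen_mult_le1 k n (A : 'M[F]_n) (Y : 'M_(k, n)) mu :
  row_free Y -> Y *m A = mu *: Y -> ~~ (('X - mu%:P) ^+ 2 %| char_poly A) -> (k <= 1)%N.
Proof.
move=> fY YA; rewrite leqNgt; apply: contraNN => lt1k.
by apply: dvdp_trans (eigen_dvd_char_poly fY YA); apply: dvdp_exp2l.
Qed.

End CharPoly.

(** * Powers of a matrix with exponent a power of l *)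

Section Frobenius.
Variables (l : nat) (K : fieldType) (n : nat).
Hypothesis l_char : l \in [pchar K].

Let l_prime : prime l := pcharf_prime l_char.

Lemma comm_exp_pchar (R : nzRingType) (y z : R) k : l \in [pchar R] -> GRing.comm y z ->
  (y - z) ^+ (l ^ k) = y ^+ (l ^ k) - z ^+ (l ^ k).
Proof.
move=> Rl cyz; elim: k => // k IHk; rewrite expnSr !exprM IHk.
have cyk : GRing.comm (y ^+ (l ^ k)) (z ^+ (l ^ k)) by apply: commrX; apply/commr_sym/commrX/commr_sym.
by have := pFrobenius_autB_comm Rl cyk.
Qed.

Lemma pchar_mx (R : comNzRingType) d : l \in [pchar R] -> l \in [pchar 'M[R]_d.+1].
Proof.
move=> Rl; rewrite inE l_prime /=; apply/eqP; rewrite -scaler_nat.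
by rewrite (pcharf0 Rl) scale0r.
Qed.

(** In characteristic l, (X - A)^q = X^q - A^q; take determinants. *)
Lemma char_poly_frobenius (A : 'M[K]_n.+1) k :
  char_poly (A ^+ (l ^ k)) \Po 'X^(l ^ k) = char_poly A ^+ (l ^ k).
Proof.
set q := (l ^ k)%N; rewrite /char_poly.
have -> : \det (char_poly_mx (A ^+ q)) \Po 'X^q =
    \det (map_mx (comp_poly 'X^q) (char_poly_mx (A ^+ q))) by rewrite det_map_mx.
have polyl : l \in [pchar {poly K}] by rewrite pchar_poly.
have E : char_poly_mx A ^+ q = map_mx (comp_poly 'X^q) (char_poly_mx (A ^+ q)).
  rewrite /char_poly_mx comm_exp_pchar ?pchar_mx //; last first.
    by rewrite /GRing.comm -!mulmxE scalar_mxC.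
  rewrite map_mxB map_scalar_mx /= comp_polyX -rmorphXn; congr (_ - _).
  rewrite -!rmorphXn /= -map_mx_comp; apply/matrixP=> i j; rewrite !mxE /=.
  by rewrite comp_polyC.
rewrite -E; elim: (q) => [|i IHi]; first by rewrite !expr0 det1.
by rewrite !exprS -mulmxE det_mulmx IHi.
Qed.

Lemma comp_Xn_inj q : (0 < q)%N -> injective (fun p : {poly K} => p \Po 'X^q).
Proof.
move=> q_gt0 p p' /eqP; rewrite -subr_eq0 -comp_polyB comp_poly_eq0 ?size_polyXn //.
by rewrite subr_eq0 => /eqP.
Qed.

(** The power q > n removes the unipotent part: (B - 1)(B - lam) = (A - 1)^q (A - lam)^q is a
    multiple of the characteristic polynomial of [A] at [A], hence 0. Since [lam ^+ q = lam], the
    characteristic polynomial does not change, so [lam] stays simple and [B - 1] has rank 1. *)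
Lemma pseudo_reflection (A : 'M[K]_n.+1) lam k : lam != 1 -> (n < l ^ k)%N ->
  lam ^+ (l ^ k) = lam ->
  char_poly A = ('X - 1) ^+ n * ('X - lam%:P) ->
  exists (a : 'rV[K]_n.+1) (f : 'cV[K]_n.+1),
    a *m f = (lam - 1)%:M /\ A ^+ (l ^ k) = 1%:M + f *m a.
Proof.
set q := (l ^ k)%N => lam1 lt_nq lamq chiA.
have q_gt0 : (0 < q)%N by apply: leq_ltn_trans lt_nq.
have Kl' : l \in [pchar {poly K}] by rewrite pchar_poly.
pose B := A ^+ q; have chiB : char_poly B = ('X - 1) ^+ n * ('X - lam%:P).
  apply: (comp_Xn_inj q_gt0); rewrite /= char_poly_frobenius chiA comp_polyM rmorphXn /=.
  rewrite !comp_polyB comp_polyX !comp_polyC exprMn exprAC.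
  rewrite !comm_exp_pchar //; try exact: mulrC.
  by rewrite expr1n -[lam in RHS]lamq polyC_exp.
have BB : (B - 1%:M) *m (B - lam%:M) = 0.
  have Ml := pchar_mx n l_char.
  have := Cayley_Hamilton A; rewrite chiA rmorphM rmorphXn /= !rmorphB /= !horner_mx_X rmorph1.
  rewrite horner_mx_C => CH.
  have cA (z : K) : GRing.comm A z%:M by rewrite /GRing.comm -!mulmxE scalar_mxC.
  have EY : (A - 1) ^+ q = B - 1.
    by rewrite comm_exp_pchar ?expr1n //; apply: commr1.
  have EW : (A - lam%:M) ^+ q = B - lam%:M.
    by rewrite comm_exp_pchar // -rmorphXn /= lamq.
  rewrite -[1%:M]/(1 : 'M[K]_n.+1) -EY -EW.
  have -> : (A - 1) ^+ q = (A - 1) ^+ (q - n) * (A - 1) ^+ n.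
    by rewrite -exprD subnK // ltnW.
  have -> : (A - lam%:M) ^+ q = (A - lam%:M) * (A - lam%:M) ^+ q.-1.
    by rewrite -exprS prednK.
  by rewrite mulmxE -mulrA (mulrA ((A - 1) ^+ n)) CH mul0r mulr0.
have rk_le1 : (\rank (B - 1%:M)%R <= 1)%N.
  apply: (eigen_mult_le1 (A := B) (Y := row_base (B - 1%:M)) (mu := lam)).
  - exact: row_base_free.
  - have /submxP[D ->] : (row_base (B - 1%:M) <= B - 1%:M)%MS by rewrite eq_row_base.
    by apply/eqP; rewrite -subr_eq0 -mul_mx_scalar -mulmxBr -mulmxA BB mulmx0.
  rewrite chiB expr2 dvdp_mul2r ?polyXsubC_eq0 // dvdp_XsubCl.
  by rewrite rootE !hornerE expf_eq0 subr_eq0 (negPf lam1) andbF.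
have nzB : B - 1%:M != 0.
  apply: contraNneq lam1 => /eqP; rewrite subr_eq0 => /eqP B1.
  have : root (char_poly B) lam by rewrite chiB rootM root_XsubC eqxx orbT.
  rewrite -eigenvalue_root_char => /eigenvalueP[v].
  rewrite B1 mulmx1 -{1}[v]scale1r => /eqP; rewrite -subr_eq0 -scalerBl scaler_eq0.
  by rewrite subr_eq0 eq_sym => /orP[//|/eqP-> /eqP].
have rk1 : \rank (B - 1%:M)%R = 1.
  by apply/eqP; rewrite eqn_leq rk_le1 lt0n mxrank_eq0.
have [f [a [E a_sub]]] : exists (f : 'cV[K]_n.+1) (a : 'rV[K]_n.+1),
    B - 1%:M = f *m a /\ (a <= B - 1%:M)%MS.
  move: (mulmx_base (B - 1%:M)) (eq_row_base (B - 1%:M)).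
  move: (col_base _) (row_base _); rewrite rk1 => f a <- ea.
  by exists f, a; split=> //; rewrite -ea.
exists a, f; split; last by rewrite -E addrC subrK.
have nz_a : a != 0 by apply: contra_neq nzB => a0; rewrite E a0 mulmx0.
have aB : a *m B = lam *: a.
  have /submxP[D ->] := a_sub.
  by apply/eqP; rewrite -subr_eq0 -mul_mx_scalar -mulmxBr -mulmxA BB mulmx0.
have : (a *m f - (lam - 1)%:M) *m a = 0.
  rewrite mulmxBl mul_scalar_mx -mulmxA -E mulmxBr mulmx1 aB scalerBl scale1r.
  by rewrite subrr.
rewrite [_ - _]mx11_scalar mul_scalar_mx => /eqP; rewrite scaler_eq0 (negPf nz_a) orbF.
move=> /eqP e0; apply/eqP; rewrite -subr_eq0; apply/eqP.
by rewrite [LHS]mx11_scalar e0 -scalemx1 scale0r.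
Qed.

End Frobenius.

(** * Restriction to a kernel and extension by duality *)

Section Dagger.
Variables (F : fieldType) (d : nat) (J : 'M[F]_d.+1).
Hypotheses (J_unit : J \in unitmx) (J_skew : J^T = - J).
Implicit Types X Y : 'M[F]_d.+1.

(* The adjoint for the form J: the pairing of v X with w is that of v with
   w (dag X). *)
Definition dag X := J *m X^T *m invmx J.

Lemma tr_invJ : (invmx J)^T = - invmx J.
Proof.
have h : J *m (invmx J)^T = - 1%:M.
  by rewrite -[X in X *m _]opprK -J_skew mulNmx -trmx_mul mulVmx // trmx1.
by rewrite -[LHS](mulKmx J_unit) h mulmxN mulmx1.
Qed.

Lemma dagM X Y : dag (X *m Y) = dag Y *m dag X.
Proof. by rewrite /dag trmx_mul !mulmxA mulmxKV. Qed.

Lemma dagD X Y : dag (X + Y) = dag X + dag Y.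
Proof. by rewrite /dag linearD mulmxDr mulmxDl. Qed.

Lemma dagN X : dag (- X) = - dag X.
Proof. by rewrite /dag linearN mulmxN mulNmx. Qed.

Lemma dag1 : dag 1%:M = 1%:M.
Proof. by rewrite /dag trmx1 mulmx1 mulmxV. Qed.

Lemma dagK : involutive dag.
Proof.
move=> X; rewrite /dag !trmx_mul trmxK tr_invJ J_skew !mulmxA !(mulmxN, mulNmx) opprK.
by rewrite mulmxV // mul1mx mulmxK.
Qed.

Lemma dag_form X (v w : 'rV[F]_d.+1) :
  v *m X *m J *m w^T = v *m J *m (w *m dag X)^T.
Proof.
rewrite /dag !trmx_mul trmxK tr_invJ J_skew !mulmxA.
by rewrite !(mulmxN, mulNmx) opprK mulmxK.
Qed.

Lemma dag_unitary X : (X *m J *m X^T == J) = (X *m dag X == 1%:M).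
Proof.
apply/eqP/eqP=> [XJ | XX]; first by rewrite /dag !mulmxA XJ mulmxV.
by rewrite -[RHS]mul1mx -XX /dag !mulmxA mulmxKV.
Qed.

Lemma dag_horner (Z Z' : 'M[F]_d.+1) q : dag Z = Z' ->
  dag (horner_mx Z q) = horner_mx Z' q.
Proof.
move=> ZZ'; elim/poly_ind: q => [|q c IHq].
  by rewrite !rmorph0 /dag trmx0 mulmx0 mul0mx.
rewrite !rmorphD !rmorphM /= !horner_mx_X !horner_mx_C dagD -!mulmxE dagM IHq ZZ'.
congr (_ + _); first by rewrite -{1}(horner_mx_X Z') mulmxE comm_horner_mx2 horner_mx_X.
by rewrite /dag tr_scalar_mx mul_mx_scalar -scalemxAl mulmxV ?scalemx1.
Qed.

End Dagger.

(** * Restriction to the kernel of p(Z) and extension by zero *)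

Section Restriction.
Variables (F : finFieldType) (d : nat) (Z : 'M[F]_d.+1) (K : finFieldType) (n : nat).
Variables (p : {poly F}) (ev : {rmorphism {poly F} -> K}) (rep : K -> {poly F}).
Variable e : 'rV[K]_n.+1 -> 'rV[F]_d.+1.

(* e identifies 'rV[K]_n.+1 with the kernel of p(Z), the class ev q of a
   polynomial acting as q(Z). *)
Record kernel_model : Prop := KernelModel {
  model_evrep : cancel rep ev;
  model_ev0 : forall q, (ev q == 0) = (p %| q);
  model_eD : {morph e : u v / u + v};
  model_inj : injective e;
  model_eZ : forall q v, e (ev q *: v) = e v *m horner_mx Z q;
  model_sur : forall u, u *m horner_mx Z p = 0 -> exists v, e v = u }.

Hypothesis mdl : kernel_model.
Let evrep := model_evrep mdl.
Let ev0 := model_ev0 mdl.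
Let eD := model_eD mdl.
Let e_inj := model_inj mdl.
Let eZ := model_eZ mdl.
Let e_sur := model_sur mdl.
Implicit Types (A B : 'M[F]_d.+1) (a b : 'M[K]_n.+1) (v w : 'rV[K]_n.+1).

Lemma e_ker v : e v *m horner_mx Z p = 0.
Proof.
have p0 : ev p = 0 by apply/eqP; rewrite ev0.
have e0 : e 0 = 0 by apply: (addrI (e 0)); rewrite -eD !addr0.
by rewrite -eZ p0 scale0r.
Qed.

Lemma e0 : e 0 = 0.
Proof. by apply: (addrI (e 0)); rewrite -eD !addr0. Qed.

Lemma eC (c : F) v : e (ev c%:P *: v) = c *: e v.
Proof. by rewrite eZ horner_mx_C mul_mx_scalar. Qed.

Lemma e_sum (I : Type) (r : seq I) (P : pred I) (f : I -> 'rV[K]_n.+1) :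
  e (\sum_(i <- r | P i) f i) = \sum_(i <- r | P i) e (f i).
Proof. exact: (big_morph e eD e0). Qed.

Definition einv (u : 'rV[F]_d.+1) : 'rV[K]_n.+1 := odflt 0 [pick v | e v == u].

Lemma einvK u : u *m horner_mx Z p = 0 -> e (einv u) = u.
Proof.
move=> /e_sur[v ev_u]; rewrite /einv; case: pickP => [w /eqP // | /(_ v)].
by rewrite ev_u eqxx.
Qed.

Lemma eK v : einv (e v) = v.
Proof. by apply: e_inj; rewrite einvK // e_ker. Qed.

Definition rho_mx A : 'M[K]_n.+1 := \matrix_i einv (e (delta_mx 0 i) *m A).

(** Scalars of [K] act as polynomials in [Z], so commuting with [Z] is K-linearity. *)
Lemma rho_mxE A v : comm_mx A Z -> e (v *m rho_mx A) = e v *m A.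
Proof.
move=> cAZ; rewrite mulmx_sum_row e_sum {2}[v]row_sum_delta e_sum mulmx_suml.
apply: eq_bigr => i _; rewrite -[v 0 i]evrep !eZ rowK.
have cA q : comm_mx A (horner_mx Z q) by apply: comm_mx_horner.
by rewrite einvK -?mulmxA ?cA // mulmxA e_ker mul0mx.
Qed.

Lemma rho_mx_uniq A a : comm_mx A Z -> (forall v, e v *m A = e (v *m a)) -> rho_mx A = a.
Proof.
move=> cA Aa; apply: mx_act_inj => v.
by apply: e_inj; rewrite rho_mxE.
Qed.

Lemma rho_mx1 : rho_mx 1%:M = 1%:M.
Proof. by apply: rho_mx_uniq => [|v]; rewrite ?mulmx1 //; apply: comm1mx. Qed.

Lemma rho_mxM A B : comm_mx A Z -> comm_mx B Z ->
  rho_mx (A *m B) = rho_mx A *m rho_mx B.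
Proof.
move=> cA cB; apply: rho_mx_uniq => [|v]; first exact/comm_mx_sym/comm_mxM/comm_mx_sym.
by rewrite mulmxA -!rho_mxE // mulmxA.
Qed.

Variable c : {poly F}.
Local Notation pi := (horner_mx Z c).
Hypotheses (c1 : p %| c - 1) (cp : pi *m horner_mx Z p = 0).

(** The two conditions on [c] make [pi] a projection onto the kernel of p(Z) that is itself a
    polynomial in [Z]. *)
Lemma pi_fix (u : 'rV_d.+1) : u *m horner_mx Z p = 0 -> u *m pi = u.
Proof.
move=> up; have /dvdpP[q cq] := c1; have -> : c = q * p + 1 by rewrite -cq subrK.
rewrite rmorphD rmorph1 mulrC rmorphM /= mulmxDr mulmx1 -mulmxE mulmxA up mul0mx.
by rewrite add0r.
Qed.

Lemma pi_ker (u : 'rV_d.+1) : u *m pi *m horner_mx Z p = 0.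
Proof. by rewrite -mulmxA cp mulmx0. Qed.

Lemma pi_e v : e v *m pi = e v. Proof. by rewrite pi_fix // e_ker. Qed.

Lemma pi_idem : pi *m pi = pi.
Proof. by apply: mx_act_inj => u; rewrite mulmxA pi_fix // pi_ker. Qed.

(** The endomorphism that is [a] on the kernel of p(Z) and 0 on the kernel of [pi]. *)
Definition lift_mx a : 'M[F]_d.+1 := \matrix_i e (einv (row i pi) *m a).

Lemma lift_mxE (u : 'rV_d.+1) a : u *m lift_mx a = e (einv (u *m pi) *m a).
Proof.
rewrite mulmx_sum_row; have -> : einv (u *m pi) =
    \sum_i ev (u 0 i)%:P *: einv (row i pi).
  apply: e_inj; rewrite einvK ?pi_ker // e_sum mulmx_sum_row.
  by apply: eq_bigr => i _; rewrite eC einvK // -row_mul cp row0.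
rewrite mulmx_suml e_sum; apply: eq_bigr => i _.
by rewrite rowK -scalemxAl eC.
Qed.

Lemma lift_mx_e v a : e v *m lift_mx a = e (v *m a).
Proof. by rewrite lift_mxE pi_e eK. Qed.

Lemma pi_lift a : pi *m lift_mx a = lift_mx a.
Proof. by apply: mx_act_inj => u; rewrite mulmxA !lift_mxE -mulmxA pi_idem. Qed.

Lemma lift_pi a : lift_mx a *m pi = lift_mx a.
Proof. by apply: mx_act_inj => u; rewrite mulmxA !lift_mxE pi_e. Qed.

Lemma lift_mxM a b : lift_mx a *m lift_mx b = lift_mx (a *m b).
Proof. by apply: mx_act_inj => u; rewrite mulmxA !(lift_mxE u) lift_mx_e mulmxA. Qed.

Lemma lift_mx1 : lift_mx 1%:M = pi.
Proof. by apply: mx_act_inj => u; rewrite lift_mxE mulmx1 einvK // pi_ker. Qed.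

Lemma comm_lift a : comm_mx (lift_mx a) Z.
Proof.
have eX v : e v *m Z = e (ev 'X *: v) by rewrite eZ horner_mx_X.
have cZ : Z *m pi = pi *m Z by symmetry; apply: comm_horner_mx.
apply: mx_act_inj => u; rewrite !mulmxA !lift_mxE eX scalemxAl; congr (e (_ *m a)).
by apply: e_inj; rewrite -eX !einvK ?pi_ker // -!mulmxA cZ.
Qed.

Lemma rho_lift B a : comm_mx B Z -> (forall v, e v *m B = 0) -> rho_mx (B + lift_mx a) = a.
Proof.
move=> cB eB; apply: rho_mx_uniq => [|v]; last by rewrite mulmxDr eB add0r lift_mx_e.
by apply/comm_mx_sym/comm_mxD; apply: comm_mx_sym => //; apply: comm_lift.
Qed.

End Restriction.

(** The identity x^deg(p) rev(p)(1/x) = p(x). The target is any ring, so that it serves for elements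
    of fields and for the matrices [Z] and [dag J Z]. *)
Lemma rev_poly_morph (F : fieldType) (R : nzRingType) (f g : {rmorphism {poly F} -> R})
    (p : {poly F}) :
  f 'X * g 'X = 1 -> (forall c, f c%:P = g c%:P) ->
  f 'X ^+ (size p).-1 * g (Poly (rev p)) = f p.
Proof.
move=> fg1 fgC; have [->|nz] := eqVneq p 0.
  by rewrite polyseq0 /= !rmorph0 mulr0.
have cf c x : GRing.comm (f c%:P) (f x) by rewrite /GRing.comm -!rmorphM mulrC.
have pE : p = \sum_(i < size p) (p`_i)%:P * 'X^i.
  by rewrite -[LHS]coefK poly_def; apply: eq_bigr => i _; rewrite mul_polyC.
have rE : Poly (rev p) = \sum_(i < size p) (p`_((size p).-1 - i))%:P * 'X^i.
  apply/polyP=> k; rewrite coef_Poly coef_sum.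
  under eq_bigr do rewrite coefCM coefXn.
  have [lt_k|le_k] := ltnP k (size p).
    rewrite (bigD1 (Ordinal lt_k)) //= eqxx mulr1 big1 ?addr0 => [|i ne_ik].
      by rewrite nth_rev // -subn1 -subnDA add1n.
    by rewrite -val_eqE /= eq_sym in ne_ik; rewrite (negPf ne_ik) mulr0.
  rewrite nth_default ?size_rev // big1 // => i _.
  by rewrite gtn_eqF ?mulr0 // (leq_trans (ltn_ord i)).
rewrite rE [in RHS]pE !rmorph_sum mulr_sumr (reindex_inj rev_ord_inj) /=.
apply: eq_bigr => i _; 
have E1 m k : (k < m -> m.-1 - (m - k.+1) = k)%N by lia.
have E2 m k : (k < m -> m.-1 = k + (m - k.+1))%N by lia.
rewrite E1 //.
rewrite !rmorphM !rmorphXn -fgC mulrA -(commrX _ (cf _ _)) -mulrA.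
congr (_ * _); rewrite (E2 _ _ (ltn_ord i)) exprD -mulrA; move: (size p - i.+1)%N => k.
suff -> : f 'X ^+ k * g 'X ^+ k = 1 by rewrite mulr1.
elim: k => [|k IHk]; first by rewrite mulr1.
by rewrite exprSr exprS -mulrA (mulrA (f 'X)) fg1 mul1r.
Qed.

Lemma bilinear_ext (F : fieldType) d (A B : 'M[F]_d.+1) :
  (forall u v : 'rV_d.+1, u *m A *m v^T = u *m B *m v^T) -> A = B.
Proof.
move=> AB; apply/matrixP=> i j; have := AB (delta_mx 0 i) (delta_mx 0 j).
by rewrite -!rowE !trmx_delta -!colE => /matrixP/(_ 0 0); rewrite !mxE.
Qed.

(** * Isometries with prescribed restriction *)

Section Lift.
Variables (F : finFieldType) (d : nat) (J Z : 'M[F]_d.+1) (K : finFieldType) (n : nat).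
Variables (p : {poly F}) (ev : {rmorphism {poly F} -> K}) (rep : K -> {poly F}).
Variable e : 'rV[K]_n.+1 -> 'rV[F]_d.+1.
Hypothesis mdl : kernel_model Z p ev rep e.
Hypotheses (J_unit : J \in unitmx) (J_skew : J^T = - J) (ZJ : Z *m dag J Z = 1%:M).
Variable c : {poly F}.
Local Notation pi := (horner_mx Z c).
Hypotheses (c1 : p %| c - 1) (cp : pi *m horner_mx Z p = 0).
Implicit Types (a : 'M[K]_n.+1) (X : 'M[F]_d.+1).

Lemma dag_comm X : comm_mx X Z -> comm_mx (dag J X) Z.
Proof.
move=> cX; have cX' : dag J Z *m dag J X = dag J X *m dag J Z.
  by rewrite -!dagM // cX.
rewrite /comm_mx -[LHS]mul1mx -{1}ZJ -mulmxA [dag J Z *m _]mulmxA cX'.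
by rewrite -[dag J X *m _ *m _]mulmxA (mulmx1C ZJ) mulmx1.
Qed.

(** It is [a] on the image of [pi], the adjoint of its inverse on the image of [dag J pi] (the dual
    kernel), and the identity where both projections vanish. *)
Definition paired_lift a : 'M_d.+1 :=
  (1%:M - pi - dag J pi + dag J (lift_mx Z e c (invmx a))) + lift_mx Z e c a.

Definition unitary_lift a : 'M_d.+1 := (1%:M - pi) + lift_mx Z e c a.

Section Paired.
Local Notation pi' := (dag J pi).
Hypotheses (pp' : pi *m pi' = 0) (p'p : pi' *m pi = 0).

Let base := 1%:M - pi - pi'.

Lemma comm_paired a : comm_mx (base + dag J (lift_mx Z e c (invmx a))) Z.
Proof.
have cpi : comm_mx pi Z by apply: comm_horner_mx.
apply/comm_mx_sym/comm_mxD; apply/comm_mx_sym; last exact/dag_comm/(comm_lift mdl).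
rewrite /comm_mx !(mulmxBl, mulmxBr) mul1mx mulmx1 cpi.
by rewrite (dag_comm cpi).
Qed.

Lemma paired_lift_rho a : rho_mx e (paired_lift a) = a.
Proof.
apply: (rho_lift mdl c1 cp); first exact: comm_paired.
move=> v; have vp : e v *m pi = e v by apply: (pi_e mdl c1).
have vp' : e v *m pi' = 0 by rewrite -vp -mulmxA pp' mulmx0.
rewrite !mulmxDr mulmx1 !mulmxN vp subrr vp' oppr0 addr0 add0r.
by rewrite -(lift_pi mdl c1 cp) dagM // mulmxA vp' mul0mx.
Qed.

Lemma paired_lift_comm a : comm_mx (paired_lift a) Z.
Proof.
apply/comm_mx_sym/comm_mxD; apply/comm_mx_sym; first exact: comm_paired.
exact: (comm_lift mdl).
Qed.

Lemma paired_lift_fix a (u : 'rV_d.+1) : u *m pi = 0 -> u *m pi' = 0 ->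
  u *m paired_lift a = u.
Proof.
move=> up up'; rewrite !mulmxDr mulmx1 !mulmxN up up' oppr0 !addr0.
rewrite -(lift_pi mdl c1 cp) dagM // mulmxA up' mul0mx addr0.
by rewrite -(pi_lift mdl c1 cp) mulmxA up mul0mx addr0.
Qed.

Lemma paired_lift_dag a : a \in unitmx -> paired_lift a *m dag J (paired_lift a) = 1%:M.
Proof.
move=> ua; rewrite /paired_lift -/base.
have XE := lift_pi mdl c1 cp a; have XE' := pi_lift mdl c1 cp a.
have YE := lift_pi mdl c1 cp (invmx a); have YE' := pi_lift mdl c1 cp (invmx a).
have XY : lift_mx Z e c a *m lift_mx Z e c (invmx a) = pi.
  by rewrite (lift_mxM mdl c1 cp) mulmxV // (lift_mx1 mdl cp).
move: (lift_mx Z e c a) (lift_mx Z e c (invmx a)) XE XE' YE YE' XY => X Y XE XE' YE YE' XY.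
have pipi := pi_idem c1 cp.
have baseE : dag J base = base.
  by rewrite /base !(dagD, dagN) dagK // dag1 // addrAC.
have bp : base *m pi = 0 by rewrite !mulmxBl mul1mx pipi p'p subrr subr0.
have pb : pi *m base = 0 by rewrite !mulmxBr mulmx1 pipi pp' subrr subr0.
have d0 : dag J 0 = 0 by rewrite /dag trmx0 mulmx0 mul0mx.
have bp' : base *m pi' = 0 by rewrite -{1}baseE -(dagM J_unit pi base) pb d0.
have p'b : pi' *m base = 0 by rewrite -{1}baseE -(dagM J_unit base pi) bp d0.
have bb : base *m base = base by rewrite {2}/base !mulmxBr mulmx1 bp bp' !subr0.
have dX : dag J X = pi' *m dag J X by rewrite -dagM // XE.
have dX' : dag J X = dag J X *m pi' by rewrite -dagM // XE'.
have dY : dag J Y = pi' *m dag J Y by rewrite -dagM // YE.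
have dY' : dag J Y = dag J Y *m pi' by rewrite -dagM // YE'.
have baseD : base = 1%:M - pi - pi' by [].
move: (base) baseD baseE bp pb bp' p'b bb => b baseD baseE bp pb bp' p'b bb.
rewrite !dagD baseE dagK // !(mulmxDl, mulmxDr) bb.
have -> : dag J Y *m b = 0 by rewrite dY' -mulmxA p'b mulmx0.
have -> : X *m b = 0 by rewrite -XE -mulmxA pb mulmx0.
have -> : b *m Y = 0 by rewrite -YE' mulmxA bp mul0mx.
have -> : dag J Y *m Y = 0 by rewrite dY' -YE' -mulmxA (mulmxA pi') p'p mul0mx mulmx0.
have -> : b *m dag J X = 0 by rewrite dX mulmxA bp' mul0mx.
have -> : X *m dag J X = 0 by rewrite dX -XE -mulmxA (mulmxA pi) pp' mul0mx mulmx0.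
rewrite -dagM // XY baseD; apply/matrixP=> i k; rewrite !mxE; ring.
Qed.

End Paired.

Section Unitary.
Hypothesis pi_dag : dag J pi = pi.

Lemma unitary_lift_rho a : rho_mx e (unitary_lift a) = a.
Proof.
apply: (rho_lift mdl c1 cp) => [|v]; last by rewrite mulmxBr mulmx1 (pi_e mdl c1) subrr.
rewrite /comm_mx !(mulmxBl, mulmxBr) mul1mx mulmx1; congr (_ - _).
exact: comm_horner_mx.
Qed.

Lemma unitary_lift_comm a : comm_mx (unitary_lift a) Z.
Proof.
apply/comm_mx_sym/comm_mxD; apply/comm_mx_sym; last exact: (comm_lift mdl).
rewrite /comm_mx !(mulmxBl, mulmxBr) mul1mx mulmx1; congr (_ - _).
exact: comm_horner_mx.
Qed.

Lemma unitary_lift_fix a (u : 'rV_d.+1) : u *m pi = 0 -> u *m unitary_lift a = u.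
Proof.
move=> up; rewrite !mulmxDr mulmx1 !mulmxN up oppr0 !addr0.
by rewrite -(pi_lift mdl c1 cp) mulmxA up mul0mx addr0.
Qed.

Lemma unitary_lift_dag a :
  (forall v w, e (v *m a) *m J *m (e (w *m a))^T = e v *m J *m (e w)^T) ->
  unitary_lift a *m dag J (unitary_lift a) = 1%:M.
Proof.
move=> ua; rewrite /unitary_lift.
have XE := lift_pi mdl c1 cp a; have XE' := pi_lift mdl c1 cp a.
have pipi := pi_idem c1 cp.
have XX : lift_mx Z e c a *m dag J (lift_mx Z e c a) = pi.
  rewrite -[RHS]pipi -[X in _ = _ *m X]pi_dag /dag !mulmxA; congr (_ *m _).
  apply: bilinear_ext => u w; have := ua (einv e (u *m pi)) (einv e (w *m pi)).
  rewrite -!(lift_mxE mdl cp) !(einvK mdl) ?(pi_ker cp) // !trmx_mul !mulmxA //.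
move: (lift_mx Z e c a) XE XE' XX => X XE XE' XX.
have dX : dag J X = pi *m dag J X by rewrite -{1}pi_dag -dagM // XE.
rewrite !(dagD, dagN) pi_dag dag1 // !(mulmxDl, mulmxDr) XX.
rewrite !(mulmxN, mulNmx, mul1mx, mulmx1) pipi XE -dX.
apply/matrixP=> i k; rewrite !mxE; ring.
Qed.

End Unitary.
End Lift.

(** * The unitary form *)

Section Descend.
Variables (F : finFieldType) (p : {poly F}) (K : finFieldType).
Variables (ev : {rmorphism {poly F} -> K}) (rep : K -> {poly F}).
Hypotheses (evrep : cancel rep ev) (ev0 : forall q, (ev q == 0) = (p %| q)).

Lemma rmorph_descend (R : comNzRingType) (f : {rmorphism {poly F} -> R}) :
  f p = 0 -> exists s : {rmorphism K -> R}, forall q, s (ev q) = f q.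
Proof.
move=> fp; pose s a := f (rep a).
have sE q : s (ev q) = f q.
  have /dvdpP[u qE] : p %| rep (ev q) - q by rewrite -ev0 rmorphB evrep subrr.
  by apply/eqP; rewrite -subr_eq0 -rmorphB qE rmorphM fp mulr0.
have sB : {morph s : a b / a - b}.
  by move=> a b; rewrite -[a]evrep -[b]evrep -rmorphB !sE rmorphB.
have sM : {morph s : a b / a * b}.
  by move=> a b; rewrite -[a]evrep -[b]evrep -rmorphM !sE rmorphM.
have s1 : s 1 = 1 by rewrite -(rmorph1 ev) sE rmorph1.
pose sA := GRing.isZmodMorphism.Build K R s sB.
pose sR := GRing.isMonoidMorphism.Build K R s (s1, sM).
pose S : {rmorphism K -> R} := HB.pack s sA sR.
by exists S.
Qed.

(** For self-reciprocal [p] the inverse of the class of X is again a root of [p], so X |-> 1/X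
    induces an automorphism of [K]. *)
Lemma ev_involution : p`_0 != 0 -> recip p = p ->
  exists2 s : {rmorphism K -> K}, s (ev 'X) * ev 'X = 1
    & forall c, s (ev c%:P) = ev c%:P.
Proof.
move=> p0 rp; have nzX : ev 'X != 0.
  apply: contra p0 => /eqP X0; have : ev p = 0 by apply/eqP; rewrite ev0.
  have [q [k pE]] : exists q k, p = q * 'X + k%:P.
    by elim/poly_ind: (p) => [|q k _]; [exists 0, 0; rewrite mul0r add0r polyC0 | exists q, k].
  have -> : p`_0 = k by rewrite pE coefD coefMX coefC add0r.
  rewrite pE rmorphD rmorphM X0 mulr0 add0r => evk; apply: contraT => nzk.
  have := oner_neq0 K; have <- : ev (k^-1%:P * k%:P) = 1 by rewrite -polyCM mulVf // rmorph1.
  by rewrite rmorphM evk mulr0 eqxx.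
pose cK := ev \o polyC.
have cu : commr_rmorph cK (ev 'X)^-1 by move=> c; apply: mulrC.
pose f : {rmorphism {poly F} -> K} := horner_morph cu.
have fX : f 'X = (ev 'X)^-1 by rewrite /f /= horner_morphX.
have fC c : f c%:P = ev c%:P by rewrite /f /= horner_morphC.
have fp : f p = 0.
  have evX : ev 'X * f 'X = 1 by rewrite fX mulfV.
  have := rev_poly_morph p evX (fun c => esym (fC c)).
  have /eqP-> : ev p == 0 by rewrite ev0.
  move/eqP; rewrite mulf_eq0 expf_eq0 (negPf nzX) andbF => /eqP fr.
  have : f (recip p) = 0 by rewrite /recip -mul_polyC rmorphM fr mulr0.
  by rewrite rp.
have [s sE] := rmorph_descend fp; exists s => [|c]; last by rewrite sE fC.
by rewrite sE fX mulVf.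
Qed.

Lemma ev_involutionK (s : {rmorphism K -> K}) : s (ev 'X) * ev 'X = 1 ->
  (forall c, s (ev c%:P) = ev c%:P) -> involutive s.
Proof.
move=> sX sC; have nzX : ev 'X != 0.
  by apply/eqP=> X0; move/eqP: sX; rewrite X0 mulr0 eq_sym oner_eq0.
have sXE : s (ev 'X) = (ev 'X)^-1 by rewrite -[LHS](mulfK nzX) sX mul1r.
move=> a; rewrite -[a]evrep; elim/poly_ind: (rep a) => [|q c IHq]; first by rewrite !rmorph0.
by rewrite !rmorphD !rmorphM IHq !sC sXE fmorphV sXE invrK.
Qed.

End Descend.

Section Hermitian.
Variables (F : finFieldType) (d : nat) (J Z : 'M[F]_d.+1) (K : finFieldType) (n : nat).
Variables (p : {poly F}) (ev : {rmorphism {poly F} -> K}) (rep : K -> {poly F}).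
Variable e : 'rV[K]_n.+1 -> 'rV[F]_d.+1.
Hypothesis mdl : kernel_model Z p ev rep e.
Hypotheses (J_unit : J \in unitmx) (J_skew : J^T = - J) (ZJ : Z *m dag J Z = 1%:M).
Variable s : {rmorphism K -> K}.
Hypotheses (sX : s (ev 'X) * ev 'X = 1) (sC : forall c, s (ev c%:P) = ev c%:P).
Hypotheses (nz_p : p != 0) (cardK : #|K| = (#|F| ^ (size p).-1)%N).
Variable theta0 : K -> F.
Hypotheses (t0D : {morph theta0 : a b / a + b}) (t01 : theta0 1 = 1).
Hypothesis t0Z : forall c a, theta0 (ev c%:P * a) = c * theta0 a.
Hypothesis two : 2%:R != 0 :> F.

Let eZ := model_eZ mdl.
Let eD := model_eD mdl.
Let sK : involutive s := ev_involutionK (model_evrep mdl) sX sC.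

Definition beta x y : F := (e x *m J *m (e y)^T) 0 0.

Lemma betaE x y : e x *m J *m (e y)^T = (beta x y)%:M.
Proof. exact: mx11_scalar. Qed.

Lemma betaC x y : beta y x = - beta x y.
Proof.
have -> : beta x y = (e x *m J *m (e y)^T)^T 0 0 by rewrite mxE.
by rewrite !trmx_mul trmxK J_skew mulNmx mulmxN mxE opprK mulmxA.
Qed.

Lemma e_dag y q : e y *m horner_mx (dag J Z) q = e (s (ev q) *: y).
Proof.
elim/poly_ind: q y => [|q c IHq] y; first by rewrite !rmorph0 mulmx0 scale0r (e0 mdl).
have eX : e y *m dag J Z = e (s (ev 'X) *: y).
  rewrite [y in LHS](_ : y = ev 'X *: (s (ev 'X) *: y)); last by rewrite scalerA mulrC sX scale1r.
  by rewrite eZ horner_mx_X -mulmxA ZJ mulmx1.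
rewrite !rmorphD !rmorphM /= horner_mx_X horner_mx_C mulmxDr scalerDl eD sC.
congr (_ + _); last by rewrite (eC mdl) mul_mx_scalar.
have cX : horner_mx (dag J Z) q *m dag J Z = dag J Z *m horner_mx (dag J Z) q.
  exact: comm_horner_mx.
by rewrite -mulmxE cX mulmxA eX IHq scalerA.
Qed.

Lemma betaZ a x y : beta (a *: x) y = beta x (s a *: y).
Proof.
rewrite -[a](model_evrep mdl); move: (rep a) => q.
by rewrite /beta eZ dag_form // (dag_horner J_unit q (erefl _)) e_dag.
Qed.

Lemma betaDl x x' y : beta (x + x') y = beta x y + beta x' y.
Proof. by rewrite /beta eD !mulmxDl mxE. Qed.

Lemma betaCl c x y : beta (ev c%:P *: x) y = c * beta x y.
Proof. by rewrite /beta (eC mdl) -!scalemxAl mxE. Qed.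

(** A substitute for the trace of [K] over [F], symmetrized to be invariant under [s]. Its value 2
    at 1 is nonzero, which makes (a, b) |-> theta (a b) non-degenerate. *)
Definition theta a := theta0 a + theta0 (s a).

Lemma theta_s a : theta (s a) = theta a.
Proof. by rewrite /theta sK addrC. Qed.

Lemma thetaD : {morph theta : a b / a + b}.
Proof. by move=> a b; rewrite /theta rmorphD !t0D addrACA. Qed.

Lemma thetaC c a : theta (ev c%:P * a) = c * theta a.
Proof. by rewrite /theta rmorphM sC !t0Z mulrDr. Qed.

Lemma theta0_eq0 : theta 0 = 0.
Proof. by rewrite -(mul0r 0) -{1}(rmorph0 ev) -polyC0 thetaC mul0r. Qed.

Lemma ev_span a : exists x : 'I_(size p).-1 -> F, a = \sum_i ev (x i)%:P * ev 'X ^+ i.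
Proof.
pose q := rep a %% p.
have -> : a = ev q.
  have /eqP p0 : ev p == 0 by rewrite (model_ev0 mdl).
  by rewrite -[LHS](model_evrep mdl) (divp_eq (rep a) p) rmorphD rmorphM p0 mulr0 add0r.
have le_q : (size q <= (size p).-1)%N.
  by rewrite -ltnS -polySpred // ltn_modpN0.
exists (fun i => q`_i); rewrite -[in LHS](coefK q) poly_def rmorph_sum /=.
rewrite (big_ord_widen _ (fun i => ev (q`_i *: 'X^i)) le_q) big_mkcond /=.
apply: eq_bigr => i _; case: ltnP => [_|/(nth_default 0)->].
  by rewrite -mul_polyC rmorphM rmorphXn.
by rewrite polyC0 rmorph0 mul0r.
Qed.

Lemma theta_nondeg c : (forall a, theta (a * c) = 0) -> c = 0.
Proof.
move=> tc; apply/eqP; apply/negP=> /negP nz; have := tc c^-1.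
by rewrite mulVf // /theta rmorph1 t01 => /eqP; apply/negP; rewrite -[1 + 1]/(2%:R).
Qed.

(* A dimension count: K and its F-linear functionals have the same cardinality. *)
Lemma theta_dual (f : K -> F) : {morph f : a b / a + b} ->
  (forall c a, f (ev c%:P * a) = c * f a) -> exists c, forall a, theta (a * c) = f a.
Proof.
move=> fD fC.
have eq_f (f1 f2 : K -> F) : {morph f1 : a b / a + b} -> {morph f2 : a b / a + b} ->
    (forall c a, f1 (ev c%:P * a) = c * f1 a) -> (forall c a, f2 (ev c%:P * a) = c * f2 a) ->
    (forall i : 'I_(size p).-1, f1 (ev 'X ^+ i) = f2 (ev 'X ^+ i)) -> f1 =1 f2.
  move=> f1D f2D f1C f2C f12 a; have [x ->] := ev_span a.
  have z1 : f1 0 = 0 by apply: (addrI (f1 0)); rewrite -f1D !addr0.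
  have z2 : f2 0 = 0 by apply: (addrI (f2 0)); rewrite -f2D !addr0.
  rewrite (big_morph f1 f1D z1) (big_morph f2 f2D z2).
  by apply: eq_bigr => i _; rewrite f1C f2C f12.
have tcD c : {morph (fun a => theta (a * c)) : a b / a + b}.
  by move=> a b; rewrite mulrDl thetaD.
have tcC c k a : theta (ev k%:P * a * c) = k * theta (a * c) by rewrite -mulrA thetaC.
pose Phi c := [ffun i : 'I_(size p).-1 => theta (ev 'X ^+ i * c)].
have Phi_inj : injective Phi.
  move=> c c' /ffunP Pcc'; apply/eqP; rewrite -subr_eq0; apply/eqP/theta_nondeg => a.
  have := eq_f _ _ (tcD c) (tcD c') (tcC c) (tcC c') _ a; rewrite mulrBr => tE.
  rewrite -[LHS](addrK (theta (a * c'))) -thetaD subrK tE ?subrr // => i.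
  by have := Pcc' i; rewrite !ffunE.
have cardP : (#|{: {ffun 'I_(size p).-1 -> F}}| <= #|K|)%N by rewrite card_ffun card_ord cardK.
have /codomP[c fE] := inj_card_onto Phi_inj cardP [ffun i : 'I_(size p).-1 => f (ev 'X ^+ i)].
exists c; apply: eq_f => // i.
by have /ffunP/(_ i) := fE; rewrite !ffunE.
Qed.

Lemma beta_gram : exists h : 'rV[K]_n.+1 -> 'rV[K]_n.+1 -> K,
  forall x y a, theta (a * h x y) = beta (a *: x) y.
Proof.
have h_ex x y : exists c, [forall a, theta (a * c) == beta (a *: x) y].
  have [a b|c a|c cP] := @theta_dual (fun a => beta (a *: x) y).
  - by rewrite scalerDl betaDl.
  - by rewrite -scalerA betaCl.
  by exists c; apply/forallP=> a; rewrite cP.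
exists (fun x y => xchoose (h_ex x y)) => x y a.
exact/eqP/(forallP (xchooseP (h_ex x y))).
Qed.

(** By duality for [theta], [beta] comes from a unique K-valued form. It is sesquilinear because the
    adjoint of a scalar is its image under [s], and skew because [J] is. *)
Lemma hermitian_gram : exists2 M : 'M[K]_n.+1,
    (map_mx s M)^T = - M & forall x y a, theta (a * hform s M x y) = beta (a *: x) y.
Proof.
have [h hE] := beta_gram.
have h_uniq x y c : (forall a, theta (a * c) = beta (a *: x) y) -> h x y = c.
  move=> cE; apply/eqP; rewrite -subr_eq0; apply/eqP/theta_nondeg => a.
  by rewrite mulrBr -[LHS](addrK (theta (a * c))) -thetaD subrK hE cE subrr.
have thN a : theta (- a) = - theta a.
  by apply: (addrI (theta a)); rewrite -thetaD !subrr theta0_eq0.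
have hDl x x' y : h (x + x') y = h x y + h x' y.
  by apply: h_uniq => a; rewrite mulrDr thetaD !hE scalerDr betaDl.
have hZl b x y : h (b *: x) y = b * h x y.
  by apply: h_uniq => a; rewrite mulrA hE scalerA.
have hC x y : h y x = - s (h x y).
  apply: h_uniq => a; rewrite mulrN thN -theta_s rmorphM sK hE.
  by rewrite betaZ sK betaC opprK.
pose M : 'M[K]_n.+1 := \matrix_(i, j) h (delta_mx 0 i) (delta_mx 0 j).
exists M; first by apply/matrixP=> i j; rewrite !mxE -[LHS]opprK -hC.
move=> x y a; rewrite -hE; congr (theta (a * _)).
have hsum (I : Type) (r : seq I) (f : I -> 'rV_n.+1) z :
    h (\sum_(i <- r) f i) z = \sum_(i <- r) h (f i) z.
  have h0 : h 0 z = 0 by rewrite -(scale0r 0) hZl mul0r.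
  exact: (big_morph (h^~ z) (fun x1 x2 => hDl x1 x2 z) h0).
rewrite /hform /hvec mxE [in RHS](row_sum_delta x) hsum; apply: eq_bigr => i _.
rewrite hZl; congr (_ * _); rewrite mxE [h _ y]hC [in RHS](row_sum_delta y) hsum.
rewrite rmorph_sum -sumrN; apply: eq_bigr => j _.
by rewrite hZl rmorphM !mxE mulrC -mulrN -hC.
Qed.

Variable c : {poly F}.
Local Notation pi := (horner_mx Z c).
Hypotheses (c1 : p %| c - 1) (cp : pi *m horner_mx Z p = 0) (pi_dag : dag J pi = pi).
Variable M : 'M[K]_n.+1.
Hypothesis gramM : forall x y a, theta (a * hform s M x y) = beta (a *: x) y.

(** A vector killed by [M] is orthogonal to the image of [pi]. As [pi] is self-adjoint and fixes the
    vector, the vector is orthogonal to everything. *)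
Lemma gram_unit : M \in unitmx.
Proof.
rewrite -row_free_unit -kermx_eq0; apply/eqP/row_matrixP=> i; rewrite row0.
set v := row i _; have vM : v *m M = 0.
  by apply/sub_kermxP; rewrite row_sub.
apply: (model_inj mdl); rewrite (e0 mdl).
apply: (can_inj (mulmxK J_unit)); rewrite mul0mx.
have evpi : e v *m pi = e v := pi_e mdl c1 v.
have piJ : J *m pi^T = pi *m J by rewrite -{2}pi_dag mulmxKV.
rewrite -evpi -mulmxA -piJ; apply/rowP=> k; rewrite [RHS]mxE.
have := gramM v (einv e (row k pi)) 1.
rewrite scale1r mul1r /hform /hvec mulmxA vM mul0mx mxE theta0_eq0 /beta (einvK mdl).
  by rewrite tr_row colE mulmxA -colE -mulmxA [X in _ = X -> _]mxE => <-.
by rewrite -row_mul cp row0.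
Qed.

Lemma GU_beta (g : GLfin K n) : g \in GU s M <->
  forall v w, beta (v *m GLval g) (w *m GLval g) = beta v w.
Proof.
split=> [gU v w | gb].
  by rewrite -[v in RHS]scale1r -gramM -(GU_h _ _ gU) gramM scale1r.
apply: h_GU => x y; apply/eqP; rewrite -subr_eq0; apply/eqP/theta_nondeg => a.
have thB u v : theta (u - v) = theta u - theta v.
  by rewrite -[LHS](addrK (theta v)) -thetaD subrK.
by rewrite mulrBr thB !gramM scalemxAl gb subrr.
Qed.

End Hermitian.

(** * Factors of the cyclotomic polynomial *)

Section PolyRoots.
Variables (F : finFieldType) (L : fieldType) (iota : {rmorphism F -> L}).
Implicit Types (p q m : {poly F}) (x z : L).
Local Notation "p ^i" := (map_poly iota p) (at level 2, format "p ^i").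

Lemma irr_dvd_root p q x : irreducible_poly p -> root p^i x -> root q^i x -> p %| q.
Proof.
move=> irr px qx; rewrite -[_ %| _]negbK -irreducible_poly_coprime //.
rewrite -(coprimep_map iota); apply/negP=> /coprimep_root/(_ px).
by rewrite -rootE qx.
Qed.

(** Row vectors over the finite field encode polynomials of bounded size, so that a least size can
    be sought by a boolean predicate. *)
Lemma min_poly_ex q x : q != 0 -> root q^i x ->
  exists2 m, monic_irreducible_poly m & root m^i x.
Proof.
move=> nz qx.
pose P k := [exists v : 'rV[F]_k, (rVpoly v != 0) && root (rVpoly v)^i x].
have Pq (u : {poly F}) : u != 0 -> root u^i x -> P (size u).
  move=> nzu ux; apply/existsP; exists (poly_rV u).
  by rewrite poly_rV_K // nzu.
have [k /existsP[v /andP[nzv vx]] kmin] := ex_minnP (ex_intro P _ (Pq q nz qx)).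
set w := rVpoly v in nzv vx; have sz_w : size w = k.
  by apply/eqP; rewrite eqn_leq size_poly kmin // Pq.
pose m := (lead_coef w)^-1 *: w.
have nzl : (lead_coef w)^-1 != 0 by rewrite invr_eq0 lead_coef_eq0.
have sz_m : size m = k by rewrite size_scale.
have nzm : m != 0 by rewrite scaler_eq0 negb_or nzl.
have mx : root m^i x by rewrite map_polyZ rootZ ?fmorph_eq0.
have ge_k u : u != 0 -> root u^i x -> (k <= size u)%N by move=> nzu ux; rewrite kmin // Pq.
exists m => //; split; last by rewrite monicE lead_coefZ mulVf // lead_coef_eq0.
split=> [|u sz_u um].
  by rewrite -(size_map_poly iota) (root_size_gt1 (a := x)) // map_poly_eq0.
have [u' mE] := dvdpP _ _ um.
have nz_uu : (u' != 0) && (u != 0) by rewrite -negb_or -mulf_eq0 -mE.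
have [nzu' nzu] := andP nz_uu.
have szE : k = (size u' + size u).-1 by rewrite -sz_m mE size_mul.
have gt0 : (0 < size u)%N by rewrite size_poly_gt0.
have gt0' : (0 < size u')%N by rewrite size_poly_gt0.
have : root (u' * u)^i x by rewrite -mE.
rewrite rmorphM rootM => /orP[/(ge_k _ nzu')|/(ge_k _ nzu)] lek.
  by case/eqP: sz_u; move: szE gt0 gt0' lek; move: (size u) (size u') => a b; lia.
rewrite -dvdp_size_eqp // sz_m; apply/eqP; move: szE gt0 gt0' lek.
by move: (size u) (size u') => a b; lia.
Qed.

Lemma recip_root p x : p`_0 != 0 -> x != 0 -> root (recip p)^i x = root p^i x^-1.
Proof.
move=> p0 nzx; rewrite /recip map_polyZ rootZ; last by rewrite fmorph_eq0 invr_eq0.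
pose f y : {rmorphism {poly F} -> L} := horner_eval y \o map_poly iota.
have fE y q : f y q = (q^i).[y] by [].
have fX y : f y 'X = y by rewrite /f /= /horner_eval map_polyX hornerX.
have fC y c : f y c%:P = iota c by rewrite /f /= /horner_eval map_polyC hornerC.
have fg : f x^-1 'X * f x 'X = 1 by rewrite !fX mulVf.
have := rev_poly_morph p fg (fun c => etrans (fC _ c) (esym (fC _ c))).
rewrite fX !fE !rootE => <-; rewrite mulf_eq0 expf_eq0 invr_eq0 (negPf nzx) andbF //.
Qed.

End PolyRoots.

Lemma size_recip (F : fieldType) (p : {poly F}) : p`_0 != 0 -> size (recip p) = size p.
Proof.
move=> p0; rewrite size_scale ?invr_eq0 // (PolyK (c := 1)) ?size_rev //.
by case: (polyseq p) p0 => [|a s] //=; rewrite ?eqxx // rev_cons last_rcons.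
Qed.

Lemma monic_recip (F : fieldType) (p : {poly F}) : p`_0 != 0 -> recip p \is monic.
Proof.
move=> p0; rewrite monicE lead_coefZ lead_coefE (PolyK (c := 1)).
  have sz : (0 < size p)%N by case: ltnP p0 => // /(nth_default 0)->; rewrite eqxx.
  by rewrite size_rev nth_rev ?prednK // subnn mulVf.
by case: (polyseq p) p0 => [|a s] //=; rewrite ?eqxx // rev_cons last_rcons.
Qed.

Lemma coprimep_no_root (F : fieldType) (L : closedFieldType) (iota : {rmorphism F -> L})
    (p q : {poly F}) :
  (forall x, root (map_poly iota p) x -> ~~ root (map_poly iota q) x) -> coprimep p q.
Proof. by move=> pq; rewrite -(coprimep_map iota); apply: Pdiv.ClosedField.root_coprimep. Qed.

Section Reps.
Variables (F : finFieldType) (L : closedFieldType) (iota : {rmorphism F -> L}).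
Variables (r : nat) (zr : L) (t : nat) (phi : 'I_t -> {poly F}).
Hypotheses (r_gt0 : (0 < r)%N) (zr_prim : r.-primitive_root zr).
Local Notation Phi := (geom_poly F r).
Hypotheses (phi_mi : forall j, monic_irreducible_poly (phi j)) (phi_reps : factor_reps Phi phi).
Local Notation "p ^i" := (map_poly iota p) (at level 2, format "p ^i").

Lemma geom_polyE : ('X - 1) * Phi = 'X^r - 1.
Proof. by rewrite subrX1. Qed.

Lemma geom_poly_factor : Phi^i = \prod_(1 <= k < r) ('X - (zr ^+ k)%:P).
Proof.
have nz : ('X - 1 : {poly L}) != 0 by rewrite monic_neq0 // -polyC1 monicXsubC.
apply: (mulfI nz); have := factor_Xn_sub_1 zr_prim.
rewrite big_ltn // expr0 polyC1 => ->.
have := congr1 (map_poly iota) geom_polyE.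
by rewrite rmorphM !rmorphB !rmorph1 /= map_polyXn map_polyX.
Qed.

Lemma geom_poly_root x : root Phi^i x -> x ^+ r = 1.
Proof.
move=> Px; have : root ('X^r - 1 : {poly F})^i x by rewrite -geom_polyE rmorphM rootM Px orbT.
rewrite rmorphB rmorph1 /= map_polyXn rootE !hornerE subr_eq0 => /eqP->//.
Qed.

Lemma geom_poly_root_neq0 x : root Phi^i x -> x != 0.
Proof.
move/geom_poly_root=> xr; apply/eqP=> x0; move/eqP: xr.
by rewrite x0 expr0n gtn_eqF //= eq_sym oner_eq0.
Qed.

Lemma phi_ndvd_root j x : root (phi j)^i x -> root Phi^i x.
Proof.
move=> px; have [/(_ j)/dvdpP[q ->] _] := phi_reps.
by rewrite rmorphM rootM px orbT.
Qed.

Lemma phi0_neq0 j : (phi j)`_0 != 0.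
Proof.
apply/negP=> /eqP p0; have : root (phi j)^i 0.
  by rewrite rootE horner_coef0 coef_map fmorph_eq0 p0.
by move/phi_ndvd_root/geom_poly_root_neq0; rewrite eqxx.
Qed.

Lemma phi_size j : (1 < size (phi j))%N.
Proof. by have [[]] := phi_mi j. Qed.

Lemma recip_phi_root j x : root (recip (phi j))^i x ->
  [/\ x != 0, root (phi j)^i x^-1 & x ^+ r = 1].
Proof.
move=> rx; have nzx : x != 0.
  apply/eqP=> x0; move: rx; rewrite x0 rootE horner_coef0 coef_map fmorph_eq0.
  rewrite /recip coefZ mulf_eq0 invr_eq0 (negPf (phi0_neq0 j)) /= coef_Poly.
  have sz := ltnW (phi_size j).
  rewrite nth_rev // subn1 -lead_coefE lead_coef_eq0.
  by rewrite -size_poly_leq0 leqNgt sz.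
split; rewrite // -?recip_root ?phi0_neq0 //.
move: rx; rewrite recip_root ?phi0_neq0 // => /phi_ndvd_root/geom_poly_root.
by rewrite exprVn => /eqP; rewrite invr_eq1 => /eqP.
Qed.

Lemma phi_inj j k : phi j = phi k \/ phi j = recip (phi k) -> j = k.
Proof.
move=> pjk; have [dv /(_ (phi j) (phi_mi j) (dv j))[i [_ iu]]] := phi_reps.
by rewrite -(iu j) ?(iu k) //; left.
Qed.

Lemma irr_eq (p q : {poly F}) x : irreducible_poly p -> p \is monic -> q \is monic ->
  (size q <= size p)%N -> root p^i x -> root q^i x -> p = q.
Proof.
move=> irr pm qm sz px qx; have pq := irr_dvd_root irr px qx.
apply/eqP; rewrite -eqp_monic // -dvdp_size_eqp // eqn_leq sz.
by rewrite dvdp_leq // monic_neq0.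
Qed.

Lemma phi_no_common_root j k x : j != k -> root (phi j)^i x -> root (phi k)^i x -> False.
Proof.
move=> neq pj pk; case/eqP: neq; apply: phi_inj; left.
have [irrj mj] := phi_mi j; have [irrk mk] := phi_mi k.
have dv1 := irr_dvd_root irrj pj pk; have dv2 := irr_dvd_root irrk pk pj.
by apply/eqP; rewrite -eqp_monic // /eqp dv1 dv2.
Qed.

Lemma phi_recip_no_common_root j k x : j != k ->
  root (phi j)^i x -> root (recip (phi k))^i x -> False.
Proof.
move=> neq pj pk; have [nzx pk' _] := recip_phi_root pk.
have [irrj mj] := phi_mi j; have [irrk mk] := phi_mi k.
have pj' : root (recip (phi j))^i x^-1.
  by rewrite recip_root ?phi0_neq0 ?invr_eq0 // invrK.
have dv1 := irr_dvd_root irrj pj pk; have dv2 := irr_dvd_root irrk pk' pj'.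
have nzr i : recip (phi i) != 0 by rewrite monic_neq0 // monic_recip // phi0_neq0.
have := dvdp_leq (nzr k) dv1; have := dvdp_leq (nzr j) dv2.
rewrite !size_recip ?phi0_neq0 // => le1 le2.
case/eqP: neq; apply: phi_inj; right.
by apply: (irr_eq irrj mj _ _ pj pk); rewrite ?monic_recip ?size_recip ?phi0_neq0.
Qed.

Lemma phi_recip_coprime j : phi j != recip (phi j) -> coprimep (phi j) (recip (phi j)).
Proof.
move=> neq; apply: (coprimep_no_root (iota := iota)) => x px; apply: contra neq => rx.
have [irr m] := phi_mi j.
by apply/eqP/(irr_eq irr m _ _ px rx); rewrite ?monic_recip ?size_recip ?phi0_neq0.
Qed.

(** The polynomial whose value at [zeta] has kernel the row space of [Wmx]. *)
Definition psi j := if phi j == recip (phi j) then phi j else phi j * recip (phi j).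

Lemma psi_root j x : root (psi j)^i x -> root (phi j)^i x \/ root (recip (phi j))^i x.
Proof.
by rewrite /psi; case: ifP => _; [left | rewrite rmorphM rootM => /orP].
Qed.

Lemma psi_coprime j k : j != k -> coprimep (psi j) (psi k).
Proof.
move=> neq; apply: (coprimep_no_root (iota := iota)) => x pj; apply/negP=> pk.
case: (psi_root pj) (psi_root pk) => {}pj [] {}pk.
- exact: phi_no_common_root pj pk.
- exact: phi_recip_no_common_root pj pk.
- by apply: phi_recip_no_common_root pk pj; rewrite eq_sym.
have [_ pj' _] := recip_phi_root pj; have [_ pk' _] := recip_phi_root pk.
exact: phi_no_common_root pj' pk'.
Qed.

(** The roots of [Phi] are simple, and each one is a root of some [psi j] through its minimal
    polynomial. *)
Lemma geom_dvd_psi : Phi %| \prod_j psi j.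
Proof.
rewrite -(dvdp_map iota) geom_poly_factor.
rewrite -(big_map (fun k => zr ^+ k) predT (fun z => 'X - z%:P)).
have prim_eq : {in index_iota 1 r &, injective (fun k => zr ^+ k)}.
  move=> i k; rewrite !mem_index_iota => /andP[_ lti] /andP[_ ltk] /eqP.
  by rewrite (eq_prim_root_expr zr_prim) !modn_small // => /eqP.
apply: uniq_roots_dvdp; last by rewrite uniq_rootsE map_inj_in_uniq ?iota_uniq.
apply/allP=> z z_in; have Pz : root Phi^i z.
  rewrite geom_poly_factor -(big_map (fun k => zr ^+ k) predT (fun z => 'X - z%:P)).
  by rewrite root_prod_XsubC.
have nzP : Phi != 0.
  by rewrite -(map_poly_eq0 iota) geom_poly_factor monic_neq0 // monic_prod_XsubC.
have [m m_mi mz] := min_poly_ex nzP Pz; have [irr _] := m_mi.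
have [_ /(_ m m_mi (irr_dvd_root irr mz Pz))[j [mj _]]] := phi_reps.
rewrite (bigD1 j) //= rmorphM rootM /psi; apply/orP; left.
case: eqP mj => [<- [] <- // | _ [] mj]; rewrite rmorphM rootM -mj mz ?orbT //.
Qed.

End Reps.

(** * Decomposition of the space *)

Section KernelRank.
Variables (F : finFieldType) (d : nat) (Z : 'M[F]_d.+1) (K : finFieldType) (n : nat).
Variables (p : {poly F}) (ev : {rmorphism {poly F} -> K}) (rep : K -> {poly F}).
Variable e : 'rV[K]_n.+1 -> 'rV[F]_d.+1.
Hypothesis mdl : kernel_model Z p ev rep e.

Lemma kernel_rank : #|K| = (#|F| ^ (size p).-1)%N ->
  \rank (kermx (horner_mx Z p)) = (n.+1 * (size p).-1)%N.
Proof.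
move=> cardK; have := card_rowg (kermx (horner_mx Z p)).
have -> : rowg (kermx (horner_mx Z p)) = [set e v | v in [set: 'rV[K]_n.+1]].
  apply/setP=> u; rewrite inE; apply/idP/imsetP=> [/sub_kermxP/(model_sur mdl)[v <-] | [v _ ->]].
    by exists v.
  exact/sub_kermxP/(e_ker mdl).
rewrite card_imset ?cardsT ?card_mx ?mul1n; last exact: model_inj mdl.
by rewrite cardK -expnM mulnC => /eqP; rewrite eqn_exp2l ?finRing_gt1 // => /eqP.
Qed.

End KernelRank.

Section Duality.
Variables (F : finFieldType) (d : nat) (J Z : 'M[F]_d.+1).
Hypotheses (J_unit : J \in unitmx) (J_skew : J^T = - J) (ZJ : Z *m dag J Z = 1%:M).

Lemma rank_dag X : \rank (dag J X) = \rank X.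
Proof.
rewrite /dag mxrankMfree ?row_free_unit ?unitmx_inv // -mxrank_tr trmx_mul trmxK.
by rewrite mxrankMfree // row_free_unit unitmx_tr.
Qed.

(** The adjoint of [Z] is its inverse, so the adjoint of p(Z) is p evaluated at the inverse: the
    reciprocal polynomial at [Z], up to a constant and a power of the inverse. *)
Lemma dag_recip (p : {poly F}) : p`_0 != 0 -> exists V, [/\ V \in unitmx,
  dag J (horner_mx Z p) = V *m horner_mx Z (recip p) & comm_mx V Z].
Proof.
move=> p0; exists (p`_0 *: dag J Z ^+ (size p).-1).
have uV : dag J Z \is a GRing.unit by have [] := mulmx1_unit ZJ.
split; first by rewrite unitmxZ ?unitfE //; apply: unitrX.
  rewrite (dag_horner J_unit p (erefl _)).
  have fg : horner_mx (dag J Z) 'X * horner_mx Z 'X = 1.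
    by rewrite !horner_mx_X; apply: mulmx1C.
  have := rev_poly_morph p fg (fun c => etrans (horner_mx_C _ c) (esym (horner_mx_C _ c))).
  rewrite /= horner_mx_X => <-; rewrite /recip linearZ -scalemxAl -scalemxAr scalerA.
  by rewrite mulfV // scale1r.
rewrite /comm_mx -scalemxAl -scalemxAr; congr (_ *: _).
by apply/esym/commrX; rewrite /GRing.comm -!mulmxE ZJ (mulmx1C ZJ).
Qed.

Lemma rank_ker_recip (p : {poly F}) : p`_0 != 0 ->
  \rank (kermx (horner_mx Z (recip p))) = \rank (kermx (horner_mx Z p)).
Proof.
move=> /dag_recip[V [uV Vp _]]; rewrite !mxrank_ker -[\rank (horner_mx Z p)]rank_dag Vp.
by rewrite (eqmxMfull _ _) ?row_full_unit.
Qed.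

Lemma ker_coprime0 (p q : {poly F}) (u : 'rV_d.+1) X : coprimep p q -> comm_mx X Z ->
  u *m horner_mx Z p = 0 -> u *m X *m horner_mx Z q = 0 -> u *m X = 0.
Proof.
move=> cpq cX up uXq; have uXp : u *m X *m horner_mx Z p = 0.
  by rewrite -mulmxA (comm_mx_horner p cX) mulmxA up mul0mx.
have := mxdirect_kermxpoly Z cpq => /eqP; rewrite -submx0 => dpq.
apply: submx0null; apply: submx_trans dpq.
by rewrite sub_capmx; apply/andP; split; apply/sub_kermxP.
Qed.

Lemma dag_pi_recip (p c : {poly F}) : p`_0 != 0 -> horner_mx Z c *m horner_mx Z p = 0 ->
  dag J (horner_mx Z c) *m horner_mx Z (recip p) = 0.
Proof.
move=> /dag_recip[V [uV Vp cV]] cp.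
have cpi : comm_mx (dag J (horner_mx Z c)) Z.
  by apply: (dag_comm J_unit ZJ); apply: comm_horner_mx.
have := congr1 (mulmx (invmx V)) (congr1 (dag J) cp).
rewrite dagM // Vp -mulmxA mulKmx // => E.
by rewrite (comm_mx_horner _ cpi) E /dag trmx0 !(mulmx0, mul0mx).
Qed.

End Duality.

Section Decomposition.
Variables (F : finFieldType) (L : closedFieldType) (iota : {rmorphism F -> L}).
Variables (r : nat) (zr : L) (t : nat) (phi : 'I_t -> {poly F}).
Hypotheses (r_gt0 : (0 < r)%N) (zr_prim : r.-primitive_root zr).
Hypothesis phi_mi : forall j, monic_irreducible_poly (phi j).
Hypothesis phi_reps : factor_reps (geom_poly F r) phi.
Variables (d : nat) (J : 'M[F]_d.+1) (zeta : {'GL_d.+1[F]}) (n : nat).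
Local Notation Z := (GLval zeta).
Hypotheses (J_unit : J \in unitmx) (J_skew : J^T = - J) (ZJ : Z *m dag J Z = 1%:M).
Hypothesis dim_d : d.+1 = (n.+1 * (r - 1))%N.
Hypothesis rank_phi : forall j,
  \rank (kermx (horner_mx Z (phi j))) = (n.+1 * (size (phi j)).-1)%N.

Local Notation psi := (psi phi).
Let phi0 := phi0_neq0 iota r_gt0 phi_reps.
Let psi_cop := psi_coprime iota r_gt0 phi_mi phi_reps.

Lemma psi_neq0 j : psi j != 0.
Proof.
rewrite /psi; have [_ m] := phi_mi j; case: ifP => _; rewrite ?mulf_neq0 ?monic_neq0 //.
by rewrite monic_recip.
Qed.

Lemma Wmx_psi j : (Wmx zeta phi j :=: kermxpoly Z (psi j))%MS.
Proof.
rewrite /Wmx /psi; case: eqP => [<- | /eqP neq]; first exact: addsmx_idPl.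
apply/eqmx_sym/(kermxpolyM Z (phi_recip_coprime iota r_gt0 phi_mi phi_reps neq)).
Qed.

Lemma rank_psi j : \rank (kermxpoly Z (psi j)) = (n.+1 * (size (psi j)).-1)%N.
Proof.
rewrite /psi; case: eqP => [_ | /eqP neq]; first exact: rank_phi.
have cop := phi_recip_coprime iota r_gt0 phi_mi phi_reps neq.
have m := (phi_mi j).2; have nz : phi j != 0 by rewrite monic_neq0.
have nzr : recip (phi j) != 0 by rewrite monic_neq0 // monic_recip.
rewrite (kermxpolyM Z cop) mxrank_disjoint_sum; last exact: mxdirect_kermxpoly.
have rk : \rank (kermxpoly Z (recip (phi j))) = (n.+1 * (size (phi j)).-1)%N.
  exact: etrans (rank_ker_recip J_unit ZJ (phi0 j)) (rank_phi j).
rewrite rk rank_phi size_mul // size_recip // -mulnDr; congr (_ * _)%N.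
have : (0 < size (phi j))%N by rewrite size_poly_gt0.
by case: (size _) => // k _; rewrite addnS.
Qed.

Lemma size_geom : size (geom_poly F r) = r.
Proof.
rewrite -(size_map_poly iota) (geom_poly_factor iota r_gt0 zr_prim).
by rewrite -(big_map (fun k => zr ^+ k) predT (fun z => 'X - z%:P)) size_prod_XsubC size_map size_iota subn1 prednK.
Qed.

(* Each U_j has dimension n over K_j, so the kernels of the coprime psi_j already
   have total rank at least n (r - 1), the dimension of the space. *)
Lemma psi_prod_full : (1%:M <= kermxpoly Z (\prod_j psi j)%R)%MS.
Proof.
have le_d : (d.+1 <= n.+1 * (r - 1))%N by rewrite -dim_d.
rewrite sub1mx -col_leq_rank; apply: leq_trans le_d _.
have cop : {in predT &, forall i j, j != i -> coprimep (psi i) (psi j)}.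
  by move=> i j _ _; rewrite eq_sym; apply: psi_cop.
rewrite (kermxpoly_prod Z cop) (mxdirectP (mxdirect_sum_kermx Z cop)) /=.
under eq_bigr do rewrite rank_psi.
rewrite -big_distrr /= leq_mul2l /=.
have nzP : \prod_j psi j != 0 by apply/prodf_neq0=> j _; apply: psi_neq0.
have := dvdp_leq nzP (geom_dvd_psi iota r_gt0 zr_prim phi_reps).
rewrite size_geom size_prod; last by move=> j _; apply: psi_neq0.
have -> : (\sum_j size (psi j) = \sum_j (size (psi j)).-1 + #|'I_t|)%N.
  rewrite -sum1_card -big_split; apply: eq_bigr => j _ /=.
  by rewrite addn1 prednK // size_poly_gt0 psi_neq0.
by rewrite -addSn addnK subn1 => /(leq_sub2r 1); rewrite !subn1.
Qed.

Lemma Wmx_full : (1%:M <= \sum_j Wmx zeta phi j)%MS.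
Proof.
apply: submx_trans psi_prod_full _.
have cop : {in predT &, forall i j, j != i -> coprimep (psi i) (psi j)}.
  by move=> i j _ _; rewrite eq_sym; apply: psi_cop.
rewrite (kermxpoly_prod Z cop); apply/sumsmx_subP=> j _.
by apply: (sumsmx_sup j) => //; rewrite Wmx_psi.
Qed.

(** The product of all [psi] vanishes at [Z], and [phi j] is coprime to its cofactor [Q] there; a
    Bezout multiple of [Q] is the idempotent. *)
Lemma idempotent_poly j : exists2 c, phi j %| c - 1 & horner_mx Z c *m horner_mx Z (phi j) = 0.
Proof.
pose Q := (if phi j == recip (phi j) then 1 else recip (phi j)) * \prod_(k | k != j) psi k.
have PE : \prod_k psi k = phi j * Q.
  by rewrite (bigD1 j) //= {1}/psi /Q; case: ifP => _; rewrite ?mul1r ?mulrA.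
have cop : coprimep (phi j) Q.
  rewrite /Q coprimepMr; apply/andP; split.
    by case: eqP => [_ | /eqP]; [exact: coprimep1 | exact: (phi_recip_coprime iota r_gt0)].
  rewrite (big_morph (coprimep (phi j)) (coprimepMr _) (coprimep1 _)) big_all_cond.
  apply/allP=> k _; apply/implyP=> neq.
  have := psi_cop neq; rewrite coprimep_sym {1}/psi.
  by case: ifP => // _; rewrite coprimepMl => /andP[].
have /Bezout_eq1_coprimepP[[u v] /= uv] := cop.
exists (v * Q); first by rewrite -uv opprD addrCA subrr addr0 dvdpNr dvdp_mull.
have : horner_mx Z (\prod_k psi k) = 0.
  by have /sub_kermxP := psi_prod_full; rewrite mul1mx.
by rewrite PE !mulmxE -rmorphM -mulrA [Q * _]mulrC rmorphM => /= ->; rewrite mulr0.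
Qed.

Variables (j : 'I_t) (c : {poly F}).
Local Notation pi := (horner_mx Z c).
Local Notation pi' := (dag J pi).
Hypotheses (c1 : phi j %| c - 1) (cp : pi *m horner_mx Z (phi j) = 0).

Let comm_pi : comm_mx pi Z. Proof. exact: comm_horner_mx. Qed.
Let comm_pi' : comm_mx pi' Z. Proof. exact: (dag_comm J_unit ZJ). Qed.

Lemma Wmx_pi k (u : 'rV_d.+1) : k != j -> (u <= Wmx zeta phi k)%MS ->
  u *m pi = 0 /\ u *m pi' = 0.
Proof.
move=> neq; rewrite Wmx_psi => /sub_kermxP u0.
have cop := psi_cop neq.
have copj : coprimep (psi k) (phi j).
  by move: cop; rewrite {2}/psi; case: ifP => // _; rewrite coprimepMr => /andP[].
have copr : coprimep (psi k) (recip (phi j)).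
  move: cop; rewrite {2}/psi; case: eqP => [<- // | _].
  by rewrite coprimepMr => /andP[].
split.
  by apply: (ker_coprime0 copj comm_pi u0); rewrite -mulmxA cp mulmx0.
apply: (ker_coprime0 copr comm_pi' u0).
by rewrite -mulmxA (dag_pi_recip J_unit ZJ) ?mulmx0.
Qed.

Lemma pi_pi'_neq : phi j != recip (phi j) -> pi *m pi' = 0 /\ pi' *m pi = 0.
Proof.
move=> neq; have cop := phi_recip_coprime iota r_gt0 phi_mi phi_reps neq.
have pp' : pi *m pi' = 0.
  apply: mx_act_inj => u; rewrite mulmx0 mulmxA.
  apply: (ker_coprime0 cop comm_pi'); first by rewrite -mulmxA cp mulmx0.
  by rewrite -(mulmxA (u *m pi)) (dag_pi_recip J_unit ZJ) ?mulmx0.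
by split=> //; rewrite (comm_mx_horner c comm_pi').
Qed.

Lemma pi_pi'_eq : phi j = recip (phi j) -> pi' = pi.
Proof.
move=> eq_r; have p'p : pi' *m pi = pi'.
  apply: mx_act_inj => u; rewrite mulmxA (pi_fix c1) // -mulmxA eq_r.
  by rewrite (dag_pi_recip J_unit ZJ) ?mulmx0.
by have := congr1 (dag J) p'p; rewrite dagM // dagK // p'p.
Qed.

(** Triviality on U_j passes to the dual summand: taking adjoints in [pi *m A = pi], with [A] an
    isometry commuting with [pi'], gives [pi' *m A = pi']. *)
Lemma Wmx_fix (A : 'M[F]_d.+1) : comm_mx A Z -> A *m dag J A = 1%:M ->
  (forall u : 'rV_d.+1, u *m horner_mx Z (phi j) = 0 -> u *m A = u) ->
  Wmx zeta phi j *m A = Wmx zeta phi j.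
Proof.
move=> cA AA fixA; apply/row_matrixP=> i; rewrite row_mul.
have : (row i (Wmx zeta phi j) <= Wmx zeta phi j)%MS by apply: row_sub.
move: (row i _) => u /sub_addsmxP[[u1 u2] /= ->]; rewrite mulmxDl; congr (_ + _).
  by rewrite fixA // -mulmxA mulmx_ker mulmx0.
set w := u2 *m _; have w0 : w *m horner_mx Z (recip (phi j)) = 0.
  by rewrite -mulmxA mulmx_ker mulmx0.
have piA : pi *m A = pi.
  by apply: mx_act_inj => v; rewrite mulmxA fixA // -mulmxA cp mulmx0.
have pi'A : pi' *m A = pi'.
  have /(congr1 (mulmx A)) : dag J A *m pi' = pi' by rewrite -dagM // piA.
  have cAp : pi' *m A = A *m pi'.
    have := congr1 (dag J) (comm_mx_horner c (dag_comm J_unit ZJ cA)).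
    by rewrite (dagM J_unit (dag J A)) (dagM J_unit pi) dagK.
  by rewrite cAp mulmxA AA mul1mx => <-.
have [V [uV Vp cV]] := dag_recip J_unit ZJ (phi0 j).
have wpi' : w *m pi' = w.
  have /dvdpP[q cq] := c1; have -> : c = q * phi j + 1 by rewrite -cq subrK.
  rewrite rmorphD rmorphM rmorph1 /= dagD dag1 // mulmxDr mulmx1 -mulmxE dagM // Vp.
  by rewrite (comm_mx_horner _ cV) !mulmxA w0 !mul0mx add0r.
by rewrite -wpi' -mulmxA pi'A.
Qed.

End Decomposition.

(** * Images of the centralizer *)

Definition classical_group (K : finFieldType) n (G : {set GLfin K n}) : Prop :=
  G = [set: GLfin K n] \/
  exists (s : {rmorphism K -> K}) (M : 'M[K]_n.+1) (e : K),
    [/\ involutive s, s e = - e, e != 0, (map_mx s M)^T = - M & M \in unitmx /\ G = GU s M].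

Section Classical.
Variables (K : finFieldType) (n : nat) (G : {group GLfin K n}).
Hypotheses (n_ge3 : (3 <= n)%N) (two : 2%:R != 0 :> K) (clG : classical_group G).
Local Open Scope group_scope.

Lemma classical_der_perfect : G^`(1) \subset [~: G^`(1), G^`(1)].
Proof.
case: clG => [-> | [s [M [e [sK se nze Msk [Mu ->]]]]]]; first exact: GL_der_perfect.
exact: (GU_der_perfect sK two se nze).
Qed.

Lemma classical_normal_dichotomy (N : {group GLfin K n}) : N \subset G ->
  G^`(1) \subset 'N(N) -> N \subset scalar_GL K n \/ G^`(1) \subset N.
Proof.
case: clG => [-> _ | [s [M [e [sK se nze Msk [Mu ->]]]]]]; first exact: GL_normal_dichotomy.
exact: (GU_normal_dichotomy sK two se nze).
Qed.

Lemma classical_root_subgroup l (iota : {rmorphism 'F_l -> K}) (tau : GLfin K n)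
    (lam : K) (a : 'rV[K]_n.+1) (f : 'cV[K]_n.+1) (m : {poly 'F_l}) :
  l \in [pchar K] -> tau \in G -> lam != 1%R -> lam != 0%R -> a *m f = (lam - 1)%:M ->
  GLval tau = (1%:M + f *m a)%R -> root (map_poly iota m) lam ->
  exists Q : {group GLfin K n}, Q \subset G^`(1) /\ root_subgroup tau m Q.
Proof.
move=> l_char Gtau lam1 lam0 af tauE mlam.
case: clG => [-> | [s [M [e [sK se nze Msk [Mu GE]]]]]].
  exact: (GL_root_subgroup l_char n_ge3 lam1 af tauE mlam).
rewrite GE in Gtau *.
by apply: (GU_root_subgroup l_char n_ge3 lam1 af tauE mlam) Gtau; eassumption.
Qed.

End Classical.

Section LocalFactor.
Variables (F : finFieldType) (d : nat) (J : 'M[F]_d.+1) (zeta : {'GL_d.+1[F]}).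
Local Notation Z := (GLval zeta).
Local Notation C := ('C_(Sp J)[zeta])%g.
Variables (K : finFieldType) (n : nat).
Variables (p : {poly F}) (ev : {rmorphism {poly F} -> K}) (rep : K -> {poly F}).
Variable e : 'rV[K]_n.+1 -> 'rV[F]_d.+1.
Hypothesis mdl : kernel_model Z p ev rep e.
Hypotheses (J_unit : J \in unitmx) (J_skew : J^T = - J) (ZJ : Z *m dag J Z = 1%:M).

Lemma Sp_centP (A : {'GL_d.+1[F]}) :
  reflect (comm_mx (GLval A) Z /\ GLval A *m dag J (GLval A) = 1%:M) (A \in C).
Proof.
rewrite inE inE dag_unitary //; apply: (iffP andP) => [[/eqP AA cA] | [cA ->]].
  split=> //; have := cent1P cA => /(congr1 (@GLval _ _)).
  exact.
split; rewrite ?eqxx //; apply/cent1P; exact: val_inj.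
Qed.

Definition rho_fun (A : {'GL_d.+1[F]}) : GLfin K n := toGL (rho_mx e (GLval A)).

Lemma rho_funE A : A \in C -> GLval (rho_fun A) = rho_mx e (GLval A).
Proof.
move=> /Sp_centP[cA AA]; rewrite toGLK //.
have cAi : comm_mx (dag J (GLval A)) Z by apply: (dag_comm J_unit ZJ).
have := rho_mxM mdl cA cAi; rewrite AA (rho_mx1 mdl) => /esym/mulmx1_unit[] //.
Qed.

Lemma rho_funM : {in C &, {morph rho_fun : A B / (A * B)%g >-> (A * B)%g}}.
Proof.
move=> A B CA CB; apply: GL_inj; rewrite GLM !rho_funE ?groupM //.
have [cA _] := Sp_centP _ CA; have [cB _] := Sp_centP _ CB.
exact: (rho_mxM mdl cA cB).
Qed.
Canonical rho_morph : {morphism C >-> GLfin K n} := Morphism rho_funM.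

Lemma rho_fun_mx (A : {'GL_d.+1[F]}) (a : 'M[K]_n.+1) : A \in C ->
  (forall v, e v *m GLval A = e (v *m a)) -> GLval (rho_fun A) = a.
Proof. by move=> CA Aa; have [cA _] := Sp_centP _ CA; rewrite rho_funE //; apply: (rho_mx_uniq mdl). Qed.

Lemma e_rho (A : {'GL_d.+1[F]}) v : A \in C -> e (v *m GLval (rho_fun A)) = e v *m GLval A.
Proof. by move=> CA; have [cA _] := Sp_centP _ CA; rewrite rho_funE //; apply: (rho_mxE mdl). Qed.

Variable c : {poly F}.
Local Notation pi := (horner_mx Z c).
Local Notation pi' := (dag J pi).
Hypotheses (c1 : p %| c - 1) (cp : pi *m horner_mx Z p = 0).

Definition fixes_complement (A : {'GL_d.+1[F]}) :=
  forall u : 'rV_d.+1, u *m pi = 0 -> u *m pi' = 0 -> u *m GLval A = u.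

Lemma unitary_cent (X : 'M[F]_d.+1) : comm_mx X Z -> X *m dag J X = 1%:M ->
  exists2 A, A \in C & GLval A = X.
Proof.
move=> cX XX; have uX : X \in unitmx by have [] := mulmx1_unit XX.
by exists (insubd (1%g : {'GL_d.+1[F]}) X); [apply/Sp_centP | ]; rewrite insubdK.
Qed.

Lemma local_GL : pi *m pi' = 0 /\ pi' *m pi = 0 ->
  forall a : GLfin K n, exists A, [/\ A \in C, rho_fun A = a & fixes_complement A].
Proof.
case=> pp' p'p a; have ua : GLval a \in unitmx := valP a.
pose X := paired_lift J Z e c (GLval a).
have [A CA AX] : exists2 A, A \in C & GLval A = X.
  apply: unitary_cent; first exact: (paired_lift_comm mdl J_unit ZJ).
  exact: (paired_lift_dag mdl J_unit J_skew c1 cp).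
exists A; split=> //.
  by apply: GL_inj; rewrite rho_funE // AX (paired_lift_rho mdl J_unit ZJ c1 cp).
by move=> u; rewrite AX; apply: (paired_lift_fix mdl J_unit c1 cp).
Qed.

Hypotheses (nz_p : p != 0) (cardK : #|K| = (#|F| ^ (size p).-1)%N).
Variable theta0 : K -> F.
Hypotheses (t0D : {morph theta0 : a b / a + b}) (t01 : theta0 1 = 1).
Hypothesis t0Z : forall k a, theta0 (ev k%:P * a) = k * theta0 a.
Hypothesis two : 2%:R != 0 :> F.
Hypothesis p0 : p`_0 != 0.

Lemma local_GU : recip p = p -> pi' = pi -> ev 'X ^+ 2 != 1 ->
  exists (s : {rmorphism K -> K}) (M : 'M[K]_n.+1) (x : K),
    [/\ involutive s, s x = - x, x != 0, (map_mx s M)^T = - M & M \in unitmx /\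
      (forall A, A \in C -> rho_fun A \in GU s M) /\
      (forall a, a \in GU s M -> exists A, [/\ A \in C, rho_fun A = a & fixes_complement A])].
Proof.
move=> rp pi_dag X2.
have [s sX sC] := ev_involution (model_evrep mdl) (model_ev0 mdl) p0 rp.
have sK := ev_involutionK (model_evrep mdl) sX sC.
have [M Msk gramM] := hermitian_gram mdl J_unit J_skew ZJ sX sC nz_p cardK t0D t01 t0Z two.
have Xs : ev 'X * s (ev 'X) = 1 by rewrite mulrC.
(* The skew element is X - 1/X, nonzero because X^2 is not 1. *)
exists s, M, (ev 'X - s (ev 'X)); split=> //.
- by rewrite rmorphB sK opprB.
- apply: contra X2; rewrite subr_eq0 => /eqP XX.
  by rewrite expr2 {2}XX Xs.
split; first exact: (gram_unit mdl J_unit sC t0Z c1 cp pi_dag gramM).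
split=> [A CA | a /(GU_beta t0D t01 two gramM) ga].
  apply/(GU_beta t0D t01 two gramM) => v w; rewrite /beta !e_rho //.
  have [_ /eqP] := Sp_centP _ CA; rewrite -dag_unitary // => /eqP AA.
  by rewrite trmx_mul !mulmxA -2!(mulmxA (e v)) AA.
pose X := unitary_lift Z e c (GLval a).
have [A CA AX] : exists2 A, A \in C & GLval A = X.
  apply: unitary_cent; first exact: (unitary_lift_comm mdl).
  apply: (unitary_lift_dag mdl J_unit c1 cp pi_dag) => v w.
  by rewrite !(betaE J) ga.
exists A; split=> //.
  by apply: GL_inj; rewrite rho_funE // AX (unitary_lift_rho mdl c1 cp).
by move=> u u0 _; rewrite AX (unitary_lift_fix mdl c1 cp).
Qed.

End LocalFactor.

(** * Common eigenvalues *)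

Lemma krylov (K : fieldType) d (v : 'rV[K]_d.+1) (T : 'M[K]_d.+1) k (p : {poly K}) :
  (size p <= k)%N -> v *m horner_mx T p = poly_rV p *m \matrix_(i < k) (v *m T ^+ i).
Proof.
move=> szp; have -> : p = \sum_(i < k) p`_i *: 'X^i.
  rewrite -poly_def; apply/polyP=> i; rewrite coef_poly; case: ltnP => // le_i.
  by rewrite nth_default // (leq_trans szp).
set q := \sum_(i < k) _; have qE i : (i < k)%N -> q`_i = p`_i.
  by move=> lti; rewrite /q -poly_def coef_poly lti.
rewrite [RHS]mulmx_sum_row {1}/q linear_sum mulmx_sumr /=; apply: eq_bigr => i _.
rewrite mxE qE // rowK linearZ rmorphXn /= horner_mx_X.
by rewrite -scalemxAr.
Qed.

Section ClosedEigenvector.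
Variables (F : finFieldType) (L : closedFieldType) (iota : {rmorphism F -> L}).
Variables (d : nat) (T : 'M[F]_d.+1).
Local Notation "p ^i" := (map_poly iota p) (at level 2, format "p ^i").
Local Notation "A ^m" := (map_mx iota A) (at level 2, format "A ^m").

(** Write m = q (X - mu) over [L] and take w = v q(T). It is nonzero because v, v T, v T^2, ... are
    independent below the degree of the irreducible [m]. The last clause lets [w] inherit
    annihilation by polynomials in [Z]. *)
Lemma closed_eigenvector (v : 'rV[F]_d.+1) (m : {poly F}) mu :
  v != 0 -> irreducible_poly m -> v *m horner_mx T m = 0 -> root m^i mu ->
  exists w : 'rV[L]_d.+1, [/\ w != 0, w *m T^m = mu *: w
    & forall B, comm_mx B T -> v *m B = 0 -> w *m B^m = 0].
Proof.
move=> nzv irr vm mmu; have [q mE] := factor_theorem _ _ mmu.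
have nzm : m^i != 0 by rewrite map_poly_eq0; case: irr => + _; case: eqP => // ->; rewrite size_poly0.
have nzq : q != 0 by apply: contra nzm => /eqP q0; rewrite mE q0 mul0r.
pose k := (size m).-1; have szq : (size q <= k)%N.
  by rewrite /k -(size_map_poly iota) mE size_Mmonic ?monicXsubC // size_XsubC addn2.
pose V := \matrix_(i < k) (v *m T ^+ i).
have rowV : row_free V.
  rewrite -kermx_eq0; apply/eqP/row_matrixP=> i; rewrite row0.
  have uV : row i (kermx V) *m V = 0 by apply/sub_kermxP; rewrite row_sub.
  move: (row i _) uV => u uV; pose p := rVpoly u.
  have szp : (size p <= k)%N by apply: size_poly.
  have vp : v *m horner_mx T p = 0 by rewrite (krylov _ _ szp) rVpolyK uV.
  apply: (can_inj rVpolyK); rewrite linear0; apply/eqP; apply/negP=> /negP nzp.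
  have cop : coprimep m p.
    rewrite irreducible_poly_coprime //; apply/negP=> /(dvdp_leq nzp).
    rewrite leqNgt (leq_ltn_trans szp) // /k prednK //.
    by case: irr => /ltnW.
  case/eqP: nzv; rewrite -[v]mulmx1.
  by apply: (ker_coprime0 (Z := T) cop); rewrite ?mulmx1 //; apply: comm1mx.
have VE : V^m = \matrix_(i < k) (v^m *m T^m ^+ i).
  by apply/row_matrixP=> i; rewrite -map_row !rowK map_mxM rmorphXn.
have wE : v^m *m horner_mx T^m q = poly_rV q *m V^m by rewrite (krylov _ _ szq) VE.
exists (v^m *m horner_mx T^m q); split.
- rewrite wE; apply/negP=> /eqP w0; case/negP: nzq; apply/eqP.
  have freeV : row_free V^m by rewrite row_free_map.
  have /(row_free_inj freeV) : poly_rV q *m V^m = 0 *m V^m by rewrite w0 mul0mx.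
  by move/(congr1 rVpoly); rewrite poly_rV_K // linear0.
- have : v^m *m horner_mx T^m m^i = 0 by rewrite -map_horner_mx -map_mxM vm map_mx0.
  rewrite mE rmorphM rmorphB /= horner_mx_X horner_mx_C -mulmxE mulmxA mulmxBr mul_mx_scalar.
  by move/eqP; rewrite subr_eq0 => /eqP.
move=> B cB vB; have cB' : comm_mx B^m T^m by rewrite /comm_mx -!map_mxM cB.
by rewrite -mulmxA -(comm_mx_horner q cB') mulmxA -map_mxM vB map_mx0 mul0mx.
Qed.

(** The two eigenvectors over [L] lie in kernels of coprime polynomials in [Z], so they are
    independent and [mu] is a multiple root. *)
Lemma common_eigenvalue_dvd (Z : 'M[F]_d.+1) (a b m : {poly F}) (v w : 'rV[F]_d.+1) mu :
  comm_mx T Z -> coprimep a b -> irreducible_poly m -> root m^i mu ->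
  v != 0 -> v *m horner_mx Z a = 0 -> v *m horner_mx T m = 0 ->
  w != 0 -> w *m horner_mx Z b = 0 -> w *m horner_mx T m = 0 ->
  ('X - mu%:P) ^+ 2 %| (char_poly T)^i.
Proof.
move=> cTZ cab irr mmu nzv va vm nzw wb wm.
have cZ q : comm_mx (horner_mx Z q) T by apply/comm_mx_sym/comm_mx_horner.
have [x [nzx xT xB]] := closed_eigenvector nzv irr vm mmu.
have [y [nzy yT yB]] := closed_eigenvector nzw irr wm mmu.
have xa : x *m horner_mx Z^m a^i = 0 by rewrite -map_horner_mx xB.
have yb : y *m horner_mx Z^m b^i = 0 by rewrite -map_horner_mx yB.
have xy0 : (x :&: y = 0)%MS.
  apply/eqP; rewrite -submx0; apply: (submx_trans (B := (kermxpoly Z^m a^i :&: kermxpoly Z^m b^i)%MS)).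
    by apply: capmxS; apply/sub_kermxP.
  by rewrite mxdirect_kermxpoly ?coprimep_map.
have free_xy : row_free (col_mx x y).
  by rewrite /row_free -addsmxE mxrank_disjoint_sum // !rank_rV nzx nzy.
rewrite map_char_poly; apply: contraTT isT => ndv.
suff : (1 + 1 <= 1)%N by [].
by apply: (eigen_mult_le1 free_xy _ ndv); rewrite mul_col_mx xT yT scale_col_mx.
Qed.

End ClosedEigenvector.

Section DualEigenvector.
Variables (F : finFieldType) (d : nat) (J Z T : 'M[F]_d.+1).
Hypotheses (J_unit : J \in unitmx) (J_skew : J^T = - J) (ZJ : Z *m dag J Z = 1%:M).
Hypotheses (cTZ : comm_mx T Z) (TJ : T *m dag J T = 1%:M).
Variables (p c m : {poly F}).
Local Notation pi := (horner_mx Z c).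
Hypotheses (p0 : p`_0 != 0) (c1 : p %| c - 1) (cp : pi *m horner_mx Z p = 0).

(* The adjoint of a singular endomorphism is singular, so an eigenvalue of the
   adjoint of T on the kernel of p(Z) gives one of T on the dual kernel. *)
Lemma dual_eigenvector (v : 'rV[F]_d.+1) : v != 0 -> v *m pi = v ->
  v *m horner_mx (dag J T) m = 0 ->
  exists w : 'rV[F]_d.+1, [/\ w != 0, w *m horner_mx Z (recip p) = 0 & w *m horner_mx T m = 0].
Proof.
move=> nzv vpi vm; have pp : v *m (1%:M - pi) = 0 by rewrite mulmxBr mulmx1 vpi subrr.
pose Y := 1%:M - pi + horner_mx (dag J T) m *m pi.
have vY : v *m Y = 0 by rewrite mulmxDr pp mulmxA vm mul0mx addr0.
have nuY : Y \notin unitmx.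
  by apply: contra nzv => uY; apply/eqP; rewrite -(mulmxK uY v) vY mul0mx.
have dY : dag J Y = 1%:M - dag J pi + dag J pi *m horner_mx T m.
  by rewrite !(dagD, dagN) dag1 // dagM // (dag_horner J_unit m (dagK J_unit J_skew T)).
have nudY : dag J Y \notin unitmx.
  by move: nuY; rewrite -!row_free_unit /row_free rank_dag.
have [w nzw wY] : exists2 w : 'rV_d.+1, w != 0 & w *m dag J Y = 0.
  move: nudY; rewrite -row_free_unit -kermx_eq0 => /rowV0Pn[w /sub_kermxP w0 nzw].
  by exists w.
have cpi : comm_mx (dag J pi) T.
  have cTdZ : comm_mx T (dag J Z) by apply/comm_mx_sym/(dag_comm J_unit TJ)/comm_mx_sym.
  rewrite (dag_horner J_unit c (erefl _)).
  by apply: comm_horner_mx; apply/comm_mx_sym.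
have pipi : dag J pi *m dag J pi = dag J pi by rewrite -dagM // (pi_idem c1 cp).
have cpm := comm_mx_horner m cpi.
have wm : w *m dag J pi *m horner_mx T m = 0.
  have := congr1 (mulmx^~ (dag J pi)) wY; rewrite mul0mx dY => <-.
  rewrite -(mulmxA w) -(mulmxA w) mulmxDl mulmxBl mul1mx pipi subrr add0r.
  by rewrite -(mulmxA (dag J pi)) -cpm (mulmxA (dag J pi) (dag J pi)) pipi.
have wpi : w *m dag J pi = w.
  move: wY; rewrite dY mulmxDr mulmxBr mulmx1 mulmxA wm addr0.
  by move/eqP; rewrite subr_eq0 => /eqP<-.
exists w; split=> //; last by rewrite -wpi wm.
by rewrite -wpi -mulmxA (dag_pi_recip J_unit ZJ) ?mulmx0.
Qed.
End DualEigenvector.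

(** * Quotient fields *)

Section QuotientField.
Variables (F : finFieldType) (p : {poly F}) (p_mi : monic_irreducible_poly p).
Local Notation K := {poly %/ p with p_mi}.

Definition quo_rep (a : K) : {poly F} := a.
Definition quo : {rmorphism {poly F} -> K} := in_qpoly p.

Lemma quo_repE q : quo_rep (quo q) = q %% p.
Proof.
rewrite /quo_rep /= mk_monicE // Pdiv.IdomainMonic.modpE //; exact: p_mi.2.
Qed.

Lemma quo_rep_size a : (size (quo_rep a) < size p)%N.
Proof. by apply: leq_trans (size_mk_monic (a : {poly %/ p})) _; rewrite mk_monicE. Qed.

Lemma quo_repK : cancel quo_rep quo.
Proof. by move=> a; apply: val_inj; rewrite [LHS]quo_repE modp_small // quo_rep_size. Qed.

Lemma quo_eq0 q : (quo q == 0) = (p %| q).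
Proof.
rewrite /dvdp -quo_repE; apply/eqP/eqP=> [-> // | q0]; exact: val_inj.
Qed.

(** The constant coefficient of the reduced representative is the F-linear functional from which the
    unitary form is built. *)
Lemma quo_coef0D : {morph (fun a => (quo_rep a)`_0) : a b / a + b}.
Proof. by move=> a b; rewrite -coefD. Qed.

Lemma quo_coef0_1 : (quo_rep 1)`_0 = 1.
Proof. by rewrite /quo_rep /= coefC. Qed.

Lemma quo_coef0Z k a : (quo_rep (quo k%:P * a))`_0 = k * (quo_rep a)`_0.
Proof.
rewrite -[a]quo_repK -rmorphM quo_repE quo_repE mul_polyC modpZl coefZ //.
Qed.

Variables (d : nat) (Z : 'M[F]_d.+1) (n : nat).
Variable e : {linear 'rV[K]_n.+1 -> Uspace Z p_mi}.

Lemma quo_model : bijective e ->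
  kernel_model Z p quo quo_rep (fun v => ker_val (e v)).
Proof.
move=> e_bij; split.
- exact: quo_repK.
- exact: quo_eq0.
- by move=> u v; rewrite linearD.
- by move=> u v /val_inj/(bij_inj e_bij).
- move=> q v; rewrite linearZ ker_valZ.
  by rewrite -[RHS]mul_ker_modp -quo_repE.
move=> u u0; have uP : in_ker_horner Z p u by apply/eqP.
have [e' _ e'K] := e_bij; exists (e' (KerHorner uP : Uspace Z p_mi)).
by rewrite e'K.
Qed.

End QuotientField.

Lemma alternating_skew (F : finFieldType) d (J : 'M[F]_d.+1) : alternating J -> J^T = - J.
Proof.
move=> altJ; apply/bilinear_ext => u v.
have uv0 : u *m J *m v^T + v *m J *m u^T = 0.
  have := altJ (u + v); rewrite linearD !mulmxDl !mulmxDr !altJ addr0 add0r addrC.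
  by rewrite addrC.
have -> : u *m J^T *m v^T = (v *m J *m u^T)^T by rewrite !trmx_mul trmxK mulmxA.
have -> : (v *m J *m u^T)^T = v *m J *m u^T.
  by rewrite [_ *m _]mx11_scalar tr_scalar_mx.
by rewrite mulmxN mulNmx; apply/eqP; rewrite -addr_eq0 addrC uv0.
Qed.

(** A scalar of order l would be a nontrivial l-th root of unity, against injectivity of the
    Frobenius map. *)
Lemma scalar_GL_pchar' l (K : finFieldType) n : l \in [pchar K] ->
  (l^'.-group (scalar_GL K n))%g.
Proof.
move=> l_char; have l_pr := pcharf_prime l_char.
rewrite /pgroup p'natE // ?cardG_gt0 //; apply/negP=> /(Cauchy l_pr)[x Zx ox].
have /scalar_GLP[a xa] := Zx.
have xl : (x ^+ l)%g = 1%g by rewrite -ox expg_order.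
have al : a ^+ l = 1.
  have := congr1 (@GLval _ _) xl; rewrite GL_X GL1 xa -rmorphXn /= => /matrixP/(_ 0 0).
  by rewrite !mxE eqxx.
have a1 : a = 1.
  apply: (fmorph_inj (pFrobenius_aut l_char)).
  by rewrite /= !pFrobenius_autE al expr1n.
have x1 : x = 1%g by apply: GL_inj; rewrite GL1 xa a1.
by move: ox; rewrite x1 order1 => l1; rewrite -l1 in l_pr.
Qed.

Section EigenRestriction.
Variables (F : finFieldType) (d : nat) (Z : 'M[F]_d.+1) (K : finFieldType) (n : nat).
Variables (p : {poly F}) (ev : {rmorphism {poly F} -> K}) (rep : K -> {poly F}).
Variable e : 'rV[K]_n.+1 -> 'rV[F]_d.+1.
Hypothesis mdl : kernel_model Z p ev rep e.
Variables (T : 'M[F]_d.+1) (A : 'M[K]_n.+1) (lam : K).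
Hypothesis eA : forall v, e (v *m A) = e v *m T.

Lemma eigen_restriction (x : 'rV[K]_n.+1) m : x *m A = lam *: x ->
  e x *m horner_mx T m = e ((map_poly (ev \o polyC) m).[lam] *: x).
Proof.
move=> xA; elim/poly_ind: m => [|q c IHq].
  by rewrite !rmorph0 horner0 scale0r mulmx0 (e0 mdl).
rewrite !(rmorphD, rmorphM) /= map_polyX map_polyC horner_mx_X horner_mx_C !hornerE.
rewrite scalerDl (model_eD mdl) (eC mdl) mulmxDr mul_mx_scalar -mulmxE mulmxA IHq.
by rewrite -eA -scalemxAl xA scalerA.
Qed.

End EigenRestriction.

Lemma irr_root1 (F : finFieldType) (K K' : fieldType) (f : {rmorphism F -> K})
    (f' : {rmorphism F -> K'}) (m : {poly F}) x :
  irreducible_poly m -> root (map_poly f m) x -> x != 1 -> ~~ root (map_poly f' m) 1.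
Proof.
move=> irr mx; apply: contra => m1.
have X1 (R : fieldType) (h : {rmorphism F -> R}) y :
    root (map_poly h ('X - 1%:P)) y = (y == 1).
  by rewrite rmorphB /= map_polyX map_polyC /= rmorph1 root_XsubC.
have : root (map_poly f' ('X - 1%:P)) 1 by rewrite X1.
move/(irr_dvd_root irr m1)/dvdpP=> [q qE].
by rewrite -(X1 _ f) qE rmorphM rootM mx orbT.
Qed.

(** * The main argument *)

Section Main.
Variables (l r : nat) (l_prime : prime l) (r_prime : prime r) (l_gt2 : (2 < l)%N).
Hypothesis neq_rl : r <> l.
Local Notation F := 'F_l.
Variables (d n t : nat) (J : 'M[F]_d.+1) (zeta : {'GL_d.+1[F]}) (phi : 'I_t -> {poly F}).
Hypotheses (J_unit : J \in unitmx) (J_skew : J^T = - J) (zeta_Sp : zeta \in Sp J).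
Hypotheses (n_ge3 : (3 <= n)%N) (dim_d : d.+1 = (n.+1 * (r - 1))%N).
Hypothesis phi_mi : forall j, monic_irreducible_poly (phi j).
Hypothesis phi_reps : factor_reps (geom_poly F r) phi.
Variables (L : closedFieldType) (iota : {rmorphism F -> L}).
Variables (zr : L) (zr_prim : r.-primitive_root zr).

Local Notation Z := (GLval zeta).
Local Notation C := ('C_(Sp J)[zeta])%g.
Local Notation K j := {poly %/ phi j with phi_mi j}.
Local Notation ev j := (quo (phi_mi j)).
Local Notation emb j := (ev j \o polyC).

Variable e : forall j, 'rV[K j]_n.+1 -> 'rV[F]_d.+1.
Hypothesis mdl : forall j, kernel_model Z (phi j) (ev j) (@quo_rep _ _ (phi_mi j)) (@e j).

Lemma l_pcharF : l \in [pchar F].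
Proof. exact: pchar_Fp. Qed.

Lemma l_pchar j : l \in [pchar K j].
Proof. by rewrite (fmorph_pchar (emb j)) l_pcharF. Qed.

Lemma twoF : 2%:R != 0 :> F.
Proof. by rewrite -(dvdn_pcharf l_pcharF) gtnNdvd. Qed.

Lemma twoK j : 2%:R != 0 :> K j.
Proof. by rewrite -(rmorph_nat (emb j)) fmorph_eq0 twoF. Qed.

Lemma ZJ : Z *m dag J Z = 1%:M.
Proof. by move: zeta_Sp; rewrite inE dag_unitary // => /eqP. Qed.

Definition rho j : {morphism C >-> GLfin (K j) n} := rho_morph (mdl j) J_unit ZJ.

Lemma r_gt0 : (0 < r)%N. Proof. exact: prime_gt0. Qed.

Let phi0 := phi0_neq0 iota r_gt0 phi_reps.

Lemma cardK j : #|{: K j}| = (#|{: F}| ^ (size (phi j)).-1)%N.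
Proof. exact: card_qfpoly. Qed.

Lemma rank_phi j : \rank (kermx (horner_mx Z (phi j))) = (n.+1 * (size (phi j)).-1)%N.
Proof. exact: (kernel_rank (mdl j) (cardK j)). Qed.

Lemma idem j : exists2 c, phi j %| c - 1 & horner_mx Z c *m horner_mx Z (phi j) = 0.
Proof. exact: (idempotent_poly iota r_gt0 zr_prim phi_mi phi_reps J_unit ZJ dim_d rank_phi). Qed.

Lemma sub_Gfactor j : Gfactor J zeta phi j \subset C.
Proof. by apply/subsetP=> A; rewrite inE => /andP[]. Qed.

Lemma fixes_complement_Gfactor j c A :
  horner_mx Z c *m horner_mx Z (phi j) = 0 ->
  A \in C -> fixes_complement J zeta c A -> A \in Gfactor J zeta phi j.
Proof.
move=> cp CA fixA; rewrite inE CA; apply/forallP=> k; apply/implyP=> neq.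
apply/eqP/row_matrixP=> i; rewrite row_mul.
by apply: fixA; have [] := Wmx_pi iota r_gt0 phi_mi phi_reps J_unit ZJ cp neq (row_sub i _).
Qed.

Lemma rho_Gfactor_neq j k A : k != j -> A \in Gfactor J zeta phi j -> rho k A = 1%g.
Proof.
move=> neq /setIdP[CA /forallP/(_ k)]; rewrite neq => /eqP WA.
apply: GL_inj; rewrite GL1; apply: (rho_fun_mx (mdl k) J_unit ZJ) => // v; rewrite mulmx1.
have: (e v <= Wmx zeta phi k)%MS.
  by apply: submx_trans (addsmxSl _ _); apply/sub_kermxP/(e_ker (mdl k)).
by case/submxP=> D ->; rewrite -mulmxA WA.
Qed.

(** Triviality on U_j extends to W_j by duality, and the W_j span the space. *)
Lemma rho_inj A : A \in C -> (forall j, rho j A = 1%g) -> A = 1%g.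
Proof.
move=> CA rA; have [cA AA] := Sp_centP zeta J_unit _ CA.
have WA j : Wmx zeta phi j *m GLval A = Wmx zeta phi j.
  have [c c1 cp] := idem j.
  apply: (Wmx_fix iota r_gt0 phi_reps J_unit J_skew ZJ c1 cp cA AA) => u /(model_sur (mdl j))[v <-].
  have := e_rho (mdl j) J_unit ZJ v CA; rewrite -[rho_fun _ _]/(rho j A) rA GL1 mulmx1.
  by move=> <-.
have /sub_sumsmxP[D DE] := Wmx_full iota r_gt0 zr_prim phi_mi phi_reps J_unit ZJ dim_d rank_phi.
have AE : GLval A = 1%:M.
  rewrite -[LHS]mul1mx DE mulmx_suml.
  by apply: eq_bigr => j _; rewrite -mulmxA WA.
exact: val_inj.
Qed.

Lemma rho_eq A B : A \in C -> B \in C -> (forall j, rho j A = rho j B) -> A = B.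
Proof.
move=> CA CB eq_r; apply/eqP; rewrite eq_mulgV1; apply/eqP/rho_inj.
  exact: groupM CA (groupVr CB).
move=> j; rewrite (morphM (rho j) CA (groupVr CB)) (morphV (rho j) CB) eq_r.
exact: mulgV.
Qed.

(** * The subgroup H and its images *)

Variables (H : {group {'GL_d.+1[F]}}) (H_sub : H \subset C).
Hypothesis H_proj : forall j, Sfactor J zeta phi j \subset proj_factor J zeta phi H j.

Lemma Sfactor_rho j s : s \in Sfactor J zeta phi j ->
  s \in C /\ exists2 h, h \in H & rho j s = rho j h.
Proof.
move=> Ss; have Cs : s \in C.
  by apply: subsetP (sub_Gfactor j) _ _; apply: subsetP (der_sub 1 _) _ Ss.
split=> //; have := subsetP (H_proj j) s Ss; rewrite inE => /andP[_ /existsP[h /andP[Hh /eqP Wh]]].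
have Ch := subsetP H_sub h Hh.
exists h; first exact: Hh.
apply: GL_inj; apply: (rho_fun_mx (mdl j) J_unit ZJ Cs) => v.
rewrite (e_rho (mdl j) J_unit ZJ v Ch).
have: (e v <= Wmx zeta phi j)%MS.
  by apply: submx_trans (addsmxSl _ _); apply/sub_kermxP/(e_ker (mdl j)).
by case/submxP=> D ->; rewrite -!mulmxA Wh.
Qed.

Lemma Sfactor_sub_single j : (forall k, k = j) -> Sfactor J zeta phi j \subset H.
Proof.
move=> single; apply/subsetP=> s /Sfactor_rho[Cs [h Hh eq_r]].
have sh : s = h by apply: (rho_eq Cs (subsetP H_sub h Hh)) => k; rewrite (single k).
by rewrite sh.
Qed.

Lemma single_factor (j k : 'I_t) : r = 2 -> j = k.
Proof.
move=> r2; have rootE i : root (map_poly iota (phi i)) zr.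
  have /closed_rootP[x px] : size (map_poly iota (phi i)) != 1%N.
    by rewrite size_map_poly gtn_eqF //; have [[]] := phi_mi i.
  have := phi_ndvd_root phi_reps px.
  rewrite (geom_poly_factor iota r_gt0 zr_prim) r2 big_nat1 expr1 root_XsubC => /eqP <-.
  exact: px.
apply/eqP; apply/negP=> /negP neq.
exact: (phi_no_common_root phi_mi phi_reps neq (rootE j) (rootE k)).
Qed.

Hypothesis r_gt2 : (2 < r)%N.

(** Otherwise X, being of odd order r as well, would be 1, and 1 + X + ... + X^(r-1) = 0 would read
    r = 0 in characteristic l. *)
Lemma ev_X_neq j : ev j 'X ^+ 2 != 1.
Proof.
apply/negP=> /eqP X2; have X_r : ev j 'X ^+ r = 1.
  apply/eqP; rewrite -subr_eq0 -rmorphXn -(rmorph1 (ev j)) -rmorphB quo_eq0 -geom_polyE.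
  by have [dv _] := phi_reps; apply: dvdp_mull.
have r_odd : odd r by case: (even_prime r_prime) => // r2; move: r_gt2; rewrite r2.
have X1 : ev j 'X = 1.
  by rewrite -X_r -(odd_double_half r) r_odd exprS -mul2n exprM X2 expr1n mulr1.
have : ev j (geom_poly F r) = 0 by apply/eqP; rewrite quo_eq0; have [] := phi_reps.
rewrite rmorph_sum; under eq_bigr do rewrite rmorphXn X1 expr1n.
rewrite sumr_const card_ord => /eqP; rewrite -(dvdn_pcharf (l_pchar j)).
by rewrite dvdn_prime2 // => /eqP lr; case: neq_rl.
Qed.

(** The isometries lifting prescribed restrictions act trivially on the other summands, so G_j alone
    already maps onto the whole image. Hence S_j maps onto its derived group. *)
Lemma local_image j :
  classical_group (rho j @* C)%g /\ (rho j @* Gfactor J zeta phi j = rho j @* C)%g.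
Proof.
have [c c1 cp] := idem j.
have sG : (rho j @* Gfactor J zeta phi j \subset rho j @* C)%g.
  by apply: morphimS; apply: sub_Gfactor.
have lift (G : {set GLfin (K j) n}) : (forall A, A \in C -> rho j A \in G) ->
    (forall a, a \in G -> exists A, [/\ A \in C, rho j A = a & fixes_complement J zeta c A]) ->
    (rho j @* C = G /\ rho j @* Gfactor J zeta phi j = rho j @* C)%g.
  move=> rG liftG.
  have sCG : (rho j @* C \subset G)%g by apply/subsetP=> _ /morphimP[A CA _ ->]; apply: rG.
  have sGG : (G \subset rho j @* Gfactor J zeta phi j)%g.
    apply/subsetP=> a /liftG[A [CA <- fixA]]; apply: mem_morphim => //.
    exact: fixes_complement_Gfactor cp CA fixA.
  split; apply/eqP; rewrite eqEsubset ?sCG ?sG /=; first exact: subset_trans sGG sG.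
  exact: subset_trans sCG sGG.
have [eq_r | neq_r] := eqVneq (phi j) (recip (phi j)).
  have pi_dag := pi_pi'_eq iota r_gt0 phi_reps J_unit J_skew ZJ c1 cp eq_r.
  have nz_p : phi j != 0 by rewrite monic_neq0 //; have [] := phi_mi j.
  have [s [M [x [sK sx nzx Msk [Mu [rG liftG]]]]]] :=
    local_GU (mdl j) J_unit J_skew ZJ c1 cp nz_p (cardK j) (@quo_coef0D _ _ (phi_mi j))
      (@quo_coef0_1 _ _ (phi_mi j)) (@quo_coef0Z _ _ (phi_mi j)) twoF (phi0 j) (esym eq_r) pi_dag (ev_X_neq j).
  have [CG GC] := lift _ rG liftG; split=> //; right.
  by exists s, M, x; split=> //.
have pp' := pi_pi'_neq iota r_gt0 phi_mi phi_reps J_unit ZJ cp neq_r.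
have [CG GC] := lift [set: GLfin (K j) n] (fun A _ => in_setT _)
  (fun a _ => local_GL (mdl j) J_unit J_skew ZJ c1 cp pp' a).
by split=> //; left.
Qed.

(** * The element tau and the exclusion of identifications *)

Variables (tau : {'GL_d.+1[F]}) (tau_H : tau \in H).
Variables (lam : forall j, K j) (A : forall j, 'M[K j]_n.+1).
Hypothesis lam_prim : forall j, r.-primitive_root (lam j).
Hypothesis eA : forall j v, e (v *m A j) = e v *m GLval tau.
Hypothesis chiA : forall j, char_poly (A j) = ('X - 1) ^+ n * ('X - (lam j)%:P).
Variable N : nat.
Hypothesis tau_eigen : map_poly iota (char_poly (GLval tau))
  = ('X - 1) ^+ N * \prod_(1 <= k < r) ('X - (zr ^+ k)%:P).

Lemma tau_C : tau \in C. Proof. exact: subsetP H_sub _ tau_H. Qed.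

Lemma rho_tau j : GLval (rho j tau) = A j.
Proof. by apply: (rho_fun_mx (mdl j) J_unit ZJ tau_C) => v; rewrite eA. Qed.

Lemma rho_der_sub j : ((rho j @* C)^`(1) \subset rho j @* H)%g.
Proof.
have [_ <-] := local_image j; rewrite -(morphim_der _ 1 (sub_Gfactor j)) derg1.
apply/subsetP=> _ /morphimP[s Cs Ss ->].
have [_ [h Hh ->]] := Sfactor_rho Ss.
exact: mem_morphim (subsetP H_sub h Hh) Hh.
Qed.

Lemma lam_neq1 j : lam j != 1.
Proof.
apply/negP=> /eqP l1; have := prim_order_dvd (lam_prim j) 1.
by rewrite l1 expr1 eqxx dvdn1 => /eqP r1; move: r_gt2; rewrite r1.
Qed.

Lemma lam_neq0 j : lam j != 0.
Proof.
apply/negP=> /eqP l0; move: (prim_expr_order (lam_prim j)) => /eqP.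
by rewrite l0 expr0n gtn_eqF ?r_gt0 // eq_sym oner_eq0.
Qed.

Lemma power_ex : exists k, (n < l ^ k)%N /\ l ^ k = 1 %[mod r].
Proof.
(* The factor [totient r] gives 1 modulo r by Euler's theorem, the factor [n.+1] makes the power
   exceed n. *)
exists (totient r * n.+1)%N; split.
  apply: (@leq_trans (totient r * n.+1)); first by rewrite leq_pmull // totient_gt0 r_gt0.
  by apply/ltnW/ltn_expl/prime_gt1.
rewrite expnM -modnXm Euler_exp_totient ?modnXm ?exp1n //.
by rewrite prime_coprime // dvdn_prime2 //; apply/eqP=> lr; case: neq_rl.
Qed.

Lemma tau_eigenvector j : exists2 x : 'rV_n.+1, x != 0 & x *m A j = lam j *: x.
Proof.
have : eigenvalue (A j) (lam j).
  by rewrite eigenvalue_root_char chiA rootM root_XsubC eqxx orbT.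
by case/eigenvalueP=> x xA nzx; exists x.
Qed.

Lemma lam_min_poly j : exists2 m : {poly F}, monic_irreducible_poly m & root (map_poly (emb j) m) (lam j).
Proof.
apply: (min_poly_ex (iota := emb j) (q := 'X^r - 1)).
  by rewrite -size_poly_gt0 size_XnsubC ?r_gt0.
rewrite rmorphB rmorph1 /= map_polyXn rootE !hornerE.
by rewrite (prim_expr_order (lam_prim j)) subrr.
Qed.

Lemma min_poly_root1 j (m : {poly F}) (R : fieldType) (f : {rmorphism F -> R}) :
  irreducible_poly m -> root (map_poly (emb j) m) (lam j) -> ~~ root (map_poly f m) 1.
Proof.
by move=> irr mlam; apply: irr_root1 irr mlam (lam_neq1 j). Qed.

(** As [lam j] differs from 1, so does its conjugate [mu]; only the separable factor of the
    characteristic polynomial can contribute. *)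
Lemma simple_eigenvalue j (m : {poly F}) mu : irreducible_poly m ->
  root (map_poly (emb j) m) (lam j) -> root (map_poly iota m) mu ->
  ~~ (('X - mu%:P) ^+ 2 %| map_poly iota (char_poly (GLval tau))).
Proof.
move=> irr mlam mmu; have mu1 : mu != 1.
  by apply: contraTneq mmu => ->; apply: min_poly_root1 irr mlam.
rewrite tau_eigen mulrC Gauss_dvdpl; last first.
  have X1 : 'X - 1 = 'X - 1%:P :> {poly L} by rewrite polyC1.
  by rewrite X1 coprimep_expl // coprimep_expr // coprimep_XsubC root_XsubC eq_sym.
rewrite -(big_map (fun k => zr ^+ k) predT (fun z => 'X - z%:P)).
apply/negP=> /dvdpP[q qE].
have : separable_poly (\prod_(z <- [seq zr ^+ k | k <- index_iota 1 r]) ('X - z%:P)).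
  rewrite separable_prod_XsubC map_inj_in_uniq ?iota_uniq // => i k.
  rewrite !mem_index_iota => /andP[_ lti] /andP[_ ltk] /eqP.
  by rewrite (eq_prim_root_expr zr_prim) !modn_small // => /eqP.
rewrite qE expr2 !separable_mul => /and3P[_ /and3P[_ _ cop] _].
by move: cop; rewrite coprimepp size_XsubC.
Qed.

(** A shared root yields a multiple eigenvalue of [tau] from two kernels of coprime polynomials. For
    the inverse of [lam k] the second kernel is the dual one, reached through the adjoint of [tau],
    which acts on U_k as the inverse of [tau]. *)
Lemma common_root_absurd j k (m : {poly F}) : j != k -> irreducible_poly m ->
  root (map_poly (emb j) m) (lam j) ->
  ~~ root (map_poly (emb k) m) (lam k) /\ ~~ root (map_poly (emb k) m) (lam k)^-1.
Proof.
move=> neq irr mlam.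
have /closed_rootP[mu mmu] : size (map_poly iota m) != 1%N.
  by rewrite size_map_poly gtn_eqF //; case: irr.
have nsq := simple_eigenvalue irr mlam mmu.
have [cT TT] := Sp_centP zeta J_unit _ tau_C.
have [x nzx xA] := tau_eigenvector j; have [y nzy yA] := tau_eigenvector k.
have e_neq0 i (v : 'rV[K i]_n.+1) : v != 0 -> e v != 0.
  by apply: contra => /eqP ev0; apply/eqP/(model_inj (mdl i)); rewrite ev0 (e0 (mdl i)).
have xm : e x *m horner_mx (GLval tau) m = 0.
  by rewrite (eigen_restriction (mdl j) (eA (j := j)) m xA) (rootP mlam) scale0r (e0 (mdl j)).
have xZ := e_ker (mdl j) x; have yZ := e_ker (mdl k) y.
split; apply: contra nsq => mk.
  have cop : coprimep (phi j) (phi k).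
    apply: (coprimep_no_root (iota := iota)) => z zj; apply/negP=> zk.
    exact: (phi_no_common_root phi_mi phi_reps neq zj zk).
  apply: (common_eigenvalue_dvd cT cop irr mmu (e_neq0 _ _ nzx) xZ xm (e_neq0 _ _ nzy) yZ).
  by rewrite (eigen_restriction (mdl k) (eA (j := k)) m yA) (rootP mk) scale0r (e0 (mdl k)).
have cop : coprimep (phi j) (recip (phi k)).
  apply: (coprimep_no_root (iota := iota)) => z zj; apply/negP=> zk.
  exact: (phi_recip_no_common_root r_gt0 phi_mi phi_reps neq zj zk).
have [c c1 cp] := idem k.
have ypi : e y *m horner_mx Z c = e y by apply: (pi_e (mdl k) c1).
have uA : A k \in unitmx by rewrite -rho_tau; apply: valP.
have yA' : y *m invmx (A k) = (lam k)^-1 *: y.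
  by rewrite -[y in LHS](scalerK (lam_neq0 k)) -yA -scalemxAl mulmxK.
have eA' v : e (v *m invmx (A k)) = e v *m dag J (GLval tau).
  by rewrite -[v in RHS](mulmxKV uA) eA -mulmxA TT mulmx1.
have ym : e y *m horner_mx (dag J (GLval tau)) m = 0.
  by rewrite (eigen_restriction (mdl k) eA' m yA') (rootP mk) scale0r (e0 (mdl k)).
have [w [nzw wZ wm]] := dual_eigenvector J_unit J_skew ZJ cT TT (phi0 k) c1 cp (e_neq0 _ _ nzy) ypi ym.
exact: (common_eigenvalue_dvd cT cop irr mmu (e_neq0 _ _ nzx) xZ xm nzw wZ wm).
Qed.

Definition scal j : {group GLfin (K j) n} := scalar_GL_group (K j) n.

Lemma tau_power : exists2 tau', tau' \in H & forall j,
  exists (a : 'rV[K j]_n.+1) (f : 'cV[K j]_n.+1),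
    a *m f = (lam j - 1)%:M /\ GLval (rho j tau') = 1%:M + f *m a.
Proof.
have [k [lt_n lk]] := power_ex; exists (tau ^+ (l ^ k))%g; first exact: (groupX (l ^ k) tau_H).
move=> j; have lamX : lam j ^+ (l ^ k) = lam j.
  rewrite -(expr_mod _ (prim_expr_order (lam_prim j))) lk modn_small ?expr1 //.
  exact: ltnW.
have [a [f [af AE]]] := pseudo_reflection (l_pchar j) (lam_neq1 j) lt_n lamX (chiA j).
exists a, f; split=> //; rewrite -AE -rho_tau -GL_X.
by rewrite (morphX (rho j) (l ^ k) tau_C).
Qed.

Lemma local_root_subgroup j tau' (a : 'rV[K j]_n.+1) (f : 'cV[K j]_n.+1) (m : {poly F}) :
  tau' \in C -> a *m f = (lam j - 1)%:M -> GLval (rho j tau') = 1%:M + f *m a ->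
  root (map_poly (emb j) m) (lam j) ->
  exists Q : {group GLfin (K j) n}, (Q \subset (rho j @* C)^`(1))%g
    /\ root_subgroup (rho j tau') m Q.
Proof.
move=> Ct af tauE mlam; have [clG _] := local_image j.
apply: (classical_root_subgroup (G := (rho j @* C)%G) n_ge3 (twoK j) clG (l_pchar j) _
  (lam_neq1 j) (lam_neq0 j) af tauE mlam).
exact: mem_morphim.
Qed.

(** The derived group contains a root subgroup, which is not centralized by the reflection. *)
Lemma der_not_scalar j : ~~ ((rho j @* C)^`(1) \subset scal j)%g.
Proof.
have [tau' Ht' refl] := tau_power; have [a [f [af tauE]]] := refl j.
have [m _ mlam] := lam_min_poly j.
have [Q [sQ [_ _ [q Qq ne1] _]]] := local_root_subgroup (subsetP H_sub _ Ht') af tauE mlam.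
apply: contra ne1 => sS; apply/commgP.
by have /centsP := scalar_GL_cent [set rho j tau']; apply; rewrite ?set11 ?(subsetP sS) ?(subsetP sQ).
Qed.

Lemma not_both_scalar j k : j != k ->
  ~ (partial_image H rho j k \subset scal j /\ partial_image H rho k j \subset scal k)%g.
Proof.
move=> neq [jk kj]; have [tau' Ht' refl] := tau_power.
have [a [f [af tauE]]] := refl j; have [b [h [bh tauEk]]] := refl k.
have Ct' := subsetP H_sub _ Ht'.
have [m [irr _] mlam] := lam_min_poly j.
have [Q [sQ rootQ]] := local_root_subgroup Ct' af tauE mlam.
have sQH : (Q \subset rho j @* H)%g := subset_trans sQ (rho_der_sub j).
have [P [lP nP ntP derP]] := root_subgroup_transfer (Z := scal) H_sub
  (fun i => @scalar_GL_cent (K i) n _) (fun i => scalar_GL_pchar' n (l_pchar i)) Ht' jk kj sQH rootQ.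
have [mk mkV] := common_root_absurd neq irr mlam.
have m1 : ~~ root (map_poly (emb k) m) 1 := min_poly_root1 (emb k) irr mlam.
case/eqP: ntP.
have nz : lam k - 1 != 0 by rewrite subr_eq0 lam_neq1.
(* Division by [lam k - 1] turns the rank one matrix [h *m b] into the idempotent of the
   reflection. *)
apply: (word_trivial (l_pchar k) lP nP (e := (lam k - 1)^-1 *: (h *m b)) _ (lam_neq0 k) _ m1 mk mkV derP).
  rewrite -scalemxAl -scalemxAr -(mulmxA h) (mulmxA b) bh mul_scalar_mx -scalemxAr.
  by congr (_ *: _); rewrite scalerA mulVf // scale1r.
by rewrite tauEk scalerA mulfV // scale1r.
Qed.

(** Goursat's argument for all other coordinates at once gives an element of [H] that agrees with
    [s] on U_j and is trivial on the other U_k; the restrictions together are faithful, so it is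
    [s]. *)
Lemma Sfactor_sub j : Sfactor J zeta phi j \subset H.
Proof.
apply/subsetP=> s Ss; have Gs : s \in Gfactor J zeta phi j by apply: subsetP (der_sub 1 _) _ Ss.
have Cs := subsetP (sub_Gfactor j) _ Gs.
have clG i := (local_image i).1.
have rs : rho j s \in ((rho j @* C)^`(1))%g.
  have [_ <-] := local_image j; rewrite -(morphim_der _ 1 (sub_Gfactor j)).
  exact: mem_morphim.
pose others := [seq k <- enum 'I_t | k != j].
have nj : j \notin others by rewrite mem_filter eqxx.
have := subsetP (goursat (Z := scal) H_sub
  (fun i => classical_der_perfect (G := (rho i @* C)%G) n_ge3 (twoK i) (clG i))
  der_not_scalar
  (fun i N sN nN => classical_normal_dichotomy (G := (rho i @* C)%G) n_ge3 (twoK i) (clG i) sN nN)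
  rho_der_sub not_both_scalar nj) _ rs.
case/morphimP=> h Ch; rewrite inE => /andP[Hh /allP h1] eq_h.
suff sh : s = h by rewrite sh.
apply: (rho_eq Cs Ch) => k; have [-> | neq] := eqVneq k j; first exact: eq_h.
have hk : rho k h = 1%g by apply/eqP/h1; rewrite mem_filter neq mem_enum.
exact: etrans (rho_Gfactor_neq neq Gs) (esym hk).
Qed.

End Main.

Theorem theorem3p17
  (l r : nat) (l_prime : prime l) (r_prime : prime r)
  (l_ge5 : (5 <= l)%N) (neq_rl : r <> l)
  (* V is the space of row vectors of length d.+1 = 2g, with form J *)
  (g d n : nat) (dim_V : d.+1 = (2 * g)%N)
  (J : 'M['F_l]_d.+1) (J_alt : alternating J) (J_nondeg : J \in unitmx)
  (zeta : {'GL_d.+1['F_l]}) (zeta_Sp : zeta \in Sp J)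
  (n_def : (n * (r - 1) = 2 * g)%N) (n_ge4 : (4 <= n)%N)
  (zeta_char : char_poly (GLval zeta) = geom_poly 'F_l r ^+ n)
  (* j : 'I_t indexes the factors G_j *)
  (t : nat) (phi : 'I_t -> {poly 'F_l})
  (phi_mi : forall j, monic_irreducible_poly (phi j))
  (phi_reps : factor_reps (geom_poly 'F_l r) phi)
  (H : {group {'GL_d.+1['F_l]}}) (H_sub : H \subset 'C_(Sp J)[zeta]%g)
  (H_proj : forall j, Sfactor J zeta phi j \subset proj_factor J zeta phi H j)
  (tau : {'GL_d.+1['F_l]}) (tau_H : tau \in H)
  (tau_proj : forall j,
     one_nontrivial_eigenvalue_of_order (GLval zeta) (phi_mi j) r n (GLval tau))
  (* L is an algebraic closure of 'F_l *)
  (L : closedFieldType) (iota : {rmorphism 'F_l -> L})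
  (L_alg : forall x : L, algebraicOver iota x)
  (zr : L) (zr_prim : r.-primitive_root zr)
  (tau_eigen : map_poly iota (char_poly (GLval tau))
     = ('X - 1) ^+ (2 * g - (r - 1)) * \prod_(1 <= k < r) ('X - (zr ^+ k)%:P)) :
  (\prod_(j < t) Sfactor J zeta phi j)%g \subset H.
Proof.
have J_skew := alternating_skew J_alt.
case: n n_def n_ge4 tau_proj {zeta_char} => [|n'] // n_def' n_ge4' tau_proj'.
have dim_d : d.+1 = (n'.+1 * (r - 1))%N by rewrite n_def'.
have l_gt2 : (2 < l)%N by apply: leq_trans l_ge5.
have /fin_all_exists[lam lamP] := tau_proj'.
have /fin_all_exists[A /fin_all_exists[e eP]] := fun j => (lamP j).2.
have mdl j := let: And3 ebij _ _ := eP j in quo_model ebij.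
have eA j := let: And3 _ eA _ := eP j in eA.
have chiA j := let: And3 _ _ chi := eP j in chi.
have Ssub j : Sfactor J zeta phi j \subset H.
  have [r_gt2 | r_le2] := ltnP 2 r.
    exact: (Sfactor_sub l_prime r_prime l_gt2 neq_rl J_nondeg J_skew zeta_Sp n_ge4' dim_d
      phi_reps zr_prim mdl H_sub H_proj r_gt2 tau_H (fun i => (lamP i).1) eA chiA tau_eigen j).
  have r2 : r = 2 by apply/eqP; rewrite eqn_leq r_le2 prime_gt1.
  apply: (Sfactor_sub_single r_prime J_nondeg J_skew zeta_Sp dim_d phi_reps iota zr_prim mdl H_sub H_proj).
  by move=> k; apply: (single_factor r_prime phi_mi phi_reps iota zr_prim).
elim/big_ind: _ => [|X Y sX sY|j _]; [exact: sub1G | exact: mul_subG | exact: Ssub].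
Qed.
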